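(* If $\ell_\ast(\mathcal G):=\inf_{e\in\mathcal E}|e|>0$ and $\ell^\ast(\mathcal G):=\sup_{e\in\mathcal E}|e|<\infty$, then the following are equivalent: (i) $\lambda_0(\mathbf H)>0$; (ii) $\lambda_0^{\mathrm{ess}}(\mathbf H)>0$; (iii) $\alpha_{\mathrm{comb}}(\mathcal V)>0$; (iv) $\alpha_{\mathrm{comb}}^{\mathrm{ess}}(\mathcal V)>0$.
   Context: Setting. $\mathcal G_d=(\mathcal V,\mathcal E)$ is an unoriented, connected, locally finite, simple graph with countably infinite $\mathcal V$ and $\mathcal E$. Each edge $e$ has a length $|e|\in(0,\infty)$ and is identified with $[0,|e|]$; gluing endpoints gives the metric graph $\mathcal G=(\mathcal V,\mathcal E,|\cdot|)$. $\mathcal E_v$ is the set of edges incident to $v$, $\deg(v)=\#\mathcal E_v$. Standing assumption: $\deg(v)\ne2$ for all $v$. Operator. $L^2(\mathcal G)=\bigoplus_eL^2(e)$. $\mathbf H_0$ acts as $-d^2/dx_e^2$ on each edge, on functions $f=(f_e)_e$ with $f_e\in H^2(e)$, nonzero on only finitely many edges, such that at every vertex $v$ the function $f$ is continuous and $\sum_{e\in\mathcal E_v}f_e'(v)=0$ (derivatives from $v$ into the edge); at degree-one vertices this is the Neumann condition $f_e'(v)=0$, and at any of the degree-one vertices it may be replaced by the Dirichlet condition $f_e(v)=0$ (mixed conditions are allowed). The Kirchhoff Laplacian $\mathbf H$ is the self-adjoint operator associated with the closure of the form $f\mapsto\int_{\mathcal G}|f'|^2dx$ on $\mathrm{dom}(\mathbf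 H_0)$. $\lambda_0(\mathbf H)=\inf\sigma(\mathbf H)$, $\lambda_0^{\mathrm{ess}}(\mathbf H)=\inf\sigma_{\mathrm{ess}}(\mathbf H)$ ($=+\infty$ if $\sigma_{\mathrm{ess}}(\mathbf H)=\varnothing$). Combinatorial isoperimetric constants. For $X\subseteq\mathcal V$ finite, $\partial X$ is the set of edges connecting $X$ with $\mathcal V\setminus X$ and $\deg(X)=\sum_{v\in X}\deg(v)$. For $Y\subseteq\mathcal V$, $\alpha_{\mathrm{comb}}(Y)=\inf\{\#(\partial X)/\deg(X):X\subseteq Y\text{ finite, nonempty}\}$, and $\alpha_{\mathrm{comb}}^{\mathrm{ess}}(\mathcal V)=\sup\{\alpha_{\mathrm{comb}}(\mathcal V\setminus X):X\subseteq\mathcal V\text{ finite}\}$.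
   Formalization: The full equivalence is stated when only finitely many degree-one vertices carry the Dirichlet condition (it fails in general for infinitely many); for arbitrary Dirichlet sets only (i)⇔(ii), (iii)⇔(iv) and (iii)⇒(i) are stated. *)

(* Defs.v *)
From HB Require Import structures.
From mathcomp Require Import all_boot all_order all_algebra finmap.
From mathcomp Require Import all_classical all_reals all_analysis.
From mathcomp Require Import complex.

Set Implicit Arguments.
Unset Strict Implicit.
Unset Printing Implicit Defensive.

Import Order.TTheory GRing.Theory Num.Theory.
Import numFieldNormedType.Exports.

Local Open Scope classical_set_scope.
Local Open Scope ring_scope.
Local Open Scope complex_scope.

(* The edge [e] is identified with the interval [0, len e], where 0 is glued to
   [init e] and [len e] to [term e]. The orientation is only used for this
   identification; [simple_edges] rules out parallel and antiparallel edges. *)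
Record metricGraph (R : realType) := MetricGraph {
  vertex : countType ;
  edge : countType ;
  init : edge -> vertex ;
  term : edge -> vertex ;
  len : edge -> R ;
  vertex_infinite : infinite_set [set: vertex] ;
  edge_infinite : infinite_set [set: edge] ;
  loopless : forall e, init e != term e ;
  simple_edges : forall e e',
    (init e = init e' /\ term e = term e') \/
    (init e = term e' /\ term e = init e') -> e = e' ;
  locally_finite : forall v,
    finite_set [set e | (init e == v) || (term e == v)] ;
  connected_graph : forall v w,
    exists p : seq vertex,
      path (fun x y => `[< exists e, (init e = x /\ term e = y) \/
                                     (init e = y /\ term e = x) >]) v p /\
      last v p = w ;
  len_gt0 : forall e, 0 < len e
}.

Section MetricGraph.
Context {R : realType}.
Variable G : metricGraph R.
Local Notation V := (vertex G).
Local Notation E := (edge G).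

Definition star (v : V) : set E := [set e | (init e == v) || (term e == v)].

Definition deg (v : V) : nat := #|` fset_set (star v)|.

Definition edge_boundary (X : {fset V}) : set E :=
  [set e | (init e \in X) (+) (term e \in X)].

Definition deg_fset (X : {fset V}) : nat := (\sum_(v <- X) deg v)%N.

Definition alpha_comb (Y : set V) : \bar R :=
  ereal_inf [set (#|` fset_set (edge_boundary X)|%:R / (deg_fset X)%:R)%:E
            | X in [set X : {fset V} | X != fset0 /\ [set` X] `<=` Y]].

Definition alpha_comb_ess : \bar R :=
  ereal_sup [set alpha_comb (~` [set` X]) | X in [set: {fset V}]].

(* Elements of L^2(G) are represented by functions, two functions being
   identified when the squared norm of their difference is 0. Values outside
   [0, len e] are irrelevant. *)

Local Notation efun := (E -> R -> R[i]).

Definition measurable_funC (D : set R) (f : R -> R[i]) :=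
  measurable_fun D (fun x => complex.Re (f x)) /\
  measurable_fun D (fun x => complex.Im (f x)).

Definition integralC (D : set R) (f : R -> R[i]) : R[i] :=
  (\int[lebesgue_measure]_(x in D) complex.Re (f x)) +i*
  (\int[lebesgue_measure]_(x in D) complex.Im (f x)).

Definition sqnorm_itv (l : R) (f : R -> R[i]) : \bar R :=
  (\int[lebesgue_measure]_(x in `[0%R, l]) ((Normc.normc (f x)) ^+ 2)%:E)%E.

Definition sqnorm (f : efun) : \bar R :=
  \esum_(e in [set: E]) sqnorm_itv (len e) (f e).

Definition L2 (f : efun) : Prop :=
  (forall e, measurable_funC `[0, len e] (f e)) /\ (sqnorm f < +oo)%E.

(* The sum of an absolutely summable family. *)
Definition sumE (a : E -> R) : R :=
  fine (\esum_(e in [set: E]) (Num.max (a e) 0)%:E) -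
  fine (\esum_(e in [set: E]) (Num.max (- a e) 0)%:E).

Definition sumEC (a : E -> R[i]) : R[i] :=
  sumE (fun e => complex.Re (a e)) +i* sumE (fun e => complex.Im (a e)).

Definition inner (f g : efun) : R[i] :=
  sumEC (fun e => integralC `[0, len e] (fun x => f e x * conjc (g e x))).

(* [f] is the C^1 representative of an element of H^2(0, l), with derivative
   [f'] on [0, l]: both [f] and [f'] are absolutely continuous, i.e. indefinite
   integrals, and the derivative of [f'] is square integrable. *)
Definition H2 (l : R) (f f' : R -> R[i]) : Prop :=
  exists f'' : R -> R[i],
    [/\ measurable_funC `[0, l] f'', (sqnorm_itv l f'' < +oo)%E,
        forall x, x \in `[0, l] -> f' x = f' 0 + integralC `[0, x] f'' &
        forall x, x \in `[0, l] -> f x = f 0 + integralC `[0, x] f'].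

Definition vertex_value (f : efun) (e : E) (v : V) : R[i] :=
  if init e == v then f e 0 else f e (len e).

(* Derivative from [v] into [e]. *)
Definition inward_deriv (f' : efun) (e : E) (v : V) : R[i] :=
  if init e == v then f' e 0 else - f' e (len e).

(* [f] is in the domain of H_0, with (edgewise) derivative [f']; [D] is the set
   of (degree-one) vertices carrying the Dirichlet condition. On each edge [f']
   is determined by [f]. *)
Definition dom_H0 (D : set V) (f f' : efun) : Prop :=
  [/\ forall e, H2 (len e) (f e) (f' e),
      finite_set [set e | exists2 x, x \in `[0, len e] & f e x != 0],
      forall v, ~ D v -> forall e e', star v e -> star v e' ->
        vertex_value f e v = vertex_value f e' v,
      forall v, ~ D v -> \sum_(e \in star v) inward_deriv f' e v = 0 &
      forall v, D v -> forall e, star v e -> vertex_value f e v = 0].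

(* [u] converges to [f] in L^2 and is Cauchy for the form int |f'|^2 on
   dom(H_0), so that [f] lies in the domain of the closure of the form. *)
Definition form_approx (D : set V) (u u' : nat -> efun) (f : efun) : Prop :=
  [/\ forall n, dom_H0 D (u n) (u' n),
      (fun n => sqnorm (fun e x => u n e x - f e x)) @ \oo --> 0%E &
      forall eps : R, 0 < eps -> exists N, forall m n, (N <= m)%N -> (N <= n)%N ->
        (sqnorm (fun e x => u' m e x - u' n e x)%R < eps%:E)%E].

Definition form_dom (D : set V) (f : efun) : Prop :=
  L2 f /\ exists u u', form_approx D u u' f.

(* [closed_form D f h c]: [f] and [h] are in the domain of the closed form,
   whose (sesquilinear) value at [(f, h)] is [c]. *)
Definition closed_form (D : set V) (f h : efun) (c : R[i]) : Prop :=
  [/\ L2 f, L2 h &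
      exists u u' w w', [/\ form_approx D u u' f, form_approx D w w' h &
        (fun n => Normc.normc (inner (u' n) (w' n) - c)) @ \oo --> (0 : R)]].

(* [kirchhoff D f g] means: f \in dom(H) and H f = g. This is the operator
   associated with the closed form by the first representation theorem. *)
Definition kirchhoff (D : set V) (f g : efun) : Prop :=
  [/\ form_dom D f, L2 g &
      forall h c, closed_form D f h c -> c = inner g h].

(* [T] is the graph of an operator in L^2(G). *)
Definition resolvent_set (T : efun -> efun -> Prop) : set R[i] :=
  [set z | (forall g, L2 g -> exists f h,
              T f h /\ sqnorm (fun e x => h e x - z * f e x - g e x) = 0%E) /\
           (exists C : R, forall f h, T f h ->
              (sqnorm f <= C%:E * sqnorm (fun e x => h e x - z * f e x)%R)%E)].

Definition spectrum (T : efun -> efun -> Prop) : set R[i] :=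
  ~` resolvent_set T.

Definition eigenspace (T : efun -> efun -> Prop) (z : R[i]) : set efun :=
  [set f | exists2 h, T f h & sqnorm (fun e x => h e x - z * f e x) = 0%E].

Definition discrete_spectrum (T : efun -> efun -> Prop) : set R[i] :=
  [set z | [/\ spectrum T z,
      exists2 eps : R, 0 < eps &
        forall y, spectrum T y -> Normc.normc (y - z) < eps -> y = z,
      exists2 f, eigenspace T z f & sqnorm f != 0%E &
      exists n (b : 'I_n -> efun), (forall i, eigenspace T z (b i)) /\
        forall f, eigenspace T z f -> exists c : 'I_n -> R[i],
          sqnorm (fun e x => f e x - \sum_(i < n) c i * b i e x) = 0%E]].

Definition ess_spectrum (T : efun -> efun -> Prop) : set R[i] :=
  spectrum T `\` discrete_spectrum T.

(* Infimum of the real points of [S]; the spectrum of a self-adjoint operator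
   is real. *)
Definition inf_real (S : set R[i]) : \bar R :=
  ereal_inf [set x%:E | x in [set x : R | S x%:C]].

(* If D is infinite, lambda0 may be positive although alpha_comb [set: V] = 0:
   attach to every vertex of the line graph on the integers a pendant edge with
   a Dirichlet end, all lengths being 1. Then int |f|^2 <= 3 int |f'|^2, while n
   consecutive integers and their pendants have boundary 2 and degree 4n. *)
Definition lambda0 (D : set V) : \bar R := inf_real (spectrum (kirchhoff D)).

Definition lambda0_ess (D : set V) : \bar R :=
  inf_real (ess_spectrum (kirchhoff D)).

Definition len_inf : \bar R := ereal_inf [set (len e)%:E | e in [set: E]].
Definition len_sup : \bar R := ereal_sup [set (len e)%:E | e in [set: E]].

End MetricGraph.

(* Main.v *)
(** Only the point 0 of the spectrum matters.  If 0 lies in the resolvent set and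
    [H f = phi], then [|phi|^2 = a(f, phi)] for the form [a], and Cauchy-Schwarz
    for [a] yields the form bound [|phi|^2 <= C a(phi, phi)].  Conversely, under a
    form bound, [(H - x) f = g] is solved for [x < 1 / (2 C)] by minimising
    [a(f, f) - x |f|^2 - 2 Re (g, f)]; hence [0 < lambda0] is equivalent to the
    form bound.  Moreover 0 is never an eigenvalue: a function of zero energy is
    constant, and the total length is infinite.  So 0 cannot be a discrete
    spectral value, and [0 < lambda0_ess] already puts 0 in the resolvent set.

    On the graph side, the layer-cake formula applied to [v |-> |f(v)|^2] turns
    [alpha_comb > 0] into the form bound; conversely smooth cutoffs of finite
    vertex sets avoiding [D] turn the form bound into
    [alpha_comb (V \ D) > 0].  Removing finitely many vertices does not affect
    positivity, because every finite nonempty set has a nonempty boundary. *)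

Require Import Defs.
From mathcomp Require Import all_boot all_order all_algebra finmap.
From mathcomp Require Import all_classical all_reals all_analysis.
From mathcomp Require Import measurable_realfun complex ring lra.

Set Implicit Arguments.
Unset Strict Implicit.
Unset Printing Implicit Defensive.

(** * Square integrable functions on an interval *)

Section IntervalCalculus.
Import Order.TTheory GRing.Theory Num.Theory.
Import numFieldNormedType.Exports.
Local Open Scope classical_set_scope.
Local Open Scope ring_scope.
Context {R : realType}.
Local Notation mu := (@lebesgue_measure R).
Implicit Types (f g : R -> R) (a b : R).

(** An element [f] of the form domain comes without a derivative: it is known only through sequences
    [u n] in [dom_H0] whose derivatives [u' n] are Cauchy. Every statement about the closed form is
    therefore a limit statement on inner products along such sequences. Closability gives it a
    meaning: two approximations of the same [f] have derivatives whose difference tends to 0. Limit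
    functions are constructed only for sequences that are Cauchy in both [u] and [u']; Sobolev's
    inequality then makes the convergence uniform on each edge, so that pointwise limits can be
    used.

    The complex Hilbert space is treated as a real one. [ip] is the real part of the inner product,
    and its imaginary part is recovered by multiplying one argument by the imaginary unit.
    Cauchy-Schwarz, the minimisation and the weak equation thus become statements about real
    quadratic polynomials. *)

Definition itv_integrable a b f := mu.-integrable `[a, b] (EFin \o f).

Definition sq_integrable a b f :=
  measurable_fun `[a, b] f /\ itv_integrable a b (fun x => f x ^+ 2).

Lemma itv_integrable_dominated a b f g : measurable_fun `[a, b] f ->
  itv_integrable a b g -> (forall x, `[a, b]%classic x -> `|f x| <= g x) ->
  itv_integrable a b f.
Proof.
move=> mf ig fg; apply: (le_integrable _ _ _ ig) => //; first exact/measurable_EFinP.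
move=> x Dx /=; rewrite lee_fin; exact: le_trans (fg x Dx) (ler_norm _).
Qed.

Lemma itv_integrableD a b f g : itv_integrable a b f -> itv_integrable a b g ->
  itv_integrable a b (fun x => f x + g x).
Proof. by move=> iF ig; apply: (eq_integrable _ _ _ _ (integrableD _ iF ig)). Qed.

Lemma itv_integrableZ a b k f :
  itv_integrable a b f -> itv_integrable a b (fun x => k * f x).
Proof. by move=> iF; apply: (eq_integrable _ _ _ _ (integrableZl _ k iF)). Qed.

Lemma itv_integrable_norm a b f :
  itv_integrable a b f -> itv_integrable a b (fun x => `|f x|).
Proof. by move=> iF; apply: (eq_integrable _ _ _ _ (integrable_abse iF)). Qed.

Lemma itv_integrable_cst a b k : itv_integrable a b (cst k).
Proof.
apply: continuous_compact_integrable; first exact: segment_compact.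
by apply: continuous_subspaceT => x; exact: cvg_cst.
Qed.

Lemma sub_itv a b c d : a <= c -> d <= b -> `[c, d]%classic `<=` `[a, b]%classic.
Proof. by move=> ac db x /=; rewrite !in_itv/= => /andP[? ?]; apply/andP; split; lra. Qed.

Lemma itv_integrableS a b c d f : a <= c -> d <= b ->
  itv_integrable a b f -> itv_integrable c d f.
Proof. by move=> ac db; apply: integrableS => //; exact: sub_itv. Qed.

Lemma sq_integrable_mul a b f g : sq_integrable a b f ->
  sq_integrable a b g -> itv_integrable a b (fun x => f x * g x).
Proof.
move=> [mf if2] [mg ig2].
apply: (@itv_integrable_dominated _ _ _ (fun x => f x ^+ 2 + g x ^+ 2)).
- exact: measurable_funM.
- exact: itv_integrableD.
- move=> x _; rewrite normrM.
  have h : 0 <= (`|f x| - `|g x|) ^+ 2 by exact: sqr_ge0.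
  have h1 : 0 <= `|f x| * `|g x| by rewrite mulr_ge0.
  rewrite -[f x ^+ 2]real_normK ?num_real// -[g x ^+ 2]real_normK ?num_real//.
  nra.
Qed.

Lemma sq_integrableD a b f g : sq_integrable a b f ->
  sq_integrable a b g -> sq_integrable a b (fun x => f x + g x).
Proof.
move=> sf sg; split; first by apply: measurable_funD; [case: sf|case: sg].
have -> : (fun x => (f x + g x) ^+ 2) =
   (fun x => (f x ^+ 2 + g x ^+ 2) + 2 * (f x * g x)) by apply/funext => x; ring.
apply: itv_integrableD; last exact/itv_integrableZ/sq_integrable_mul.
by apply: itv_integrableD; [case: sf|case: sg].
Qed.

Lemma sq_integrableZ a b k f : sq_integrable a b f ->
  sq_integrable a b (fun x => k * f x).
Proof.
move=> [mf sf]; split; first by apply: measurable_funM => //; exact: measurable_cst.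
have -> : (fun x => (k * f x) ^+ 2) = (fun x => k ^+ 2 * f x ^+ 2)
  by apply/funext => x; ring.
exact: itv_integrableZ.
Qed.

Lemma sq_integrableS a b c d f : a <= c -> d <= b ->
  sq_integrable a b f -> sq_integrable c d f.
Proof.
move=> ac db [mf sf]; split; last exact: itv_integrableS sf.
by apply: measurable_funS mf => //; exact: sub_itv.
Qed.

Lemma sq_integrable_cst a b (k : R) : sq_integrable a b (cst k).
Proof.
by split; [exact: measurable_cst|exact: (itv_integrable_cst a b (k ^+ 2))].
Qed.

Lemma sq_integrableW a b f : sq_integrable a b f -> itv_integrable a b f.
Proof.
move=> sf; have := sq_integrable_mul sf (sq_integrable_cst a b 1).
by apply: eq_integrable => // x _ /=; rewrite mulr1.
Qed.

Lemma Rintegral_cst_itv a b k : a <= b -> \int[mu]_(x in `[a, b]) k = k * (b - a).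
Proof.
move=> ab; rewrite Rintegral_cst//= lebesgue_measure_itv/= lte_fin.
by case: ltP => //= ba; have -> : a = b by [lra|]; rewrite ?subrr.
Qed.

(** The integral of [(f x - t) ^+ 2] is nonnegative for every [t]; the mean value [t = I / (b - a)]
    gives the claim. A degenerate interval has no mean and is treated apart. *)
Lemma Rintegral_cauchy_schwarz a b f : a <= b -> sq_integrable a b f ->
  (\int[mu]_(x in `[a, b]) f x) ^+ 2 <=
  (b - a) * \int[mu]_(x in `[a, b]) f x ^+ 2.
Proof.
move=> ab sf; have iF := sq_integrableW sf; have [mf if2] := sf.
set I := \int[mu]_(x in _) f x; set J := \int[mu]_(x in _) f x ^+ 2.
have key t : 0 <= J + (- 2 * t) * I + t ^+ 2 * (b - a).
  rewrite -Rintegral_cst_itv// -RintegralZl// -!RintegralD//.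
  - by apply: Rintegral_ge0 => x _; have := sqr_ge0 (f x - t); nra.
  - by apply: itv_integrableD => //; exact: itv_integrableZ.
  - exact: (itv_integrable_cst a b (t ^+ 2)).
  - exact: itv_integrableZ.
move: ab; rewrite le_eqVlt => /predU1P[eab|ab].
  rewrite /I eab set_itv1 Rintegral_set1 expr0n/= subrr mul0r//.
have ba : 0 < b - a by rewrite subr_gt0.
have := key (I / (b - a)).
rewrite -(ler_pM2l ba) mulr0.
have -> : (b - a) * (J + -2 * (I / (b - a)) * I + (I / (b - a)) ^+ 2 * (b - a)) =
   (b - a) * J - I ^+ 2 by field; rewrite gt_eqF.
by rewrite subr_ge0.
Qed.

Lemma Rintegral_itv_split a b c f : a <= c -> c <= b -> itv_integrable a b f ->
  \int[mu]_(x in `[a, b]) f x =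
  \int[mu]_(x in `[a, c]) f x + \int[mu]_(x in `[c, b]) f x.
Proof.
move=> ac cb iF.
have := @Rintegral_itvB R f (BLeft a) (BRight b) c iF; rewrite !bnd_simp => /(_ ac cb).
move/eqP; rewrite subr_eq => /eqP ->; rewrite addrC; congr (_ + _).
apply: Rintegral_itv_obnd_cbnd; apply: integrableS iF => //.
by apply: subset_itvr; rewrite bnd_simp.
Qed.

Lemma le_Rintegral_itv a b c d f : a <= c -> d <= b -> c <= d ->
  itv_integrable a b f -> (forall x, a <= x <= b -> 0 <= f x) ->
  \int[mu]_(x in `[c, d]) f x <= \int[mu]_(x in `[a, b]) f x.
Proof.
move=> ac db cd iF f0.
rewrite (@Rintegral_itv_split a b c)//; last by lra.
rewrite (@Rintegral_itv_split c b d)//; last exact: itv_integrableS iF.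
rewrite addrCA lerDl addr_ge0//.
- by apply: Rintegral_ge0 => x /=; rewrite in_itv/= => /andP[? ?]; apply: f0; lra.
- by apply: Rintegral_ge0 => x /=; rewrite in_itv/= => /andP[? ?]; apply: f0; lra.
Qed.

(* [f] is absolutely continuous on [0, l] with square integrable derivative
   [f']. *)
Definition H1 (l : R) f f' := sq_integrable 0 l f' /\
  forall x, 0 <= x <= l -> f x = f 0 + \int[mu]_(y in `[0, x]) f' y.

Lemma H1_sub l f f' x y : H1 l f f' -> 0 <= x -> x <= y -> y <= l ->
  f y - f x = \int[mu]_(t in `[x, y]) f' t.
Proof.
move=> [sf fE] x0 xy yl; rewrite (fE y) ?(fE x); try (apply/andP; split; lra).
rewrite (@Rintegral_itv_split 0 y x)//; first lra.
exact: itv_integrableS (sq_integrableW sf).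
Qed.

(** Cauchy-Schwarz on [[x, y]]. The energy is then enlarged to all of [[0, l]], so that the Hoelder
    constant is the same for all pairs of points. *)
Lemma H1_hoelder l f f' x y : H1 l f f' -> 0 <= x -> x <= y -> y <= l ->
  (f y - f x) ^+ 2 <= (y - x) * \int[mu]_(t in `[0, l]) f' t ^+ 2.
Proof.
move=> hf x0 xy yl; rewrite (H1_sub hf)//.
have [sf _] := hf.
apply: (le_trans (Rintegral_cauchy_schwarz xy _)).
  exact: sq_integrableS sf.
rewrite ler_wpM2l ?subr_ge0//; apply: le_Rintegral_itv => //; first by case: sf.
by move=> *; exact: sqr_ge0.
Qed.

Lemma H1_osc l f f' x y : H1 l f f' -> 0 <= x <= l -> 0 <= y <= l ->
  (f y - f x) ^+ 2 <= l * \int[mu]_(t in `[0, l]) f' t ^+ 2.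
Proof.
move=> hf; wlog xy : x y / x <= y => [ih|].
  case: (leP x y) => [xy|/ltW yx]; first exact: ih.
  by move=> xl yl; rewrite -opprB sqrrN; exact: ih.
move=> /andP[x0 xl] /andP[y0 yl].
apply: (le_trans (H1_hoelder hf x0 xy yl)).
by rewrite ler_wpM2r//; [apply: Rintegral_ge0 => *; exact: sqr_ge0|lra].
Qed.

Lemma H1_continuous l f f' : H1 l f f' -> {within `[0, l], continuous f}.
Proof.
move=> hf; set K := \int[mu]_(t in `[0, l]) f' t ^+ 2.
have K0 : 0 <= K by apply: Rintegral_ge0 => *; exact: sqr_ge0.
have hK x y : 0 <= x <= l -> 0 <= y <= l -> (f x - f y) ^+ 2 <= `|x - y| * K.
  move=> /andP[x0 xl] /andP[y0 yl]; have [xy|/ltW yx] := leP x y.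
    by rewrite -opprB sqrrN distrC ger0_norm ?subr_ge0//; exact: (H1_hoelder hf).
  by rewrite ger0_norm ?subr_ge0//; exact: (H1_hoelder hf).
apply/subspace_continuousP => x /=; rewrite in_itv/= => xl.
apply/cvgrPdist_lt => e e0; near=> y.
have yl : 0 <= y <= l by near: y; apply: filterS (withinT _ _) => y /=; rewrite in_itv.
rewrite -(ltr_pXn2r (_ : 0 < 2)%N)// ?nnegrE// ?ltW// real_normK ?num_real//.
apply: (le_lt_trans (hK _ _ xl yl)).
(* [K] may vanish; the radius is taken to be [e ^+ 2 / (K + 1)]. *)
apply: (@le_lt_trans _ _ (`|x - y| * (K + 1))); first by rewrite ler_wpM2l// lerDl.
rewrite -ltr_pdivlMr ?ltr_wpDl//; near: y.
apply: cvg_within; apply: (@cvgr_dist_lt _ _ _ (nbhs x)) => //.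
by rewrite divr_gt0 ?exprn_gt0// ltr_wpDl.
Unshelve. all: by end_near. Qed.

Lemma continuous_sq_integrable a b f :
  {within `[a, b], continuous f} -> sq_integrable a b f.
Proof.
move=> cf; split; first exact: subspace_continuous_measurable_fun.
apply: continuous_compact_integrable; first exact: segment_compact.
move=> x; apply: (@cvg_comp _ _ _ f (fun y => y ^+ 2) _ (nbhs (f x))); first exact: cf.
exact: exprn_continuous.
Qed.

Lemma H1_sq_integrable l f f' : H1 l f f' -> sq_integrable 0 l f.
Proof. by move=> /H1_continuous/continuous_sq_integrable. Qed.

Lemma H1_bounded l f f' : H1 l f f' ->
  exists2 K, 0 <= K & forall x, 0 <= x <= l -> `|f x| <= K.
Proof.
move=> hf; set K := l * \int[mu]_(t in `[0, l]) f' t ^+ 2.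
exists (`|f 0| + Num.sqrt K); first by rewrite addr_ge0// sqrtr_ge0.
move=> x xl; have l0 : (0 <= 0 :> R) && (0 <= l) by apply/andP; split=> //; case/andP : xl; exact: le_trans.
have := H1_osc hf l0 xl; rewrite -ler_sqrt; last first.
  apply: le_trans (H1_osc hf l0 xl); exact: sqr_ge0.
rewrite sqrtr_sqr => h; rewrite -(subrK (f 0) (f x)) addrC.
by rewrite (le_trans (ler_normD _ _))// lerD2l.
Qed.

(* [f x ^+ 2 <= 2 * f y ^+ 2 + 2 * (f x - f y) ^+ 2], integrated over an interval
   of length [h] containing [x]. *)
Lemma H1_sobolev l f f' h x : H1 l f f' -> 0 <= x <= l -> 0 <= h <= l ->
  h * f x ^+ 2 <= 2 * (\int[mu]_(t in `[0, l]) f t ^+ 2) +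
                  2 * h ^+ 2 * \int[mu]_(t in `[0, l]) f' t ^+ 2.
Proof.
move=> hf /andP[x0 xl] /andP[h0 hl].
set K := \int[mu]_(t in `[0, l]) f' t ^+ 2.
have K0 : 0 <= K by apply: Rintegral_ge0 => *; exact: sqr_ge0.
have [_ if2] := H1_sq_integrable hf.
have [a [a0 ax xah ahl]] : exists a, [/\ 0 <= a, a <= x, x <= a + h & a + h <= l].
  by have [xh|xh] := leP x (l - h); [exists x|exists (l - h)]; split; lra.
have aah : a <= a + h by lra.
have i2 : itv_integrable a (a + h) (fun t => f t ^+ 2).
  exact: itv_integrableS if2.
apply: (@le_trans _ _ (2 * (\int[mu]_(t in `[a, a + h]) f t ^+ 2) + 2 * h ^+ 2 * K)).
  have -> : 2 * h ^+ 2 * K = (2 * h * K) * (a + h - a) by ring.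
  have -> : h * f x ^+ 2 = f x ^+ 2 * (a + h - a) by ring.
  rewrite -RintegralZl// -!Rintegral_cst_itv//.
  rewrite -RintegralD//; [|exact: itv_integrableZ|exact: itv_integrable_cst].
  apply: le_Rintegral => //; first exact: itv_integrable_cst.
    by apply: itv_integrableD; [exact: itv_integrableZ|exact: itv_integrable_cst].
  move=> y /=; rewrite in_itv/= => /andP[ay yah].
  have : (f x - f y) ^+ 2 <= h * K.
    have [xy|/ltW yx] := leP x y.
      rewrite -opprB sqrrN; apply: le_trans (H1_hoelder hf x0 xy _) _; first by lra.
      by rewrite ler_wpM2r//; lra.
    apply: le_trans (H1_hoelder hf _ yx xl) _; first by lra.
    by rewrite ler_wpM2r//; lra.
  by have := sqr_ge0 (2 * f y - f x); nra.
rewrite lerD2r ler_pM2l//; apply: le_Rintegral_itv => // t _; exact: sqr_ge0.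
Qed.

(** Here the point [x] is fixed and [f y ^+ 2 <= 2 * f x ^+ 2 + 2 * (f y - f x) ^+ 2] is integrated
    over [y]. *)
Lemma H1_poincare l f f' x : H1 l f f' -> 0 <= x <= l ->
  \int[mu]_(t in `[0, l]) f t ^+ 2 <=
  2 * l * f x ^+ 2 + 2 * l ^+ 2 * \int[mu]_(t in `[0, l]) f' t ^+ 2.
Proof.
move=> hf xl; have l0 : 0 <= l by case/andP : xl; exact: le_trans.
set K := \int[mu]_(t in `[0, l]) f' t ^+ 2.
have [_ if2] := H1_sq_integrable hf.
have -> : 2 * l * f x ^+ 2 + 2 * l ^+ 2 * K =
  (2 * f x ^+ 2 + 2 * l * K) * (l - 0) by rewrite subr0; ring.
rewrite -Rintegral_cst_itv//; apply: le_Rintegral => //.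
- exact: itv_integrable_cst.
- move=> y /=; rewrite in_itv/= => yl; have := H1_osc hf xl yl.
  by rewrite -/K => h; have := sqr_ge0 (2 * f x - f y); nra.
Qed.

Lemma H1_scale l f f' k : H1 l f f' -> H1 l (fun x => k * f x) (fun x => k * f' x).
Proof.
move=> [sf fE]; split; first exact: sq_integrableZ.
move=> x xl; rewrite fE// mulrDr RintegralZl//.
by apply: itv_integrableS (sq_integrableW sf) => //; case/andP: xl.
Qed.

Lemma H1_add l f f' g g' : H1 l f f' -> H1 l g g' ->
  H1 l (fun x => f x + g x) (fun x => f' x + g' x).
Proof.
move=> [sf fE] [sg gE]; split; first exact: sq_integrableD.
move=> x xl; rewrite fE// gE// addrACA RintegralD//.
- by apply: itv_integrableS (sq_integrableW sf) => //; case/andP: xl.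
- by apply: itv_integrableS (sq_integrableW sg) => //; case/andP: xl.
Qed.

(* On a subinterval of length at most [h], replacing [g] by its value at the
   left endpoint costs at most [sqrt (h * int g'^2)]; the longer intervals are
   obtained by concatenating [n] such pieces. *)
Lemma H1_weak_bound l f f' g g' eta K h n x y :
  H1 l f f' -> H1 l g g' ->
  (forall t, 0 <= t <= l -> `|f t| <= eta) ->
  (forall t, 0 <= t <= l -> `|g t| <= K) ->
  0 <= h -> 0 <= x -> x <= y -> y <= l -> y - x <= h *+ n ->
  `|\int[mu]_(t in `[x, y]) (f' t * g t)| <=
  2 * eta * K * n%:R + Num.sqrt (h * \int[mu]_(t in `[0, l]) g' t ^+ 2) *
    \int[mu]_(t in `[x, y]) `|f' t|.
Proof.
move=> hf hg feta gK h0; set S := Num.sqrt _.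
have S0 : 0 <= S by exact: sqrtr_ge0.
have [sf' _] := hf; have sg := H1_sq_integrable hg.
have ifg : itv_integrable 0 l (fun t => f' t * g t) by exact: sq_integrable_mul.
have if' : itv_integrable 0 l f' by exact: sq_integrableW.
have if'n := itv_integrable_norm if'.
elim: n x y => [|n ih] x y x0 xy yl yxn.
  have -> : y = x by rewrite mulr0n in yxn; lra.
  by rewrite set_itv1 !Rintegral_set1 normr0 !mulr0 addr0.
pose z := Num.max x (y - h).
have xz : x <= z by rewrite le_max lexx.
have zy : z <= y by rewrite ge_max xy/= gerBl.
have yzh : y - z <= h by rewrite lerBlDr -lerBlDl le_max lexx orbT.
have zx : z - x <= h *+ n.
  rewrite /z; case: (leP x (y - h)) => hx; last by rewrite subrr mulrn_wge0.
  by rewrite mulrS in yxn; lra.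
clearbody z; have {}ih := ih x z x0 xz (le_trans zy yl) zx.
have z0 : 0 <= z by exact: le_trans xz.
have zl : 0 <= z <= l by rewrite z0 (le_trans zy).
have yl' : 0 <= y <= l by rewrite yl (le_trans z0).
have i1 : itv_integrable x y (fun t => f' t * g t) by exact: itv_integrableS ifg.
have i2 : itv_integrable x y (fun t => `|f' t|) by exact: itv_integrableS if'n.
have i3 : itv_integrable z y f' by exact: itv_integrableS if'.
have i4 : itv_integrable z y (fun t => f' t * g t) by exact: itv_integrableS ifg.
have i5 : itv_integrable z y (fun t => `|f' t|) by exact: itv_integrableS if'n.
rewrite (@Rintegral_itv_split x y z)// (@Rintegral_itv_split x y z (fun t => `|f' t|))//.
have E : \int[mu]_(t in `[z, y]) (f' t * g t) =
    g z * (f y - f z) + \int[mu]_(t in `[z, y]) (f' t * (g t - g z)).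
  rewrite (H1_sub hf)// -RintegralZl// -RintegralD//; last 2 first.
  - exact: itv_integrableZ.
  - have -> : (fun t => f' t * (g t - g z)) =
       (fun t => f' t * g t + (- g z) * f' t) by apply/funext => t; ring.
    by apply: itv_integrableD => //; exact: itv_integrableZ.
  - by apply: eq_Rintegral => t _; ring.
have E1 : `|g z * (f y - f z)| <= 2 * eta * K.
  rewrite normrM; have := gK z zl; have := feta _ zl; have := feta _ yl'.
  have := ler_normB (f y) (f z); have := normr_ge0 (g z).
  have := normr_ge0 (f y - f z); nra.
have E2 : `|\int[mu]_(t in `[z, y]) (f' t * (g t - g z))| <=
    S * \int[mu]_(t in `[z, y]) `|f' t|.
  have i6 : itv_integrable z y (fun t => f' t * (g t - g z)).
    have -> : (fun t => f' t * (g t - g z)) =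
       (fun t => f' t * g t + (- g z) * f' t) by apply/funext => t; ring.
    by apply: itv_integrableD => //; exact: itv_integrableZ.
  apply: (le_trans (le_normr_Rintegral _ i6)) => //.
  rewrite -RintegralZl//; apply: le_Rintegral => //.
  - exact: itv_integrable_norm.
  - exact: itv_integrableZ.
  - move=> t /=; rewrite in_itv/= => /andP[zt ty].
    rewrite normrM mulrC ler_wpM2r// -(sqrtr_sqr (g t - g z)) ler_sqrt; last first.
      by rewrite mulr_ge0// Rintegral_ge0// => *; exact: sqr_ge0.
    apply: (le_trans (H1_hoelder hg _ _ _)) => //; first exact: le_trans yl.
    by rewrite ler_wpM2r ?Rintegral_ge0// => [*|]; [exact: sqr_ge0|lra].
rewrite E; apply: le_trans (ler_normD _ _) _.
apply: le_trans (lerD ih (le_trans (ler_normD _ _) (lerD E1 E2))) _.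
by rewrite le_eqVlt -natr1; apply/orP; left; apply/eqP; ring.
Qed.

(** A quantitative weak convergence: if [f] tends to 0 in L^2 with bounded energy, then [f'] tends
    to 0 against every fixed [g] of class H^1. The constants are chosen in the order [n] (number of
    pieces), [eta] (sup bound on [f]), [h] (window in Sobolev's inequality), [delta]. *)
Lemma H1_weak l g g' M eps : 0 < l -> H1 l g g' -> 0 < eps ->
  exists2 delta, 0 < delta & forall f f', H1 l f f' ->
    \int[mu]_(t in `[0, l]) f t ^+ 2 <= delta ->
    \int[mu]_(t in `[0, l]) f' t ^+ 2 <= M ->
    `|\int[mu]_(t in `[0, l]) (f' t * g t)| <= eps.
Proof.
move=> l0 hg eps0; have [K K0 gK] := H1_bounded hg.
wlog M0 : M / 0 <= M => [ih|].
  have [d d0 dP] := ih `|M| (normr_ge0 _); exists d => // f f' hf fd fM.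
  by apply: dP hf fd _; exact: le_trans (ler_norm _).
set P := \int[mu]_(t in `[0, l]) g' t ^+ 2.
have P0 : 0 <= P by apply: Rintegral_ge0 => *; exact: sqr_ge0.
(* With pieces of length [l / n], the square of the second term in [H1_weak_bound] is at most
   [S / n]; [n] makes this at most [(eps / 2) ^+ 2]. *)
pose S := (l * P) * (l + M) ^+ 2.
have S0 : 0 <= S by rewrite mulr_ge0 ?sqr_ge0// mulr_ge0// ltW.
pose n := (Num.truncn (4 * S / eps ^+ 2)).+1.
have n0 : 0 < n%:R :> R by rewrite ltr0n.
have nS : 4 * S <= n%:R * eps ^+ 2.
  by rewrite -ler_pdivrMr ?exprn_gt0// ltW// truncnS_gt.
clearbody n; have [K1 n1] : K + 1 != 0 /\ n%:R != 0 :> R by rewrite !gt_eqF// ltr_wpDl.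
have M1 : M + 1 != 0 by rewrite gt_eqF// ltr_wpDl.
have frac (k : R) : 0 <= k -> k / (k + 1) <= 1.
  by move=> k0; rewrite ler_pdivrMr ?ltr_wpDl// mul1r lerDl.
have [eta eta0 etaE] : exists2 eta, 0 < eta & 2 * eta * K * n%:R <= eps / 2.
  exists (eps / (4 * (K + 1) * n%:R)).
    by rewrite divr_gt0// !mulr_gt0// ltr_wpDl.
  have -> : 2 * (eps / (4 * (K + 1) * n%:R)) * K * n%:R = (eps / 2) * (K / (K + 1)).
    by field; rewrite ?K1 ?n1.
  by rewrite ler_piMr ?divr_ge0 ?(ltW eps0)// frac.
(* Divided by [h], Sobolev's inequality bounds [f t ^+ 2] by [2 * delta / h + 2 * h * M]. The choice
   of [h] makes the energy term at most [eta ^+ 2 / 2], and [delta = h * eta ^+ 2 / 4] does the same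
   for the other term. *)
have [h /andP[h0 hl] hE] : exists2 h, (0 < h) && (h <= l) & 2 * h * M <= eta ^+ 2 / 2.
  have c0 : 0 < eta ^+ 2 / (4 * (M + 1)).
    by rewrite divr_gt0 ?exprn_gt0// mulr_gt0// ltr_wpDl.
  exists (Num.min l (eta ^+ 2 / (4 * (M + 1)))).
    by rewrite lt_min l0 c0 ge_min lexx.
  apply: (@le_trans _ _ (2 * (eta ^+ 2 / (4 * (M + 1))) * M)).
    by rewrite ler_wpM2r// ler_pM2l// ge_min lexx orbT.
  have -> : 2 * (eta ^+ 2 / (4 * (M + 1))) * M = (eta ^+ 2 / 2) * (M / (M + 1)).
    by field; rewrite ?M1.
  by rewrite ler_piMr ?divr_ge0 ?sqr_ge0// frac.
exists (h * eta ^+ 2 / 4); first by rewrite divr_gt0// mulr_gt0// exprn_gt0.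
move=> f f' hf fd fM.
have feta t : 0 <= t <= l -> `|f t| <= eta.
  move=> tl; rewrite -(@ler_pXn2r _ 2)// ?nnegrE ?(ltW eta0)// real_normK ?num_real//.
  rewrite -(ler_pM2l h0).
  have hhl : 0 <= h <= l by rewrite ltW.
  apply: (le_trans (H1_sobolev hf tl hhl)).
  have : h * (2 * h * \int[mu]_(x in `[0, l]) f' x ^+ 2) <= h * (eta ^+ 2 / 2).
    rewrite ler_pM2l//; apply: le_trans hE; rewrite ler_wpM2l// mulr_ge0// ltW//.
  move: fd; move: (\int[mu]_(t in `[0, l]) f t ^+ 2) => A.
  by move: (\int[mu]_(t in `[0, l]) f' t ^+ 2) => B; lra.
have ln : l - 0 <= (l / n%:R) *+ n.
  by rewrite subr0 -mulr_natr divfK// gt_eqF.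
have ln0 : 0 <= l / n%:R by rewrite divr_ge0 ?ltW.
apply: le_trans (H1_weak_bound hf hg feta gK ln0 (lexx 0) (ltW l0) (lexx l) ln) _.
rewrite -/P [leRHS](splitr eps) lerD//.
set V := \int[mu]_(t in _) _.
have V0 : 0 <= V by apply: Rintegral_ge0.
have [[mf' if2] _] := hf.
(* The L^1 norm of [f'] is bounded through [|t| <= 1 + t ^+ 2]. *)
have VM : V <= l + M.
  apply: (@le_trans _ _ (\int[mu]_(t in `[0, l]) (1 + f' t ^+ 2))).
    apply: le_Rintegral => //.
    - by apply: itv_integrable_norm; apply: sq_integrableW; split.
    - by apply: itv_integrableD => //; exact: itv_integrable_cst.
    - move=> t _; rewrite -[f' t ^+ 2]real_normK ?num_real//.
      by have := sqr_ge0 (`|f' t| - 1); have := normr_ge0 (f' t); nra.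
  rewrite RintegralD//; last exact: itv_integrable_cst.
  by rewrite Rintegral_cst_itv ?(ltW l0)// mul1r subr0 lerD2l.
rewrite -(@ler_pXn2r _ 2)// ?nnegrE ?mulr_ge0 ?sqrtr_ge0 ?divr_ge0 ?(ltW eps0)//.
rewrite exprMn sqr_sqrtr; last by rewrite mulr_ge0.
apply: (@le_trans _ _ (l / n%:R * P * (l + M) ^+ 2)).
  apply: ler_wpM2l; first exact: mulr_ge0.
  by rewrite ler_pXn2r// ?nnegrE// addr_ge0// ltW.
have -> : l / n%:R * P * (l + M) ^+ 2 = S / n%:R by rewrite /S; ring.
by rewrite ler_pdivrMr//; move: nS; rewrite exprMn; lra.
Qed.

End IntervalCalculus.

(** * Complex-valued functions on a single edge *)

Section ComplexEdge.
Import Order.TTheory GRing.Theory Num.Theory.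
Import numFieldNormedType.Exports.
Local Open Scope classical_set_scope.
Local Open Scope ring_scope.
Local Open Scope complex_scope.
Context {R : realType}.
Local Notation mu := (@lebesgue_measure R).
Local Notation Re := (@complex.Re R).
Local Notation Im := (@complex.Im R).
Implicit Types (l : R) (u v w : R -> R[i]) (z : R[i]).

(** The discriminant criterion, and the common source of the Cauchy-Schwarz inequalities and of the
    residual bound for minimising sequences. For [c = 0] the polynomial is affine, and a nonzero
    slope would make it take the value -1 at [t = - (a + 1) / (2 * b)]. *)
Lemma quadratic_ge0 (a b c : R) :
  (forall t, 0 <= a + 2 * t * b + t ^+ 2 * c) -> 0 <= c -> b ^+ 2 <= a * c.
Proof.
move=> key; rewrite le_eqVlt => /predU1P[c0|c0]; last first.
  have := key (- b / c); rewrite -(ler_pM2l c0) mulr0.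
  have -> : c * (a + 2 * (- b / c) * b + (- b / c) ^+ 2 * c) = a * c - b ^+ 2.
    by field; rewrite gt_eqF.
  by rewrite subr_ge0.
rewrite -c0 mulr0; have [->|n0] := eqVneq b 0; first by rewrite expr0n.
have := key (- (a + 1) / (2 * b)); rewrite -c0 mulr0 addr0.
have -> : a + 2 * (- (a + 1) / (2 * b)) * b = -1 by field.
by rewrite ler0N1.
Qed.

Lemma ReD z z' : Re (z + z') = Re z + Re z'. Proof. by case: z z' => [? ?] []. Qed.
Lemma ImD z z' : Im (z + z') = Im z + Im z'. Proof. by case: z z' => [? ?] []. Qed.
Lemma ReN z : Re (- z) = - Re z. Proof. by case: z. Qed.
Lemma ImN z : Im (- z) = - Im z. Proof. by case: z. Qed.
Lemma ReM z z' : Re (z * z') = Re z * Re z' - Im z * Im z'.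
Proof. by case: z z' => [? ?] []. Qed.
Lemma ImM z z' : Im (z * z') = Re z * Im z' + Im z * Re z'.
Proof. by case: z z' => [? ?] []. Qed.
Lemma Re_conjc z : Re (conjc z) = Re z. Proof. by case: z. Qed.
Lemma Im_conjc z : Im (conjc z) = - Im z. Proof. by case: z. Qed.
Definition ReImE := (ReD, ImD, ReN, ImN, ReM, ImM, Re_conjc, Im_conjc).

Lemma sqr_normc z : Normc.normc z ^+ 2 = Re z ^+ 2 + Im z ^+ 2.
Proof. by case: z => a b /=; rewrite sqr_sqrtr// addr_ge0 ?sqr_ge0. Qed.

Lemma complex_eq z z' : Re z = Re z' -> Im z = Im z' -> z = z'.
Proof. by case: z z' => [? ?] [? ?] /= -> ->. Qed.

Definition edge_sq l u :=
  sq_integrable 0 l (fun x => Re (u x)) /\ sq_integrable 0 l (fun x => Im (u x)).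

(** The real part of the sesquilinear L^2 product on the edge; [integralC_conj] recovers the
    imaginary part by replacing [v] with ['i * v]. *)
Definition edge_inner l u v : R :=
  \int[mu]_(x in `[0, l]) (Re (u x) * Re (v x) + Im (u x) * Im (v x)).

Definition edge_norm l u := edge_inner l u u.

Lemma edge_inner_integrable l u v : edge_sq l u -> edge_sq l v ->
  itv_integrable 0 l (fun x => Re (u x) * Re (v x) + Im (u x) * Im (v x)).
Proof.
by move=> [u1 u2] [v1 v2]; apply: itv_integrableD; exact: sq_integrable_mul.
Qed.

Lemma edge_normE l u : edge_sq l u ->
  edge_norm l u = \int[mu]_(x in `[0, l]) Re (u x) ^+ 2 +
                  \int[mu]_(x in `[0, l]) Im (u x) ^+ 2.
Proof.
by move=> [[_ u1] [_ u2]]; rewrite -RintegralD//.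
Qed.

Lemma edge_norm_ge0 l u : 0 <= edge_norm l u.
Proof. by apply: Rintegral_ge0 => x _; rewrite addr_ge0// -expr2 sqr_ge0. Qed.

Lemma sqnorm_itvE l u : edge_sq l u -> sqnorm_itv l u = (edge_norm l u)%:E.
Proof.
move=> su; rewrite /edge_norm /edge_inner /Rintegral fineK; last first.
  by apply: integrable_fin_num => //; exact: edge_inner_integrable.
by apply: eq_integral => x _; rewrite sqr_normc.
Qed.

Lemma edge_sqP l u : edge_sq l u <->
  measurable_funC `[0, l] u /\ (sqnorm_itv l u < +oo)%E.
Proof.
split=> [su|[[m1 m2] fu]].
  by rewrite sqnorm_itvE// ltry; split=> //; split; case: su => -[? ?] [? ?].
have mn : measurable_fun `[0, l] (fun x => Re (u x) ^+ 2 + Im (u x) ^+ 2).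
  by apply: measurable_funD; exact: measurable_funX.
have iN : itv_integrable 0 l (fun x => Re (u x) ^+ 2 + Im (u x) ^+ 2).
  apply/integrableP; split; first exact/measurable_EFinP.
  apply: le_lt_trans fu; rewrite le_eqVlt; apply/orP; left; apply/eqP.
  apply: eq_integral => x _ /=.
  by rewrite sqr_normc ger0_norm// addr_ge0 ?sqr_ge0.
by split; split=> //; apply: itv_integrable_dominated iN _ => [|x _];
  [exact: measurable_funX| |exact: measurable_funX|];
  rewrite ger0_norm ?sqr_ge0// ?lerDl ?lerDr sqr_ge0.
Qed.

Lemma edge_sq_axpy l z u v : edge_sq l u -> edge_sq l v ->
  edge_sq l (fun x => u x + z * v x).
Proof.
move=> [u1 u2] [v1 v2]; split.
- have -> : (fun x => Re (u x + z * v x)) =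
    (fun x => Re (u x) + (Re z * Re (v x) + (- Im z) * Im (v x))).
    by apply/funext => x; rewrite !ReImE; ring.
  by do 2 (apply: sq_integrableD; rewrite //; try exact: sq_integrableZ).
- have -> : (fun x => Im (u x + z * v x)) =
    (fun x => Im (u x) + (Im z * Re (v x) + Re z * Im (v x))).
    by apply/funext => x; rewrite !ReImE; ring.
  by do 2 (apply: sq_integrableD; rewrite //; try exact: sq_integrableZ).
Qed.

Lemma edge_innerC l u v : edge_inner l u v = edge_inner l v u.
Proof. by apply: eq_Rintegral => x _; ring. Qed.

Lemma edge_inner_axpy l (t : R) u v w :
  edge_sq l u -> edge_sq l v -> edge_sq l w ->
  edge_inner l (fun x => u x + t%:C * v x) w =
  edge_inner l u w + t * edge_inner l v w.
Proof.
move=> su sv sw; rewrite /edge_inner -RintegralZl//; last exact: edge_inner_integrable.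
rewrite -RintegralD//; last 2 first.
- exact: edge_inner_integrable.
- exact/itv_integrableZ/edge_inner_integrable.
by apply: eq_Rintegral => x _; rewrite !ReImE /=; ring.
Qed.

Lemma edge_inner_ii l u v :
  edge_inner l (fun x => 'i * u x) (fun x => 'i * v x) = edge_inner l u v.
Proof. by apply: eq_Rintegral => x _; rewrite !ReImE /=; ring. Qed.

Lemma edge_inner_axpyr l (t : R) u v w :
  edge_sq l u -> edge_sq l v -> edge_sq l w ->
  edge_inner l w (fun x => u x + t%:C * v x) =
  edge_inner l w u + t * edge_inner l w v.
Proof.
by move=> su sv sw; rewrite edge_innerC edge_inner_axpy// !(edge_innerC _ w).
Qed.

Lemma edge_inner_cauchy_schwarz l u v : edge_sq l u -> edge_sq l v ->
  edge_inner l u v ^+ 2 <= edge_norm l u * edge_norm l v.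
Proof.
move=> su sv; apply: quadratic_ge0; last exact: edge_norm_ge0.
move=> t; apply: le_trans (edge_norm_ge0 l (fun x => u x + t%:C * v x)) _.
have suv := edge_sq_axpy t%:C su sv.
rewrite /edge_norm edge_inner_axpy// !edge_inner_axpyr// (edge_innerC l v u).
by rewrite le_eqVlt; apply/orP; left; apply/eqP; ring.
Qed.

Lemma edge_inner_le l u v : edge_sq l u -> edge_sq l v ->
  `|edge_inner l u v| <= edge_norm l u + edge_norm l v.
Proof.
move=> su sv; have iF := edge_inner_integrable su sv.
apply: (le_trans (le_normr_Rintegral _ iF)) => //.
rewrite -RintegralD//; [|exact: edge_inner_integrable..].
apply: le_Rintegral => //.
- exact: itv_integrable_norm.
- by apply: itv_integrableD; exact: edge_inner_integrable.
- move=> x _; set a := Re _; set b := Re _; set c := Im _; set d := Im _.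
  rewrite ler_norml; apply/andP; split.
    have := sqr_ge0 (a + b); have := sqr_ge0 (c + d).
    by have := sqr_ge0 a; have := sqr_ge0 b; have := sqr_ge0 c; have := sqr_ge0 d; nra.
  have := sqr_ge0 (a - b); have := sqr_ge0 (c - d).
  by have := sqr_ge0 a; have := sqr_ge0 b; have := sqr_ge0 c; have := sqr_ge0 d; nra.
Qed.

Lemma integralC_conj l u v : integralC `[0, l] (fun x => u x * conjc (v x)) =
  edge_inner l u v +i* edge_inner l u (fun x => 'i * v x).
Proof.
by rewrite /integralC; congr (_ +i* _); apply: eq_Rintegral => x _;
  rewrite !ReImE /=; ring.
Qed.

End ComplexEdge.

(** * The Hilbert space of the metric graph *)

Section Sums.
Import Order.TTheory GRing.Theory Num.Theory.
Local Open Scope classical_set_scope.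
Local Open Scope ring_scope.
Context {R : realType} {I : choiceType}.
Implicit Types (a b p n : I -> R).

(** [fine] sends [+oo] to 0, so finiteness of the extended sum has to be carried as a separate
    hypothesis. *)
Definition sumR a : R := fine (\esum_(e in [set: I]) (a e)%:E).

Definition ssummable a := (\esum_(e in [set: I]) `|a e|%:E < +oo)%E.

Lemma esum_ge0_fin a : (forall e, 0 <= a e) ->
  (\esum_(e in [set: I]) (a e)%:E < +oo)%E ->
  \esum_(e in [set: I]) (a e)%:E = (sumR a)%:E.
Proof.
move=> a0 fa; rewrite /sumR fineK// ge0_fin_numE//.
by apply: esum_ge0 => e _; rewrite lee_fin.
Qed.

Lemma ssummable_le a p : (forall e, `|a e| <= p e) ->
  (\esum_(e in [set: I]) (p e)%:E < +oo)%E -> ssummable a.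
Proof.
by move=> ap; apply: le_lt_trans; apply: le_esum => e _; rewrite lee_fin.
Qed.

(** Finite partial sums give one inequality for every factor; for positive [k] the reverse one is
    the same inequality for the factor [k^-1] and the family [k * p e]. *)
Lemma esum_scale p (k : R) : 0 <= k -> (forall e, 0 <= p e) ->
  \esum_(e in [set: I]) (k * p e)%:E = (k%:E * \esum_(e in [set: I]) (p e)%:E)%E.
Proof.
move=> k0 p0.
have H (c : R) q : 0 <= c -> (forall e, 0 <= q e) ->
  (\esum_(e in [set: I]) (c * q e)%:E <= c%:E * \esum_(e in [set: I]) (q e)%:E)%E.
  move=> c0 q0; apply: ge_ereal_sup => _ [A [fA _] <-].
  under eq_fsbigr do rewrite EFinM.
  rewrite -ge0_mule_fsumr; last by move=> e; rewrite lee_fin.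
  rewrite lee_wpmul2l ?lee_fin//; apply: ereal_sup_ubound; exists A => //.
move: k0; rewrite le_eqVlt => /predU1P[<-|k0].
  rewrite mul0e; apply: esum1 => e _; by rewrite mul0r.
apply/eqP; rewrite eq_le H ?(ltW k0)//=.
have := H k^-1 (fun e => k * p e); rewrite invr_ge0 ltW// => /(_ erefl).
move=> /(_ (fun e => mulr_ge0 (ltW k0) (p0 e))).
under eq_esum do rewrite mulKf ?gt_eqF//.
by move/(lee_wpmul2l (x := k%:E)); rewrite muleA -EFinM divff ?gt_eqF// mul1e lee_fin;
  apply; exact: ltW.
Qed.

Lemma ssummableZ k a : ssummable a -> ssummable (fun e => k * a e).
Proof.
rewrite /ssummable => sa; under eq_esum do rewrite normrM.
by rewrite esum_scale//; apply: lte_mul_pinfty => //; rewrite ?fin_num_abs ?ltry ?lee_fin.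
Qed.

End Sums.

(** * Linearity of signed sums over the edges *)

Section SumE.
Import Order.TTheory GRing.Theory Num.Theory.
Local Open Scope classical_set_scope.
Local Open Scope ring_scope.
Context {R : realType} {G : metricGraph R}.
Local Notation I := (edge G).
Implicit Types (a b p n : I -> R).

(** Any splitting of [a] into nonnegative summable parts computes [sumE], not only the one into
    positive and negative parts: both sides of [ap e + n e = p e + an e] are sums of nonnegative
    families, which may be added freely. Additivity of [sumE] rests on this freedom. *)
Lemma sumE_sub a p n : (forall e, 0 <= p e) -> (forall e, 0 <= n e) ->
  (\esum_(e in [set: I]) (p e)%:E < +oo)%E ->
  (\esum_(e in [set: I]) (n e)%:E < +oo)%E ->
  (forall e, a e = p e - n e) -> sumE a = sumR p - sumR n.
Proof.
move=> p0 n0 fp fn aE.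
pose ap e := Num.max (a e) 0; pose an e := Num.max (- a e) 0.
have ap0 e : 0 <= ap e by rewrite le_max lexx orbT.
have an0 e : 0 <= an e by rewrite le_max lexx orbT.
have fap : (\esum_(e in [set: I]) (ap e)%:E < +oo)%E.
  apply: le_lt_trans fp; apply: le_esum => e _.
  by rewrite lee_fin ge_max p0 andbT aE gerBl.
have fan : (\esum_(e in [set: I]) (an e)%:E < +oo)%E.
  apply: le_lt_trans fn; apply: le_esum => e _.
  by rewrite lee_fin ge_max n0 andbT aE opprB gerBl.
have : (\esum_(e in [set: I]) (ap e + n e)%:E = \esum_(e in [set: I]) (p e + an e)%:E)%E.
  apply: eq_esum => e _; congr EFin; have := aE e; rewrite /ap /an.
  by case: (leP (a e) 0) => h; case: (leP (- a e) 0) => h'; lra.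
under eq_esum do rewrite EFinD.
rewrite esumD//; try by move=> e _; rewrite lee_fin.
under [in RHS]eq_esum do rewrite EFinD.
rewrite esumD//; try by move=> e _; rewrite lee_fin.
rewrite (esum_ge0_fin ap0 fap) (esum_ge0_fin an0 fan).
rewrite (esum_ge0_fin p0 fp) (esum_ge0_fin n0 fn) => /(congr1 fine) /=.
by rewrite /sumE -/(sumR ap) -/(sumR an); lra.
Qed.

Lemma sumE_ge0 a : (forall e, 0 <= a e) -> sumE a = sumR a.
Proof.
move=> a0; rewrite /sumE [X in _ - fine X]esum1 ?subr0.
  by congr fine; apply: eq_esum => e _; rewrite max_l.
by move=> e _; rewrite max_r// oppr_le0.
Qed.

Lemma ssummable_pos a : ssummable a ->
  (\esum_(e in [set: I]) (Num.max (a e) 0)%:E < +oo)%E.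
Proof.
by apply: le_lt_trans; apply: le_esum => e _; rewrite lee_fin ge_max ler_norm/=.
Qed.

Lemma ssummable_neg a : ssummable a ->
  (\esum_(e in [set: I]) (Num.max (- a e) 0)%:E < +oo)%E.
Proof.
by apply: le_lt_trans; apply: le_esum => e _; rewrite lee_fin ge_max -normrN ler_norm/=.
Qed.

Lemma sumR_add p n : (forall e, 0 <= p e) -> (forall e, 0 <= n e) ->
  (\esum_(e in [set: I]) (p e)%:E < +oo)%E ->
  (\esum_(e in [set: I]) (n e)%:E < +oo)%E ->
  sumR (fun e => p e + n e) = sumR p + sumR n.
Proof.
move=> p0 n0 fp fn; rewrite {1}/sumR; under eq_esum do rewrite EFinD.
rewrite esumD; try by move=> e _; rewrite lee_fin.
by rewrite (esum_ge0_fin p0 fp) (esum_ge0_fin n0 fn).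
Qed.

Let pos a e := Num.max (a e) 0.
Let neg a e := Num.max (- a e) 0.
Let pos0 a e : 0 <= pos a e. Proof. by rewrite le_max lexx orbT. Qed.
Let neg0 a e : 0 <= neg a e. Proof. by rewrite le_max lexx orbT. Qed.
Let posneg a e : a e = pos a e - neg a e.
Proof. by rewrite /pos/neg; case: (leP (a e) 0); case: (leP (- a e) 0); lra. Qed.

Let fin_add p n : (forall e, 0 <= p e) -> (forall e, 0 <= n e) ->
  (\esum_(e in [set: I]) (p e)%:E < +oo)%E ->
  (\esum_(e in [set: I]) (n e)%:E < +oo)%E ->
  (\esum_(e in [set: I]) (p e + n e)%:E < +oo)%E.
Proof.
move=> p0 n0 fp fn; under eq_esum do rewrite EFinD.
by rewrite esumD; [exact: lte_add_pinfty| |] => e _; rewrite lee_fin.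
Qed.

Lemma sumED a b : ssummable a -> ssummable b ->
  sumE (fun e => a e + b e) = sumE a + sumE b.
Proof.
move=> sa sb.
have [pa na] := (ssummable_pos sa, ssummable_neg sa).
have [pb nb] := (ssummable_pos sb, ssummable_neg sb).
rewrite (@sumE_sub _ (fun e => pos a e + pos b e) (fun e => neg a e + neg b e)).
- by rewrite !sumR_add// /sumE -!/(sumR _); ring.
- by move=> e; rewrite addr_ge0.
- by move=> e; rewrite addr_ge0.
- exact: fin_add.
- exact: fin_add.
- by move=> e; rewrite {1}(posneg a) {1}(posneg b); ring.
Qed.

Lemma sumEN a : sumE (fun e => - a e) = - sumE a.
Proof.
by rewrite /sumE opprB; under [in X in _ - fine X = _]eq_esum do rewrite opprK.
Qed.

Lemma sumEZ k a : ssummable a -> sumE (fun e => k * a e) = k * sumE a.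
Proof.
move=> sa; have [pa na] := (ssummable_pos sa, ssummable_neg sa).
wlog k0 : k / 0 <= k => [ih|].
  have [/ih//|/ltW k0] := leP 0 k.
  have -> : (fun e => k * a e) = (fun e => - (- k * a e)) by apply/funext => e; ring.
  by rewrite sumEN ih ?oppr_ge0//; ring.
(* This also holds for a divergent family: [fine] turns [+oo] into 0, and the scaled sum is either
   [+oo] or 0. *)
have sc (q : I -> R) : (forall e, 0 <= q e) -> sumR (fun e => k * q e) = k * sumR q.
  move=> q0; rewrite /sumR esum_scale//.
  have [f|] := boolP (\esum_(e in [set: I]) (q e)%:E \is a fin_num)%E.
    by rewrite fineM.
  rewrite ge0_fin_numE ?esum_ge0// => [|e _]; last by rewrite lee_fin.
  rewrite ltey negbK => /eqP ->; rewrite mulr0.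
  by move: k0; rewrite le_eqVlt => /predU1P[<-|k0]; [rewrite mul0e|rewrite gt0_muley].
rewrite (@sumE_sub _ (fun e => k * pos a e) (fun e => k * neg a e)).
- by rewrite !sc// /sumE -!/(sumR _); ring.
- by move=> e; rewrite mulr_ge0.
- by move=> e; rewrite mulr_ge0.
- by rewrite esum_scale// lte_mul_pinfty// lee_fin.
- by rewrite esum_scale// lte_mul_pinfty// lee_fin.
- by move=> e; rewrite {1}(posneg a); ring.
Qed.

Lemma sumE_norm_le a : ssummable a -> `|sumE a| <= sumR (fun e => `|a e|).
Proof.
move=> sa; have [pa na] := (ssummable_pos sa, ssummable_neg sa).
have -> : (fun e => `|a e|) = (fun e => pos a e + neg a e).
  apply/funext => e; rewrite /pos /neg.
  have [a0|a0] := leP 0 (a e); [rewrite ger0_norm//|rewrite ltr0_norm//];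
    by case: (leP (a e) 0); case: (leP (- a e) 0); lra.
rewrite sumR_add// /sumE -!/(sumR _).
have p0 : 0 <= sumR (pos a) by rewrite fine_ge0// esum_ge0// => e _; rewrite lee_fin.
have n0 : 0 <= sumR (neg a) by rewrite fine_ge0// esum_ge0// => e _; rewrite lee_fin.
by rewrite ler_norml; apply/andP; split; rewrite /pos /neg in p0 n0 *; lra.
Qed.

End SumE.

(** * The global inner product as a real bilinear form *)

Section InnerProduct.
Import Order.TTheory GRing.Theory Num.Theory.
Import numFieldNormedType.Exports.
Local Open Scope classical_set_scope.
Local Open Scope ring_scope.
Local Open Scope complex_scope.
Context {R : realType} {G : metricGraph R}.
Local Notation E := (edge G).
Local Notation efun := (E -> R -> R[i]).
Local Notation Re := (@complex.Re R).
Local Notation Im := (@complex.Im R).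
Implicit Types (f g h : efun) (z : R[i]) (e : E).

Definition axpy z f g : efun := fun e x => f e x + z * g e x.
Definition iscale f : efun := fun e x => 'i * f e x.

(* the real part of [inner f g]; the imaginary part is [ip f (iscale g)] *)
Definition ip f g : R := sumE (fun e => edge_inner (len e) (f e) (g e)).
Definition nrm2 f : R := ip f f.

Lemma inner_ip f g : inner f g = ip f g +i* ip f (iscale g).
Proof.
rewrite /inner /sumEC; congr (_ +i* _); congr sumE; apply/funext => e;
  by rewrite integralC_conj.
Qed.

Lemma L2_edge f e : L2 f -> edge_sq (len e) (f e).
Proof.
move=> [mf ff]; apply/edge_sqP; split=> //; apply: le_lt_trans ff.
rewrite -(@esum_set1 _ _ e (fun e => sqnorm_itv (len e) (f e)))//; last first.
  by apply: integral_ge0 => x _; rewrite lee_fin sqr_ge0.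
rewrite /sqnorm [leRHS]esum_mkcond esum_mkcond; apply: le_esum => e' _.
rewrite in_setT; case: ifP => // _.
by apply: integral_ge0 => x _; rewrite lee_fin sqr_ge0.
Qed.

Lemma sqnormE f : (forall e, edge_sq (len e) (f e)) ->
  sqnorm f = (\esum_(e in [set: E]) (edge_norm (len e) (f e))%:E)%E.
Proof. by move=> sf; apply: eq_esum => e _; rewrite sqnorm_itvE. Qed.

Lemma L2P f : L2 f <-> (forall e, edge_sq (len e) (f e)) /\
  (\esum_(e in [set: E]) (edge_norm (len e) (f e))%:E < +oo)%E.
Proof.
split=> [lf|[sf ff]].
  have sf e : edge_sq (len e) (f e) by exact: L2_edge.
  by split=> //; rewrite -sqnormE//; case: lf.
by split; [move=> e; have [] := (edge_sqP _ _).1 (sf e)|rewrite sqnormE].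
Qed.

Lemma L2_sqnorm f : L2 f -> sqnorm f = (nrm2 f)%:E.
Proof.
move=> /L2P[sf ff]; rewrite sqnormE// esum_ge0_fin//; last by move=> e; exact: edge_norm_ge0.
by rewrite /nrm2 /ip sumE_ge0// => e; exact: edge_norm_ge0.
Qed.

Lemma ip_ssummable f g : L2 f -> L2 g ->
  ssummable (fun e => edge_inner (len e) (f e) (g e)).
Proof.
move=> /L2P[sf ff] /L2P[sg fg].
apply: (@ssummable_le _ _ _ (fun e => edge_norm (len e) (f e) + edge_norm (len e) (g e))).
  by move=> e; exact: edge_inner_le.
under eq_esum do rewrite EFinD.
by rewrite esumD; [exact: lte_add_pinfty| |] => e _; rewrite lee_fin edge_norm_ge0.
Qed.

Lemma ipC f g : ip f g = ip g f.
Proof. by congr sumE; apply/funext => e; rewrite edge_innerC. Qed.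

Lemma ip_ii f g : ip (iscale f) (iscale g) = ip f g.
Proof. by congr sumE; apply/funext => e; rewrite edge_inner_ii. Qed.

Lemma nrm2_ge0 f : 0 <= nrm2 f.
Proof.
rewrite /nrm2 /ip sumE_ge0; last by move=> e; exact: edge_norm_ge0.
by rewrite fine_ge0// esum_ge0// => e _; rewrite lee_fin edge_norm_ge0.
Qed.

Lemma edge_norm_axpy_le l z u v : edge_sq l u -> edge_sq l v ->
  edge_norm l (fun x : R => u x + z * v x) <=
  2 * edge_norm l u + 2 * (Re z ^+ 2 + Im z ^+ 2) * edge_norm l v.
Proof.
move=> su sv; rewrite /edge_norm /edge_inner -!RintegralZl//;
  [|exact: edge_inner_integrable..].
have suv := edge_sq_axpy z su sv.
rewrite -RintegralD//; [|exact/itv_integrableZ/edge_inner_integrable..].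
apply: le_Rintegral => //; first exact: edge_inner_integrable.
  by apply: itv_integrableD; exact/itv_integrableZ/edge_inner_integrable.
move=> x _; rewrite !ReImE; move: (Re z) (Im z) (Re (u x)) (Im (u x)) (Re (v x)) (Im (v x)).
move=> a b p q r s.
have := sqr_ge0 (p - (a * r - b * s)); have := sqr_ge0 (q - (a * s + b * r)); nra.
Qed.

Lemma L2_axpy z f g : L2 f -> L2 g -> L2 (axpy z f g).
Proof.
move=> /L2P[sf ff] /L2P[sg fg]; apply/L2P; split=> [e|]; first exact: edge_sq_axpy.
set c := 2 * (Re z ^+ 2 + Im z ^+ 2).
have c0 : 0 <= c by rewrite mulr_ge0// addr_ge0// sqr_ge0.
apply: (@le_lt_trans _ _ (\esum_(e in [set: E])
  (2 * edge_norm (len e) (f e) + c * edge_norm (len e) (g e))%:E)%E).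
  by apply: le_esum => e _; rewrite lee_fin edge_norm_axpy_le.
under eq_esum do rewrite EFinD.
rewrite esumD; last 2 first.
- by move=> e _; rewrite lee_fin mulr_ge0// edge_norm_ge0.
- by move=> e _; rewrite lee_fin mulr_ge0// edge_norm_ge0.
rewrite !esum_scale//; try by move=> e; exact: edge_norm_ge0.
by apply: lte_add_pinfty; apply: lte_mul_pinfty; rewrite ?lee_fin.
Qed.

Lemma L2_ext f g : (forall e, f e = g e) -> L2 f -> L2 g.
Proof. by move=> fg; have -> : g = f by apply/funext. Qed.

Lemma L2_sub f g : L2 f -> L2 g -> L2 (fun e x => f e x - g e x).
Proof.
move=> lf lg; apply: L2_ext (L2_axpy (-1) lf lg) => e; apply/funext => x.
by rewrite /axpy mulN1r.
Qed.

Lemma L2_cst0 : L2 (fun (_ : E) _ => 0).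
Proof.
apply/L2P; split=> [e|]; first by split; exact: (sq_integrable_cst _ _ 0).
rewrite esum1// => e _; congr EFin; rewrite /edge_norm /edge_inner.
rewrite (@eq_Rintegral _ _ _ _ _ (cst 0)); last by move=> x _; rewrite /= mulr0 addr0.
by rewrite Rintegral_cst// mul0r.
Qed.

Lemma L2_iscale f : L2 f -> L2 (iscale f).
Proof.
move=> lf; apply: L2_ext (L2_axpy 'i L2_cst0 lf) => e; apply/funext => x.
by rewrite /axpy add0r.
Qed.

Lemma ip_axpyl (t : R) f g h : L2 f -> L2 g -> L2 h ->
  ip (axpy t%:C f g) h = ip f h + t * ip g h.
Proof.
move=> lf lg lh; rewrite /ip -sumEZ; last exact: ip_ssummable.
rewrite -sumED; [|exact: ip_ssummable|exact/ssummableZ/ip_ssummable].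
by congr sumE; apply/funext => e; rewrite edge_inner_axpy//; exact: L2_edge.
Qed.

Opaque ip.

Lemma ip_axpyr (t : R) f g h : L2 f -> L2 g -> L2 h ->
  ip h (axpy t%:C f g) = ip h f + t * ip h g.
Proof. by move=> lf lg lh; rewrite (ipC h) (ip_axpyl t lf lg lh) (ipC f) (ipC g). Qed.

Lemma nrm2_axpy (t : R) f g : L2 f -> L2 g ->
  nrm2 (axpy t%:C f g) = nrm2 f + 2 * t * ip f g + t ^+ 2 * nrm2 g.
Proof.
move=> lf lg; have la := L2_axpy t%:C lf lg.
rewrite /nrm2 (ip_axpyl t lf lg la) (ip_axpyr t lf lg lf) (ip_axpyr t lf lg lg) (ipC g f).
have alg (p q r : R) : p + t * q + t * (q + t * r) = p + 2 * t * q + t ^+ 2 * r by ring.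
exact: alg.
Qed.

Lemma nrm2E f : nrm2 f = ip f f. Proof. by []. Qed.

Opaque nrm2.

Lemma sub_axpy f g : (fun e x => f e x - g e x) = axpy (-1)%:C f g.
Proof.
apply/funext => e; apply/funext => x; rewrite /axpy.
have -> : (-1)%:C = -1 :> R[i] by apply/eqP; rewrite eq_complex /= oppr0 !eqxx.
by rewrite mulN1r.
Qed.

Lemma ip_subl f g h : L2 f -> L2 g -> L2 h ->
  ip (fun e x => f e x - g e x) h = ip f h - ip g h.
Proof. by move=> lf lg lh; rewrite sub_axpy ip_axpyl// mulN1r. Qed.

Lemma ip_subr f g h : L2 f -> L2 g -> L2 h ->
  ip h (fun e x => f e x - g e x) = ip h f - ip h g.
Proof. by move=> lf lg lh; rewrite (ipC h) (ip_subl lf lg lh) (ipC f) (ipC g). Qed.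

Lemma nrm2_sub f g : L2 f -> L2 g ->
  nrm2 (fun e x => f e x - g e x) = nrm2 f - 2 * ip f g + nrm2 g.
Proof. move=> lf lg; rewrite sub_axpy (nrm2_axpy _ lf lg).
have alg (p q r : R) : p + 2 * -1 * q + (-1) ^+ 2 * r = p - 2 * q + r by ring.
exact: alg. Qed.

Lemma ip_cauchy_schwarz f g : L2 f -> L2 g -> ip f g ^+ 2 <= nrm2 f * nrm2 g.
Proof.
move=> lf lg; apply: quadratic_ge0 (nrm2_ge0 g) => t.
by rewrite -nrm2_axpy//; exact: nrm2_ge0.
Qed.

Lemma ip_le f g : L2 f -> L2 g -> `|ip f g| <= Num.sqrt (nrm2 f) * Num.sqrt (nrm2 g).
Proof.
move=> lf lg; rewrite -sqrtrM ?nrm2_ge0// -sqrtr_sqr ler_sqrt ?mulr_ge0 ?nrm2_ge0//.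
exact: ip_cauchy_schwarz.
Qed.

Lemma nrm2_triangle f g h : L2 f -> L2 g -> L2 h ->
  nrm2 (fun e x => f e x - h e x) <=
  2 * nrm2 (fun e x => f e x - g e x) + 2 * nrm2 (fun e x => g e x - h e x).
Proof.
move=> lf lg lh; set a := fun e x => f e x - g e x; set b := fun e x => g e x - h e x.
have la : L2 a by exact: L2_sub. have lb : L2 b by exact: L2_sub.
have -> : (fun e x => f e x - h e x) = axpy 1%:C a b.
  by apply/funext => e; apply/funext => x; rewrite /axpy mul1r /a /b addrA subrK.
have := nrm2_ge0 (fun e x => a e x - b e x).
rewrite (nrm2_sub la lb) (nrm2_axpy _ la lb).
have alg (p q r : R) : 0 <= p - 2 * q + r -> p + 2 * 1 * q + 1 ^+ 2 * r <= 2 * p + 2 * r.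
  by lra.
exact: alg.
Qed.

Lemma edge_norm_le_nrm2 f e : L2 f -> edge_norm (len e) (f e) <= nrm2 f.
Proof.
move=> lf; rewrite -lee_fin -L2_sqnorm// -sqnorm_itvE; last exact: L2_edge.
rewrite -(@esum_set1 _ _ e (fun e => sqnorm_itv (len e) (f e)))//; last first.
  by apply: integral_ge0 => x _; rewrite lee_fin sqr_ge0.
rewrite /sqnorm [leRHS]esum_mkcond esum_mkcond; apply: le_esum => e' _.
rewrite in_setT; case: ifP => // _.
by apply: integral_ge0 => x _; rewrite lee_fin sqr_ge0.
Qed.

Lemma sum_edge_norm_le f (F : {fset E}) : L2 f ->
  \sum_(e <- F) edge_norm (len e) (f e) <= nrm2 f.
Proof.
move=> lf; rewrite -lee_fin -L2_sqnorm// sqnormE; last by move=> e; exact: L2_edge.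
rewrite -sumEFin; apply: ereal_sup_ubound; exists [set` F].
  by split=> //; exact: finite_fset.
by rewrite fsbig_finite/= ?set_fsetK//; exact: finite_fset.
Qed.

(** The squared norm is a supremum of finite partial sums, so one uniform bound on these yields
    membership in [L2] and the norm estimate at once. *)
Lemma nrm2_le f (C : R) : (forall e, edge_sq (len e) (f e)) ->
  (forall F : {fset E}, \sum_(e <- F) edge_norm (len e) (f e) <= C) ->
  L2 f /\ nrm2 f <= C.
Proof.
move=> sf FC; have H : (sqnorm f <= C%:E)%E.
  rewrite sqnormE//; apply: ge_ereal_sup => _ [A [fA _] <-].
  by rewrite fsbig_finite//= sumEFin lee_fin.
have lf : L2 f by apply/L2P; split=> //; rewrite -sqnormE//; apply: le_lt_trans H (ltry _).
by split=> //; rewrite -lee_fin -L2_sqnorm.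
Qed.

End InnerProduct.

Opaque ip nrm2.

(** * The closed form and the Kirchhoff Laplacian *)

Section OperatorDomain.
Import Order.TTheory GRing.Theory Num.Theory.
Import numFieldNormedType.Exports.
Local Open Scope classical_set_scope.
Local Open Scope ring_scope.
Local Open Scope complex_scope.
Context {R : realType} {G : metricGraph R}.
Local Notation mu := (@lebesgue_measure R).
Local Notation V := (vertex G).
Local Notation E := (edge G).
Local Notation efun := (E -> R -> R[i]).
Local Notation Re := (@complex.Re R).
Local Notation Im := (@complex.Im R).
Implicit Types (z : R[i]) (e : E) (D : set V).

Definition CH1 (l : R) (u u' : R -> R[i]) :=
  H1 l (fun x => Re (u x)) (fun x => Re (u' x)) /\
  H1 l (fun x => Im (u x)) (fun x => Im (u' x)).

Lemma CH1_edge_sq l u u' : CH1 l u u' -> edge_sq l u /\ edge_sq l u'.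
Proof.
by move=> [h1 h2]; split; split; [exact: H1_sq_integrable h1|
  exact: H1_sq_integrable h2|case: h1|case: h2].
Qed.

Lemma CH1_axpy l z u u' v v' : CH1 l u u' -> CH1 l v v' ->
  CH1 l (fun x => u x + z * v x) (fun x => u' x + z * v' x).
Proof.
move=> [u1 u2] [v1 v2].
have lin a b : H1 l (fun x => a * Re (v x) + b * Im (v x))
    (fun x => a * Re (v' x) + b * Im (v' x)) by apply: H1_add; exact: H1_scale.
split.
- have -> : (fun x => Re (u x + z * v x)) =
    (fun x => Re (u x) + (Re z * Re (v x) + (- Im z) * Im (v x))).
    by apply/funext => x; rewrite !ReImE; ring.
  have -> : (fun x => Re (u' x + z * v' x)) =
    (fun x => Re (u' x) + (Re z * Re (v' x) + (- Im z) * Im (v' x))).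
    by apply/funext => x; rewrite !ReImE; ring.
  exact: H1_add.
- have -> : (fun x => Im (u x + z * v x)) =
    (fun x => Im (u x) + (Im z * Re (v x) + Re z * Im (v x))).
    by apply/funext => x; rewrite !ReImE; ring.
  have -> : (fun x => Im (u' x + z * v' x)) =
    (fun x => Im (u' x) + (Im z * Re (v' x) + Re z * Im (v' x))).
    by apply/funext => x; rewrite !ReImE; ring.
  exact: H1_add.
Qed.

(** Exposes that [f'] is itself absolutely continuous, so that the derivative of a function in
    [dom_H0] can serve as the fixed test function in [CH1_weak]. *)
Lemma H2P l f f' : H2 l f f' <-> exists f'', CH1 l f' f'' /\ CH1 l f f'.
Proof.
split=> [[f'' [m2 s2 E1 E0]]|[f'' [[r1 i1] [r0 i0]]]].
- have [sr si] : edge_sq l f'' by apply/edge_sqP.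
  have c1 : CH1 l f' f''.
    by split; split=> // x xl; rewrite E1 ?in_itv//= !ReImE.
  exists f''; split=> //; have [[sr' si'] _] := CH1_edge_sq c1.
  by split; split=> // x xl; rewrite E0 ?in_itv//= !ReImE.
- exists f''; have sf : edge_sq l f'' by split; [case: r1|case: i1].
  have [mf ff] := (edge_sqP _ _).1 sf.
  split=> // x; rewrite in_itv/= => xl; apply: complex_eq; rewrite !ReImE.
  + by have [_ ->] := r1. + by have [_ ->] := i1.
  + by have [_ ->] := r0. + by have [_ ->] := i0.
Qed.

Lemma CH1_weak l g g' (M eps : R) : 0 < l -> CH1 l g g' -> 0 < eps ->
  exists2 delta, 0 < delta & forall f f', CH1 l f f' ->
    edge_norm l f <= delta -> edge_norm l f' <= M ->
    `|edge_inner l f' g| <= eps.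
Proof.
move=> l0 [gr gi] e0; have e2 : 0 < eps / 2 by rewrite divr_gt0.
have [d1 d10 P1] := H1_weak M l0 gr e2.
have [d2 d20 P2] := H1_weak M l0 gi e2.
exists (Num.min d1 d2); first by rewrite lt_min d10.
move=> f f' cf; have [sf sf'] := CH1_edge_sq cf; have [fr fi] := cf.
rewrite (edge_normE sf) (edge_normE sf') le_min => /andP[h1 h2] hM.
have q0 (a : R -> R) : 0 <= \int[mu]_(x in `[0, l]) a x ^+ 2.
  by apply: Rintegral_ge0 => *; exact: sqr_ge0.
have [[sr si] [gr' gi']] := (sf', (H1_sq_integrable gr, H1_sq_integrable gi)).
rewrite /edge_inner RintegralD//; [|exact: sq_integrable_mul..].
rewrite [leRHS]splitr; apply: le_trans (ler_normD _ _) (lerD _ _).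
- apply: P1 fr _ _; [apply: le_trans h1|apply: le_trans hM]; by rewrite lerDl.
- apply: P2 fi _ _; [apply: le_trans h2|apply: le_trans hM]; by rewrite lerDr.
Qed.

Implicit Types (f g h u w : efun).

Lemma dom_H0_CH1 D u u' e : dom_H0 D u u' -> CH1 (len e) (u e) (u' e).
Proof. by move=> [/(_ e)/H2P[k []]]. Qed.

Lemma dom_H0_CH1' D u u' e : dom_H0 D u u' ->
  exists k, CH1 (len e) (u' e) k.
Proof. by move=> [/(_ e)/H2P[k [c _]]]; exists k. Qed.

Lemma dom_H0_edge_sq D u u' e : dom_H0 D u u' ->
  edge_sq (len e) (u e) /\ edge_sq (len e) (u' e).
Proof. by move=> /dom_H0_CH1 - /(_ e)/CH1_edge_sq. Qed.

Lemma edge_norm_eq0 l (u : R -> R[i]) : {in `[0, l], forall x, u x = 0} -> edge_norm l u = 0.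
Proof.
move=> u0; rewrite /edge_norm /edge_inner.
rewrite (@eq_Rintegral _ _ _ _ _ (cst 0)); first by rewrite Rintegral_cst// mul0r.
by move=> x; rewrite inE => xl; rewrite u0//= mulr0 addr0.
Qed.

(** [dom_H0] asks only [u] to live on finitely many edges. On the other edges [u] has norm 0, so
    [CH1_weak] with test function [u' e] bounds the norm of [u' e] by every positive [eps]. *)
Lemma dom_H0_support D u u' : dom_H0 D u u' ->
  exists F : {fset E}, forall e, e \notin F ->
    edge_norm (len e) (u e) = 0 /\ edge_norm (len e) (u' e) = 0.
Proof.
move=> du; have [_ fu _ _ _] := du; exists (fset_set
  [set e | exists2 x, x \in `[0, len e] & u e x != 0]) => e.
rewrite in_fset_set// notin_setE => ne.
have u0 : edge_norm (len e) (u e) = 0.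
  apply: edge_norm_eq0 => x xl; apply/eqP/negPn/negP => ux; apply: ne.
  by exists x.
split=> //; have [k c'] := dom_H0_CH1' e du.
apply/eqP; rewrite eq_le edge_norm_ge0 andbT; apply/ler_addgt0Pr => eps e0.
have [d d0 dP] := CH1_weak (edge_norm (len e) (u' e)) (len_gt0 e) c' e0.
rewrite add0r; apply: le_trans (ler_norm _) _.
by apply: dP (dom_H0_CH1 e du) _ _ => //; rewrite u0 ltW.
Qed.

Lemma nrm2_fsupport f (F : {fset E}) : (forall e, edge_sq (len e) (f e)) ->
  (forall e, e \notin F -> edge_norm (len e) (f e) = 0) ->
  L2 f /\ nrm2 f <= \sum_(e <- F) edge_norm (len e) (f e).
Proof.
move=> sf fF; apply: nrm2_le => // F'.
rewrite (big_fsetID _ (fun e => e \in F) F')/= [X in _ + X]big1_fset ?addr0; last first.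
  by move=> e; rewrite !inE => /andP[_ /fF].
rewrite [leRHS](big_fsetID _ (fun e => e \in F'))/=.
rewrite (_ : [fset x in F' | x \in F]%fset = [fset x in F | x \in F']%fset); last first.
  by apply/fsetP => e; rewrite !inE andbC.
by rewrite lerDl sumr_ge0// => e _; exact: edge_norm_ge0.
Qed.

Lemma dom_H0_L2 D u u' : dom_H0 D u u' -> L2 u /\ L2 u'.
Proof.
move=> du; have [F FP] := dom_H0_support du; split.
- have [] // := @nrm2_fsupport u F.
  + by move=> e; have [] := dom_H0_edge_sq e du.
  + by move=> e /FP[].
- have [] // := @nrm2_fsupport u' F.
  + by move=> e; have [] := dom_H0_edge_sq e du.
  + by move=> e /FP[].
Qed.

Lemma vertex_value_axpy z f g e v :
  vertex_value (axpy z f g) e v = vertex_value f e v + z * vertex_value g e v.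
Proof. by rewrite /vertex_value; case: ifP. Qed.

Lemma inward_deriv_axpy z f g e v :
  inward_deriv (axpy z f g) e v = inward_deriv f e v + z * inward_deriv g e v.
Proof. by rewrite /inward_deriv; case: ifP => // _; rewrite /axpy opprD mulrN. Qed.

Lemma dom_H0_axpy D z u u' w w' : dom_H0 D u u' -> dom_H0 D w w' ->
  dom_H0 D (axpy z u w) (axpy z u' w').
Proof.
move=> [u1 u2 u3 u4 u5] [w1 w2 w3 w4 w5]; split.
- move=> e; have /H2P[a [a1 a2]] := u1 e; have /H2P[b [b1 b2]] := w1 e.
  by apply/H2P; exists (fun x => a x + z * b x); split; exact: CH1_axpy.
- apply: (@sub_finite_set _ _ ([set e | exists2 x, x \in `[0, len e] & u e x != 0] `|`
     [set e | exists2 x, x \in `[0, len e] & w e x != 0])); last by rewrite finite_setU.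
  move=> e /= [x xl]; rewrite /axpy => nz.
  have [u0|] := eqVneq (u e x) 0; last by left; exists x.
  right; exists x => //; apply: contraNneq nz => ->; by rewrite u0 mulr0 addr0.
- move=> v Dv e e' ev e'v; rewrite !vertex_value_axpy.
  by rewrite (u3 v Dv e e')// (w3 v Dv e e').
- move=> v Dv; have := u4 v Dv; have := w4 v Dv.
  have fs := locally_finite v.
  rewrite !fsbig_finite//= => sw su.
  under eq_bigr do rewrite inward_deriv_axpy.
  by rewrite big_split/= su -mulr_sumr sw mulr0 addr0.
- move=> v Dv e ev; rewrite vertex_value_axpy u5// w5// mulr0 addr0//.
Qed.

Lemma dom_H0_0 D : dom_H0 D (fun _ _ => 0) (fun _ _ => 0).
Proof.
have h0 l : H1 l (fun _ => 0 : R) (fun _ => 0).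
  split; first exact: (sq_integrable_cst _ _ 0).
  by move=> x xl; rewrite Rintegral_cst// mul0r addr0.
split.
- by move=> e; apply/H2P; exists (fun=> 0); split; split; exact: h0.
- rewrite (_ : [set _ | _] = set0)//; apply/seteqP; split=> // e [x _].
  by rewrite eqxx.
- by move=> v _ e e' _ _; rewrite /vertex_value !if_same.
- move=> v _; rewrite fsbig1// => e _; rewrite /inward_deriv.
  by case: ifP; rewrite ?oppr0.
- by move=> v _ e _; rewrite /vertex_value if_same.
Qed.

Lemma dom_H0_sub D u u' w w' : dom_H0 D u u' -> dom_H0 D w w' ->
  dom_H0 D (fun e x => u e x - w e x) (fun e x => u' e x - w' e x).
Proof. by move=> du dw; rewrite !sub_axpy; exact: dom_H0_axpy. Qed.

Lemma iscaleE f : iscale f = axpy 'i (fun _ _ => 0) f.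
Proof. by apply/funext => e; apply/funext => x; rewrite /axpy add0r. Qed.

Lemma dom_H0_iscale D u u' : dom_H0 D u u' -> dom_H0 D (iscale u) (iscale u').
Proof. by move=> du; rewrite !iscaleE; apply: dom_H0_axpy => //; exact: dom_H0_0. Qed.

Lemma ip_fsupport f g (F : {fset E}) : L2 f -> L2 g ->
  (forall e, e \notin F -> edge_norm (len e) (g e) = 0) ->
  `|ip f g| <= \sum_(e <- F) `|edge_inner (len e) (f e) (g e)|.
Proof.
move=> lf lg gF; have ss := ip_ssummable lf lg.
have sp : sumR (fun e => `|edge_inner (len e) (f e) (g e)|) <=
    \sum_(e <- F) `|edge_inner (len e) (f e) (g e)|.
  rewrite -lee_fin -esum_ge0_fin//; apply: ge_ereal_sup => _ [A [fA _] <-].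
  rewrite fsbig_finite//= sumEFin lee_fin.
  rewrite (big_fsetID _ (fun e => e \in F) (fset_set A))/= [X in _ + X]big1_fset ?addr0.
    rewrite [leRHS](big_fsetID _ (fun e => e \in fset_set A))/=.
    rewrite (_ : [fset x in fset_set A | x \in F]%fset =
      [fset x in F | x \in fset_set A]%fset); last first.
      by apply/fsetP => e; rewrite !inE andbC.
    by rewrite lerDl sumr_ge0.
  move=> e; rewrite !inE => /andP[_ /gF g0] _; apply/eqP; rewrite normr_eq0 -sqrf_eq0.
  rewrite eq_le sqr_ge0 andbT.
  have := edge_inner_cauchy_schwarz (L2_edge e lf) (L2_edge e lg).
  by rewrite g0 mulr0.
exact: le_trans (sumE_norm_le ss) sp.
Qed.

End OperatorDomain.

Opaque edge_inner.

(** * Null sequences of real numbers *)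

Section RealSequences.
Import Order.TTheory GRing.Theory Num.Theory.
Import numFieldNormedType.Exports.
Local Open Scope classical_set_scope.
Local Open Scope ring_scope.
Context {R : realType}.
Implicit Types (a b : nat -> R).

Lemma cvg0_ge0P a : (forall n, 0 <= a n) ->
  (a @ \oo --> (0 : R)) <->
  (forall eps, 0 < eps -> exists N, forall n, (N <= n)%N -> a n <= eps).
Proof.
move=> a0; split=> [/cvgr0Pnorm_le H eps eps0|H].
  have [N _ NP] := H _ eps0; exists N => n Nn.
  exact: le_trans (ler_norm _) (NP n Nn).
apply/cvgr0Pnorm_le => eps eps0; have [N NP] := H _ eps0; exists N => // n Nn /=.
by rewrite ger0_norm//; exact: NP.
Qed.

Lemma cauchy_seq_cvg a : (forall eps, 0 < eps ->
    exists N, forall m n, (N <= m)%N -> (N <= n)%N -> `|a m - a n| <= eps) ->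
  exists l : R, a @ \oo --> l.
Proof.
move=> H; suff : cvg (a @ \oo) by move=> c; exists (lim (a @ \oo)).
apply/cauchy_cvgP/cauchy_exP => eps eps0.
have e2 : 0 < eps / 2 by rewrite divr_gt0.
have [N NP] := H _ e2; exists (a N); exists N => // n Nn.
rewrite /ball/=; apply: le_lt_trans (NP N n (leqnn _) Nn) _.
by rewrite ltr_pdivrMr// mulr_natr mulr2n ltrDl.
Qed.

Lemma cvg0_sqrt a : a @ \oo --> (0 : R) -> (fun n => Num.sqrt (a n)) @ \oo --> (0 : R).
Proof.
move=> a0; rewrite -[X in _ --> X]sqrtr0.
by apply: (@cvg_comp _ _ _ a Num.sqrt _ (nbhs (0 : R))) => //; exact: sqrt_continuous.
Qed.

Lemma cvg0_bilinear a b (k k' : R) : a @ \oo --> (0 : R) -> b @ \oo --> (0 : R) ->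
  (fun n => a n * b n + a n * k + k' * b n) @ \oo --> (0 : R).
Proof.
move=> a0 b0; have -> : (0 : R) = 0 * 0 + 0 * k + k' * 0 by ring.
exact: (cvgD (cvgD (cvgM a0 b0) (cvgM a0 (cvg_cst k))) (cvgM (cvg_cst k') b0)).
Qed.

Lemma cvg0_lin a b (k k' : R) : a @ \oo --> (0 : R) -> b @ \oo --> (0 : R) ->
  (fun n => k * a n + k' * b n) @ \oo --> (0 : R).
Proof.
move=> a0 b0; have -> : (0 : R) = k * 0 + k' * 0 by ring.
exact: (cvgD (cvgM (cvg_cst k) a0) (cvgM (cvg_cst k') b0)).
Qed.

Lemma cvg0_squeeze a b : (forall n, `|a n| <= b n) -> b @ \oo --> (0 : R) ->
  a @ \oo --> (0 : R).
Proof.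
move=> ab b0; apply: norm_cvg0; apply: squeeze_cvgr (cvg_cst 0) b0.
by apply: nearW => n; rewrite normr_ge0/=.
Qed.

End RealSequences.

(** * Closability of the energy form *)

Section Closability.
Import Order.TTheory GRing.Theory Num.Theory.
Import numFieldNormedType.Exports.
Local Open Scope classical_set_scope.
Local Open Scope ring_scope.
Local Open Scope complex_scope.
Context {R : realType} {G : metricGraph R}.
Local Notation mu := (@lebesgue_measure R).
Local Notation V := (vertex G).
Local Notation E := (edge G).
Local Notation efun := (E -> R -> R[i]).
Local Notation Re := (@complex.Re R).
Local Notation Im := (@complex.Im R).
Implicit Types (z : R[i]) (e : E) (D : set V) (f g h : efun) (u w d : nat -> efun).

Lemma nrm2_le2 f g : L2 f -> L2 g ->
  nrm2 f <= 2 * nrm2 (fun e x => f e x - g e x) + 2 * nrm2 g.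
Proof.
move=> lf lg; have := nrm2_ge0 (axpy (- 2)%:C f g).
rewrite (nrm2_axpy _ lf lg) (nrm2_sub lf lg).
have alg (p q r : R) : 0 <= p + 2 * -2 * q + (-2) ^+ 2 * r ->
  p <= 2 * (p - 2 * q + r) + 2 * r by lra.
exact: alg.
Qed.

Definition cauchy_nrm2 u := forall eps : R, 0 < eps -> exists N, forall m n,
  (N <= m)%N -> (N <= n)%N -> nrm2 (fun e x => u m e x - u n e x) < eps.

Lemma cauchy_nrm2_bounded u : (forall n, L2 (u n)) -> cauchy_nrm2 u ->
  exists2 M : R, 0 <= M & exists N, forall n, (N <= n)%N -> nrm2 (u n) <= M.
Proof.
move=> lu /(_ 1 ltr01)[N NP]; exists (2 + 2 * nrm2 (u N)).
  by rewrite addr_ge0// mulr_ge0// nrm2_ge0.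
exists N => n Nn; apply: le_trans (nrm2_le2 (lu n) (lu N)) _.
by have := NP n N Nn (leqnn _); lra.
Qed.

(* [|d' n|^2] is [(d' n, d' n - d' N)], small by the Cauchy property, plus
   [(d' n, d' N)], which tends to 0 because [d' N] is absolutely continuous and
   finitely supported while [d n] tends to 0. *)
Lemma form_closable D d d' : (forall n, dom_H0 D (d n) (d' n)) ->
  (fun n => nrm2 (d n)) @ \oo --> (0 : R) -> cauchy_nrm2 d' ->
  (fun n => nrm2 (d' n)) @ \oo --> (0 : R).
Proof.
move=> dd d0 cd'.
have ld n : L2 (d n) by have [] := dom_H0_L2 (dd n).
have ld' n : L2 (d' n) by have [] := dom_H0_L2 (dd n).
have [M M0 [N1 MP]] := cauchy_nrm2_bounded ld' cd'.
apply/(cvg0_ge0P (fun n => nrm2_ge0 (d' n))) => eps eps0.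
have e20 : 0 < (eps / 2) ^+ 2 / (M + 1).
  by rewrite divr_gt0 ?exprn_gt0 ?divr_gt0// ltr_wpDl.
have [N2 N2P] := cd' _ e20; pose N := maxn N1 N2.
have [F FP] := dom_H0_support (dd N).
(* Each edge of [F] receives an equal share of [eps / 2]; the successor keeps the divisor positive
   when [F] is empty. *)
pose k : R := (size F).+1%:R.
have k0 : 0 < k by rewrite ltr0n.
have ek0 : 0 < eps / 2 / k by rewrite !divr_gt0.
have /cvg0_ge0P d0' := d0.
have edge e : exists N3, forall n, (N3 <= n)%N ->
    `|edge_inner (len e) (d' n e) (d' N e)| <= eps / 2 / k.
  have [g' c'] := dom_H0_CH1' e (dd N).
  have [delta delta0 dP] := CH1_weak M (len_gt0 e) c' ek0.
  have [N4 N4P] := d0' (fun n => nrm2_ge0 (d n)) _ delta0.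
  exists (maxn N1 N4) => n; rewrite geq_max => /andP[n1 n4].
  apply: dP (dom_H0_CH1 e (dd n)) _ _.
    exact: le_trans (edge_norm_le_nrm2 e (ld n)) (N4P n n4).
  exact: le_trans (edge_norm_le_nrm2 e (ld' n)) (MP n n1).
have [T TP] : exists T, forall n, (T <= n)%N -> forall e, e \in (F : seq E) ->
    `|edge_inner (len e) (d' n e) (d' N e)| <= eps / 2 / k.
  elim: (F : seq E) => [|e s [T TP]]; first by exists 0%N.
  have [T1 T1P] := edge e; exists (maxn T1 T) => n; rewrite geq_max => /andP[n1 n2] e'.
  by rewrite inE => /predU1P[->|es]; [exact: T1P|exact: TP].
exists (maxn N T) => n; rewrite geq_max => /andP[nN nT].
have nN1 : (N1 <= n)%N by apply: leq_trans nN; exact: leq_maxl.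
have nN2 : (N2 <= n)%N by apply: leq_trans nN; exact: leq_maxr.
have -> : nrm2 (d' n) = ip (d' n) (fun e x => d' n e x - d' N e x) + ip (d' n) (d' N).
  by rewrite ip_subr// subrK.
rewrite [leRHS]splitr; apply: le_trans (ler_norm _) _.
apply: le_trans (ler_normD _ _) (lerD _ _).
  rewrite -(@ler_pXn2r _ 2)// ?nnegrE ?divr_ge0 ?(ltW eps0)// real_normK ?num_real//.
  apply: le_trans (ip_cauchy_schwarz (ld' n) (L2_sub (ld' n) (ld' N))) _.
  apply: (@le_trans _ _ ((M + 1) * ((eps / 2) ^+ 2 / (M + 1)))).
    apply: ler_pM; rewrite ?nrm2_ge0//.
      by apply: le_trans (MP n nN1) _; rewrite lerDl.
    by apply/ltW/N2P => //; exact: leq_maxr.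
  by rewrite mulrC divfK// gt_eqF// ltr_wpDl.
apply: (le_trans (ip_fsupport (ld' n) (ld' N) _)); first by move=> e /FP[].
apply: (@le_trans _ _ (\sum_(e <- F) (eps / 2 / k))).
  by rewrite big_seq [leRHS]big_seq; apply: ler_sum => e eF; exact: TP.
rewrite big_const_seq count_predT iter_addr_0 -[leLHS]mulr_natr.
by rewrite mulrAC ler_pdivrMr// ler_wpM2l ?divr_ge0 ?(ltW eps0)// ler_nat.
Qed.

Lemma ip_cvg u w f h : (forall n, L2 (u n)) -> (forall n, L2 (w n)) -> L2 f -> L2 h ->
  (fun n => nrm2 (fun e x => u n e x - f e x)) @ \oo --> (0 : R) ->
  (fun n => nrm2 (fun e x => w n e x - h e x)) @ \oo --> (0 : R) ->
  (fun n => ip (u n) (w n)) @ \oo --> ip f h.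
Proof.
move=> lu lw lf lh uf wh.
apply/subr_cvg0; apply: cvg0_squeeze (cvg0_bilinear (Num.sqrt (nrm2 h))
  (Num.sqrt (nrm2 f)) (cvg0_sqrt uf) (cvg0_sqrt wh)) => n.
have lun := L2_sub (lu n) lf; have lwn := L2_sub (lw n) lh.
have -> : ip (u n) (w n) - ip f h =
    ip (fun e x => u n e x - f e x) (fun e x => w n e x - h e x) +
    ip (fun e x => u n e x - f e x) h + ip f (fun e x => w n e x - h e x).
  rewrite (ip_subr (lw n) lh lun) (ip_subr (lw n) lh lf).
  rewrite (ip_subl (lu n) lf (lw n)) (ip_subl (lu n) lf lh).
  have alg (p q r s : R) : p - s = (p - r) - (q - s) + (q - s) + (r - s) by ring.
  exact: alg.
apply: le_trans (ler_normD _ _) (lerD _ (ip_le lf lwn)).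
exact: le_trans (ler_normD _ _) (lerD (ip_le lun lwn) (ip_le lun lh)).
Qed.


Lemma nrm2_subC f g : L2 f -> L2 g ->
  nrm2 (fun e x => f e x - g e x) = nrm2 (fun e x => g e x - f e x).
Proof.
move=> lf lg; rewrite (nrm2_sub lf lg) (nrm2_sub lg lf) (ipC g f).
have alg (p q r : R) : p - q + r = r - q + p by ring.
exact: alg.
Qed.

Lemma nrm2_sub_le f g : L2 f -> L2 g ->
  nrm2 (fun e x => f e x - g e x) <= 2 * nrm2 f + 2 * nrm2 g.
Proof.
move=> lf lg; have := nrm2_ge0 (axpy 1%:C f g); rewrite nrm2_axpy// nrm2_sub//.
have alg (p q r : R) : 0 <= p + 2 * 1 * q + 1 ^+ 2 * r ->
  p - 2 * q + r <= 2 * p + 2 * r by lra.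
exact: alg.
Qed.

Lemma ip_null f g h : L2 f -> L2 g -> L2 h ->
  nrm2 (fun e x => f e x - g e x) = 0 -> ip f h = ip g h.
Proof.
move=> lf lg lh fg0; apply/eqP; rewrite -subr_eq0 -ip_subl// -sqrf_eq0.
rewrite eq_le sqr_ge0 andbT; apply: le_trans (ip_cauchy_schwarz (L2_sub lf lg) lh) _.
by rewrite fg0 mul0r.
Qed.

(** Passes from the extended-real [sqnorm] to the real [nrm2], where bilinear algebra is available.
    Membership of [f] in [L2] makes all the norms finite. *)
Lemma form_approxP D u u' f : L2 f -> form_approx D u u' f <->
  [/\ forall n, dom_H0 D (u n) (u' n),
      (fun n => nrm2 (fun e x => u n e x - f e x)) @ \oo --> (0 : R) &
      cauchy_nrm2 u'].
Proof.
move=> lf.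
have E1 (du : forall n, dom_H0 D (u n) (u' n)) : (fun n => sqnorm (fun e x => u n e x - f e x)) =
    EFin \o (fun n => nrm2 (fun e x => u n e x - f e x)).
  by apply/funext => n /=; rewrite L2_sqnorm//; apply: L2_sub => //; have [] := dom_H0_L2 (du n).
have E2 (du : forall n, dom_H0 D (u n) (u' n)) m n : sqnorm (fun e x => u' m e x - u' n e x) =
    (nrm2 (fun e x => u' m e x - u' n e x))%:E.
  rewrite L2_sqnorm//; apply: L2_sub; [by have [] := dom_H0_L2 (du m)|].
  by have [] := dom_H0_L2 (du n).
split=> -[du uf cu]; split=> //.
- move: uf; rewrite E1// => uf; have [_ H] := (fine_cvgP _ 0).1 uf; exact: H.
- move=> eps /cu[N NP]; exists N => m n Nm Nn.
  by have := NP m n Nm Nn; rewrite E2// lte_fin.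
- by rewrite E1//; apply: (fine_cvgP _ (0 : R)).2; split=> //; exact: nearW.
- move=> eps /cu[N NP]; exists N => m n Nm Nn.
  by rewrite E2// lte_fin; exact: NP.
Qed.

(** Applied to derivatives, this produces the value of the closed form, whose existence the relation
    [closed_form] does not provide by itself. *)
Lemma ip_cauchy_cvg u w : (forall n, L2 (u n)) -> (forall n, L2 (w n)) ->
  cauchy_nrm2 u -> cauchy_nrm2 w -> exists l : R, (fun n => ip (u n) (w n)) @ \oo --> l.
Proof.
move=> lu lw cu cw; apply: cauchy_seq_cvg => eps eps0.
have [M M0 [N1 MP]] := cauchy_nrm2_bounded lu cu.
have [M' M'0 [N2 MP']] := cauchy_nrm2_bounded lw cw.
have d0 : 0 < (eps / 2) ^+ 2 / (M + M' + 1).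
  by rewrite divr_gt0 ?exprn_gt0 ?divr_gt0// ltr_wpDl// addr_ge0.
have [N3 N3P] := cu _ d0; have [N4 N4P] := cw _ d0.
have half f g (K : R) : L2 f -> L2 g -> nrm2 f < (eps / 2) ^+ 2 / (M + M' + 1) ->
    nrm2 g <= K -> K <= M + M' + 1 -> `|ip f g| <= eps / 2.
  move=> lf lg f1 g1 K1.
  rewrite -(@ler_pXn2r _ 2)// ?nnegrE ?divr_ge0 ?(ltW eps0)// real_normK ?num_real//.
  apply: le_trans (ip_cauchy_schwarz lf lg) _.
  apply: (@le_trans _ _ ((eps / 2) ^+ 2 / (M + M' + 1) * (M + M' + 1))).
    apply: ler_pM; rewrite ?nrm2_ge0//; first exact: ltW.
    exact: le_trans K1.
  by rewrite divfK// gt_eqF// ltr_wpDl// addr_ge0.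
exists (maxn (maxn N1 N2) (maxn N3 N4)) => m n.
rewrite !geq_max => /andP[/andP[m1 m2] /andP[m3 m4]] /andP[/andP[n1 n2] /andP[n3 n4]].
have -> : ip (u m) (w m) - ip (u n) (w n) =
    ip (fun e x => u m e x - u n e x) (w m) + ip (fun e x => w m e x - w n e x) (u n).
  rewrite (ip_subl (lu m) (lu n) (lw m)) (ip_subl (lw m) (lw n) (lu n)).
  by rewrite (ipC (w m) (u n)) (ipC (w n) (u n)) addrA subrK.
rewrite [leRHS]splitr; apply: le_trans (ler_normD _ _) (lerD _ _).
- apply: (half _ _ M'); rewrite ?MP' ?N3P//; first exact: L2_sub.
  by rewrite addrAC lerDr addr_ge0.
- apply: (half _ _ M); rewrite ?MP ?N4P//; first exact: L2_sub.
  by rewrite -addrA lerDl addr_ge0.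
Qed.

(** The difference [u n - w n] lies in [dom_H0], tends to 0 in L^2 and has Cauchy derivatives, so
    closability applies. Consequently the value of the closed form does not depend on the
    approximating sequences. *)
Lemma form_approx_deriv_unique D u u' w w' f : L2 f ->
  form_approx D u u' f -> form_approx D w w' f ->
  (fun n => nrm2 (fun e x => u' n e x - w' n e x)) @ \oo --> (0 : R).
Proof.
move=> lf /form_approxP - /(_ lf)[du uf cu] /form_approxP - /(_ lf)[dw wf cw].
have lu n : L2 (u n) by have [] := dom_H0_L2 (du n).
have lw n : L2 (w n) by have [] := dom_H0_L2 (dw n).
have lu' n : L2 (u' n) by have [] := dom_H0_L2 (du n).
have lw' n : L2 (w' n) by have [] := dom_H0_L2 (dw n).
apply: (@form_closable D (fun n e x => u n e x - w n e x)).
- by move=> n; exact: dom_H0_sub.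
- apply: (@cvg0_squeeze _ _ (fun n => 2 * nrm2 (fun e x => u n e x - f e x) +
    2 * nrm2 (fun e x => w n e x - f e x))).
    move=> n; rewrite ger0_norm ?nrm2_ge0//.
    by apply: le_trans (nrm2_triangle (lu n) lf (lw n)) _; rewrite (nrm2_subC lf (lw n)).
  exact: cvg0_lin uf wf.
- move=> eps eps0; have e4 : 0 < eps / 4 by rewrite divr_gt0.
  have [N1 N1P] := cu _ e4; have [N2 N2P] := cw _ e4.
  exists (maxn N1 N2) => m n; rewrite !geq_max => /andP[m1 m2] /andP[n1 n2].
  have -> : (fun e x => u' m e x - w' m e x - (u' n e x - w' n e x)) =
    (fun e x => (u' m e x - u' n e x) - (w' m e x - w' n e x)).
    by apply/funext => e; apply/funext => x; rewrite !opprB addrACA [RHS]addrACA;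
      congr (_ + _); rewrite addrC.
  apply: le_lt_trans (nrm2_sub_le (L2_sub (lu' m) (lu' n)) (L2_sub (lw' m) (lw' n))) _.
  have := N1P m n m1 n1; have := N2P m n m2 n2.
  move: (nrm2 _) (nrm2 _) => p q; lra.
Qed.

End Closability.

(** * The weak equation that characterises the operator *)

Section RepresentationTheorem.
Import Order.TTheory GRing.Theory Num.Theory.
Import numFieldNormedType.Exports.
Local Open Scope classical_set_scope.
Local Open Scope ring_scope.
Local Open Scope complex_scope.
Context {R : realType} {G : metricGraph R}.
Local Notation V := (vertex G).
Local Notation E := (edge G).
Local Notation efun := (E -> R -> R[i]).
Local Notation Re := (@complex.Re R).
Local Notation Im := (@complex.Im R).
Implicit Types (z : R[i]) (e : E) (D : set V) (f g h : efun) (u w : nat -> efun).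

Lemma normc_cvg0P (a : nat -> R[i]) (c : R[i]) :
  (fun n => Normc.normc (a n - c)) @ \oo --> (0 : R) <->
  (fun n => Re (a n)) @ \oo --> Re c /\ (fun n => Im (a n)) @ \oo --> Im c.
Proof.
have nRe (z : R[i]) : `|Re z| <= Normc.normc z.
  case: z => x y /=; rewrite -[leLHS]sqrtr_sqr ler_sqrt ?addr_ge0 ?sqr_ge0//.
  by rewrite lerDl sqr_ge0.
have nIm (z : R[i]) : `|Im z| <= Normc.normc z.
  case: z => x y /=; rewrite -[leLHS]sqrtr_sqr ler_sqrt ?addr_ge0 ?sqr_ge0//.
  by rewrite lerDr sqr_ge0.
have nle (z : R[i]) : Normc.normc z <= `|Re z| + `|Im z|.
  rewrite -(@ler_pXn2r _ 2)// ?nnegrE ?addr_ge0// ?sqr_normc; last exact: le_trans (nRe z).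
  rewrite sqrrD !real_normK ?num_real// addrAC lerDl mulrn_wge0// mulr_ge0//.
split=> [ac|[ar ai]].
  split; apply/subr_cvg0; apply: cvg0_squeeze ac => n.
  - by rewrite -ReN -ReD; exact: nRe.
  - by rewrite -ImN -ImD; exact: nIm.
have ar0 : (fun n => `|Re (a n) - Re c|) @ \oo --> (0 : R).
  by apply/norm_cvg0P; apply/subr_cvg0.
have ai0 : (fun n => `|Im (a n) - Im c|) @ \oo --> (0 : R).
  by apply/norm_cvg0P; apply/subr_cvg0.
apply: cvg0_squeeze (cvg0_lin 1 1 ar0 ai0) => n.
rewrite !mul1r ger0_norm; last exact: le_trans (nRe _).
by rewrite -!ReN -!ImN -ReD -ImD; exact: nle.
Qed.

Lemma cauchy_nrm2_bound_all u : (forall n, L2 (u n)) -> cauchy_nrm2 u ->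
  exists2 M : R, 0 <= M & forall n, nrm2 (u n) <= M.
Proof.
move=> lu cu; have [M M0 [N NP]] := cauchy_nrm2_bounded lu cu.
have s0 : 0 <= \sum_(i < N) nrm2 (u i) by apply: sumr_ge0 => i _; exact: nrm2_ge0.
exists (M + \sum_(i < N) nrm2 (u i)); first exact: addr_ge0.
move=> n; have [Nn|nN] := leqP N n; first by apply: le_trans (NP n Nn) _; rewrite lerDl.
rewrite (bigD1 (Ordinal nN))//= addrCA lerDl addr_ge0//.
by apply: sumr_ge0 => i _; exact: nrm2_ge0.
Qed.

(** The derivatives come with no limit function; the boundedness of Cauchy sequences takes over the
    role that the limits play in [ip_cvg]. *)
Lemma ip_cvg_close u w (u1 w1 : nat -> efun) (l : R) :
  (forall n, L2 (u n)) -> (forall n, L2 (w n)) ->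
  (forall n, L2 (u1 n)) -> (forall n, L2 (w1 n)) ->
  cauchy_nrm2 u -> cauchy_nrm2 w ->
  (fun n => nrm2 (fun e x => u1 n e x - u n e x)) @ \oo --> (0 : R) ->
  (fun n => nrm2 (fun e x => w1 n e x - w n e x)) @ \oo --> (0 : R) ->
  (fun n => ip (u n) (w n)) @ \oo --> l -> (fun n => ip (u1 n) (w1 n)) @ \oo --> l.
Proof.
move=> lu lw lu1 lw1 cu cw du dw ul.
have [K K0 KP] := cauchy_nrm2_bound_all lu cu.
have [L L0 LP] := cauchy_nrm2_bound_all lw cw.
have -> : (fun n => ip (u1 n) (w1 n)) =
    (fun n => ip (u n) (w n) + (ip (u1 n) (w1 n) - ip (u n) (w n))).
  by apply/funext => n; rewrite addrCA subrr addr0.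
rewrite -[X in _ --> X]addr0; apply: cvgD => //.
apply: cvg0_squeeze (cvg0_bilinear (Num.sqrt L) (Num.sqrt K) (cvg0_sqrt du) (cvg0_sqrt dw)) => n.
have lun := L2_sub (lu1 n) (lu n); have lwn := L2_sub (lw1 n) (lw n).
have -> : ip (u1 n) (w1 n) - ip (u n) (w n) =
    ip (fun e x => u1 n e x - u n e x) (fun e x => w1 n e x - w n e x) +
    ip (fun e x => u1 n e x - u n e x) (w n) + ip (u n) (fun e x => w1 n e x - w n e x).
  rewrite (ip_subr (lw1 n) (lw n) lun) (ip_subr (lw1 n) (lw n) (lu n)).
  rewrite (ip_subl (lu1 n) (lu n) (lw1 n)) (ip_subl (lu1 n) (lu n) (lw n)).
  have alg (p q r s : R) : p - s = (p - r) - (q - s) + (q - s) + (r - s) by ring.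
  exact: alg.
apply: le_trans (ler_normD _ _) (lerD _ _).
  apply: le_trans (ler_normD _ _) (lerD (ip_le lun lwn) _).
  apply: le_trans (ip_le lun (lw n)) _; apply: ler_wpM2l; first exact: sqrtr_ge0.
  by rewrite ler_sqrt.
apply: le_trans (ip_le (lu n) lwn) _; apply: ler_wpM2r; first exact: sqrtr_ge0.
by rewrite ler_sqrt.
Qed.

Lemma form_approx_cst D f f' : dom_H0 D f f' -> form_approx D (fun=> f) (fun=> f') f.
Proof.
move=> df; have [lf lf'] := dom_H0_L2 df.
have z0 g : L2 g -> nrm2 (fun e x => g e x - g e x) = 0.
  move=> lg; rewrite nrm2_sub//.
  have alg (p : R) : p - 2 * p + p = 0 by ring.
  exact: alg.
apply/(form_approxP _ _ _ lf); split=> //; first by rewrite z0//; exact: cvg_cst.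
by move=> eps eps0; exists 0%N => m n _ _; rewrite z0.
Qed.

Lemma iscale_sub f g :
  (fun e x => iscale f e x - iscale g e x) = iscale (fun e x => f e x - g e x).
Proof. by apply/funext => e; apply/funext => x; rewrite /iscale mulrBr. Qed.

Lemma nrm2_iscale f : nrm2 (iscale f) = nrm2 f.
Proof. exact: ip_ii. Qed.

Lemma form_approx_iscale D u u' f : L2 f -> form_approx D u u' f ->
  form_approx D (fun n => iscale (u n)) (fun n => iscale (u' n)) (iscale f).
Proof.
move=> lf /(form_approxP _ _ _ lf)[du uf cu].
apply/form_approxP; first exact: L2_iscale.
split; first by move=> n; exact: dom_H0_iscale.
- by under eq_fun do rewrite iscale_sub nrm2_iscale.
- move=> eps /cu[N NP]; exists N => m n Nm Nn.
  by rewrite iscale_sub nrm2_iscale; exact: NP.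
Qed.

Lemma form_approx_L2 D u u' f : form_approx D u u' f ->
  (forall n, L2 (u n)) /\ (forall n, L2 (u' n)).
Proof. by move=> [du _ _]; split=> n; have [] := dom_H0_L2 (du n). Qed.

Lemma form_approx_cauchy D u u' f : L2 f -> form_approx D u u' f -> cauchy_nrm2 u'.
Proof. by move=> lf /(form_approxP _ _ _ lf)[]. Qed.

(** The definition of [kirchhoff] can be used only once a complex value of the closed form is
    exhibited. Its real part is the limit against [w'], its imaginary part the limit against
    [iscale (w' n)]; the conclusion keeps the real part. *)
Lemma kirchhoff_weak D f g h u u' w w' : kirchhoff D f g ->
  form_approx D u u' f -> L2 h -> form_approx D w w' h ->
  (fun n => ip (u' n) (w' n)) @ \oo --> ip g h.
Proof.
move=> [[lf _] lg K] fu lh fw.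
have [[lu lu'] [lw lw']] := (form_approx_L2 fu, form_approx_L2 fw).
have cu := form_approx_cauchy lf fu; have cw := form_approx_cauchy lh fw.
have ciw := form_approx_cauchy (L2_iscale lh) (form_approx_iscale lh fw).
have [r rP] := ip_cauchy_cvg lu' lw' cu cw.
have [s sP] := ip_cauchy_cvg lu' (fun n => L2_iscale (lw' n)) cu ciw.
have : closed_form D f h (r +i* s).
  split=> //; exists u, u', w, w'; split=> //; apply/normc_cvg0P; split.
  - by under eq_fun do rewrite inner_ip.
  - by under eq_fun do rewrite inner_ip.
by move=> /K; rewrite inner_ip => -[<- _].
Qed.

(** One approximation of [f] and real parts are enough: any other approximation has asymptotically
    the same derivatives, and the imaginary part of the equation for [h] is the real part for
    [iscale h]. *)
Lemma kirchhoff_intro D f g u u' : L2 f -> L2 g -> form_approx D u u' f ->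
  (forall h w w', L2 h -> form_approx D w w' h ->
    (fun n => ip (u' n) (w' n)) @ \oo --> ip g h) ->
  kirchhoff D f g.
Proof.
move=> lf lg fu H; split=> //; first by split=> //; exists u, u'.
move=> h c [_ lh [v [v' [w [w' [fv fw]]]]]] /normc_cvg0P[cr ci].
have [[lu lu'] [lw lw']] := (form_approx_L2 fu, form_approx_L2 fw).
have [lv lv'] := form_approx_L2 fv.
have uv := form_approx_deriv_unique lf fv fu.
have key h1 w1 w1' : L2 h1 -> form_approx D w1 w1' h1 ->
    (fun n => ip (v' n) (w1' n)) @ \oo --> ip g h1.
  move=> lh1 fw1; have [lw1 lw1'] := form_approx_L2 fw1.
  apply: (ip_cvg_close lu' lw1' lv' lw1' _ _ uv) (H h1 w1 w1' lh1 fw1).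
  - exact: form_approx_cauchy fu.
  - exact: form_approx_cauchy fw1.
  - exact: (form_approx_deriv_unique lh1 fw1 fw1).
have lim_eq (a b : nat -> R) (x y : R) : a =1 b -> a @ \oo --> x -> b @ \oo --> y -> x = y.
  move=> /funext -> bx bY; exact: (cvg_unique _ bx bY).
rewrite inner_ip; apply: complex_eq => /=.
- apply: lim_eq cr (key _ _ _ lh fw) => n; by rewrite inner_ip.
- apply: lim_eq ci (key _ _ _ (L2_iscale lh) (form_approx_iscale lh fw)) => n.
  by rewrite inner_ip.
Qed.

End RepresentationTheorem.

(** * Limits of form-Cauchy sequences on one edge *)

Section Completeness.
Import Order.TTheory GRing.Theory Num.Theory.
Import numFieldNormedType.Exports.
Local Open Scope classical_set_scope.
Local Open Scope ring_scope.
Local Open Scope complex_scope.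
Context {R : realType}.
Local Notation mu := (@lebesgue_measure R).
Local Notation Re := (@complex.Re R).
Local Notation Im := (@complex.Im R).

Lemma H1_sub_fun l (f f' g g' : R -> R) : H1 l f f' -> H1 l g g' ->
  H1 l (fun x => f x - g x) (fun x => f' x - g' x).
Proof.
move=> hf hg; have := H1_add hf (H1_scale (-1) hg).
have E (p q : R -> R) : (fun x => p x + -1 * q x) = (fun x => p x - q x).
  by apply/funext => x; rewrite mulN1r.
by rewrite !E.
Qed.

(** Sobolev's inequality with the whole edge as window makes the sequence uniformly Cauchy. The
    limit can thus be taken pointwise: it is measurable as a pointwise limit and square integrable
    because it stays within distance 1 of some [a N]. *)
Lemma H1_limit l (a a' : nat -> R -> R) : 0 < l -> (forall n, H1 l (a n) (a' n)) ->
  (forall eps, 0 < eps -> exists N, forall m n, (N <= m)%N -> (N <= n)%N ->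
    \int[mu]_(x in `[0, l]) (a m x - a n x) ^+ 2 <= eps /\
    \int[mu]_(x in `[0, l]) (a' m x - a' n x) ^+ 2 <= eps) ->
  exists2 b, sq_integrable 0 l b & forall eps, 0 < eps -> exists N, forall n,
    (N <= n)%N -> \int[mu]_(x in `[0, l]) (a n x - b x) ^+ 2 <= eps.
Proof.
move=> l0 ha ca.
have unif eps : 0 < eps -> exists N, forall m n, (N <= m)%N -> (N <= n)%N ->
    forall x, 0 <= x <= l -> `|a m x - a n x| <= eps.
  move=> eps0; set c := 2 + 2 * l ^+ 2.
  have c0 : 0 < c by rewrite addr_gt0// mulr_gt0// exprn_gt0.
  (* With [h = l], Sobolev's inequality carries the coefficients 2 and [2 * l ^+ 2], whose sum is
     [c]. *)
  have e0 : 0 < l * eps ^+ 2 / c by rewrite divr_gt0// mulr_gt0// exprn_gt0.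
  have [N NP] := ca _ e0; exists N => m n Nm Nn x xl; have [P1 P2] := NP m n Nm Nn.
  rewrite -(@ler_pXn2r _ 2)// ?nnegrE ?(ltW eps0)// real_normK ?num_real//.
  rewrite -(ler_pM2l l0).
  have ll : 0 <= l <= l by rewrite lexx ltW.
  apply: (le_trans (H1_sobolev (H1_sub_fun (ha m) (ha n)) xl ll)).
  have -> : l * eps ^+ 2 = 2 * (l * eps ^+ 2 / c) + 2 * l ^+ 2 * (l * eps ^+ 2 / c).
    by rewrite -mulrDl -/c [RHS]mulrC divfK// gt_eqF.
  by apply: lerD; apply: ler_wpM2l => //; rewrite mulr_ge0// sqr_ge0.
have lim x : exists y : R, 0 <= x <= l -> (a ^~ x) @ \oo --> y.
  have [xl|nxl] := boolP (0 <= x <= l); last by exists 0.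
  have [y yP] : exists y : R, (a ^~ x) @ \oo --> y; last by exists y.
  apply: cauchy_seq_cvg => eps /unif[N NP]; exists N => m n Nm Nn.
  exact: NP.
have [b bP] := choice lim.
have unifb eps : 0 < eps -> exists N, forall n, (N <= n)%N ->
    forall x, 0 <= x <= l -> `|a n x - b x| <= eps.
  move=> /unif[N NP]; exists N => n Nn x xl.
  have cv : (fun m => `|a n x - a m x|) @ \oo --> `|a n x - b x|.
    by apply: cvg_norm; apply: cvgB; [exact: cvg_cst|exact: bP].
  apply: (@ler_cvg_to _ _ _ _ (fun m => `|a n x - a m x|) (cst eps)) cv (cvg_cst _) _.
  by exists N => // m Nm; exact: NP.
have sb : sq_integrable 0 l b.
  have mb : measurable_fun `[0, l] b.
    apply: (@measurable_fun_cvg _ _ _ _ a) => [n|x]; last by rewrite /= in_itv/=; exact: bP.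
    by have [] := H1_sq_integrable (ha n).
  have [N NP] := unifb 1 ltr01.
  have [_ aN] := H1_sq_integrable (ha N).
  split=> //; apply: (@itv_integrable_dominated _ _ _ _ (fun x => 2 * a N x ^+ 2 + 2)).
  - exact: measurable_funX.
  - by apply: itv_integrableD; [exact: itv_integrableZ|exact: itv_integrable_cst].
  - move=> x /=; rewrite in_itv/= => xl; rewrite ger0_norm ?sqr_ge0//.
    have : (a N x - b x) ^+ 2 <= 1.
      by rewrite -real_normK ?num_real// exprn_ile1//; exact: NP.
    by have := sqr_ge0 (2 * a N x - b x); nra.
exists b => // eps eps0.
have d0 : 0 < Num.sqrt (eps / l) by rewrite sqrtr_gt0 divr_gt0.
have [N NP] := unifb _ d0; exists N => n Nn.
have -> : eps = (eps / l) * (l - 0) by rewrite subr0 divfK// gt_eqF.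
rewrite -Rintegral_cst_itv ?(ltW l0)//; apply: le_Rintegral => //.
- have [] // : sq_integrable 0 l (fun x => a n x - b x).
  have -> : (fun x => a n x - b x) = (fun x => a n x + -1 * b x).
    by apply/funext => x; rewrite mulN1r.
  by apply: sq_integrableD; [exact: H1_sq_integrable (ha n)|exact: sq_integrableZ].
- exact: itv_integrable_cst.
- move=> x /=; rewrite in_itv/= => xl; have := NP n Nn x xl.
  rewrite -(@ler_pXn2r _ 2)// ?nnegrE ?sqrtr_ge0// real_normK ?num_real//.
  by rewrite sqr_sqrtr// divr_ge0 ?ltW.
Qed.

Lemma CH1_limit l (a a' : nat -> R -> R[i]) : 0 < l -> (forall n, CH1 l (a n) (a' n)) ->
  (forall eps : R, 0 < eps -> exists N, forall m n, (N <= m)%N -> (N <= n)%N ->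
    edge_norm l (fun x => a m x - a n x) <= eps /\
    edge_norm l (fun x => a' m x - a' n x) <= eps) ->
  exists2 b, edge_sq l b & forall eps : R, 0 < eps -> exists N, forall n,
    (N <= n)%N -> edge_norm l (fun x => a n x - b x) <= eps.
Proof.
move=> l0 ha ca.
have q0 (c : R -> R) : 0 <= \int[mu]_(x in `[0, l]) c x ^+ 2.
  by apply: Rintegral_ge0 => *; exact: sqr_ge0.
have sub_sq (u v : R -> R[i]) : edge_sq l u -> edge_sq l v -> edge_sq l (fun x => u x - v x).
  move=> su sv; have := edge_sq_axpy (-1) su sv.
  by under eq_fun do rewrite mulN1r.
have nE (u v : R -> R[i]) : edge_sq l u -> edge_sq l v ->
    edge_norm l (fun x => u x - v x) =
    \int[mu]_(x in `[0, l]) (Re (u x) - Re (v x)) ^+ 2 +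
    \int[mu]_(x in `[0, l]) (Im (u x) - Im (v x)) ^+ 2.
  move=> su sv; rewrite edge_normE; last exact: sub_sq.
  by congr (_ + _); apply: eq_Rintegral => x _; rewrite !ReImE.
have sa n : edge_sq l (a n) by have [] := CH1_edge_sq (ha n).
have sa' n : edge_sq l (a' n) by have [] := CH1_edge_sq (ha n).
have [br sbr brP] : exists2 b, sq_integrable 0 l b & forall eps : R, 0 < eps ->
    exists N, forall n, (N <= n)%N ->
    \int[mu]_(x in `[0, l]) (Re (a n x) - b x) ^+ 2 <= eps.
  apply: (@H1_limit l (fun n x => Re (a n x)) (fun n x => Re (a' n x))) => //.
    by move=> n; have [] := ha n.
  move=> eps /ca[N NP]; exists N => m n Nm Nn; have := NP m n Nm Nn.
  rewrite !nE// => -[h1 h2]; split; [apply: le_trans h1|apply: le_trans h2];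
    by rewrite lerDl.
have [bi sbi biP] : exists2 b, sq_integrable 0 l b & forall eps : R, 0 < eps ->
    exists N, forall n, (N <= n)%N ->
    \int[mu]_(x in `[0, l]) (Im (a n x) - b x) ^+ 2 <= eps.
  apply: (@H1_limit l (fun n x => Im (a n x)) (fun n x => Im (a' n x))) => //.
    by move=> n; have [] := ha n.
  move=> eps /ca[N NP]; exists N => m n Nm Nn; have := NP m n Nm Nn.
  rewrite !nE// => -[h1 h2]; split; [apply: le_trans h1|apply: le_trans h2];
    by rewrite lerDr.
have sb : edge_sq l (fun x => br x +i* bi x) by split.
exists (fun x => br x +i* bi x) => // eps eps0.
have e2 : 0 < eps / 2 by rewrite divr_gt0.
have [N1 N1P] := brP _ e2; have [N2 N2P] := biP _ e2.
exists (maxn N1 N2) => n; rewrite geq_max => /andP[n1 n2].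
by rewrite nE// [leRHS]splitr lerD//=; [exact: N1P|exact: N2P].
Qed.

End Completeness.

(** * Global limits, and the form bound drawn from the resolvent at 0 *)

Section Spectral.
Import Order.TTheory GRing.Theory Num.Theory.
Import numFieldNormedType.Exports.
Local Open Scope classical_set_scope.
Local Open Scope ring_scope.
Local Open Scope complex_scope.
Context {R : realType} {G : metricGraph R}.
Local Notation V := (vertex G).
Local Notation E := (edge G).
Local Notation efun := (E -> R -> R[i]).
Implicit Types (z : R[i]) (e : E) (D : set V) (f g h : efun) (u w : nat -> efun).

(** The limit is chosen edge by edge, and convergence in the global norm is proved on finite edge
    sets with a bound that does not depend on the set. *)
Lemma dom_H0_limit D u u' : (forall n, dom_H0 D (u n) (u' n)) ->
  cauchy_nrm2 u -> cauchy_nrm2 u' -> exists2 f, L2 f & form_approx D u u' f.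
Proof.
move=> du cu cu'.
have lu n : L2 (u n) by have [] := dom_H0_L2 (du n).
have lu' n : L2 (u' n) by have [] := dom_H0_L2 (du n).
have lim e : exists b, edge_sq (len e) b /\ forall eps : R, 0 < eps -> exists N, forall n,
    (N <= n)%N -> edge_norm (len e) (fun x => u n e x - b x) <= eps.
  have [|b sb bP] := CH1_limit (len_gt0 e) (fun n => dom_H0_CH1 e (du n)); last by exists b.
  move=> eps eps0; have [N1 N1P] := cu _ eps0; have [N2 N2P] := cu' _ eps0.
  exists (maxn N1 N2) => m n; rewrite !geq_max => /andP[m1 m2] /andP[n1 n2]; split.
  - apply: le_trans (edge_norm_le_nrm2 e (L2_sub (lu m) (lu n))) _.
    by apply/ltW/N1P.
  - apply: le_trans (edge_norm_le_nrm2 e (L2_sub (lu' m) (lu' n))) _.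
    by apply/ltW/N2P.
have [f fP] := choice lim.
have sub_sq n e : edge_sq (len e) (fun x => u n e x - f e x).
  have := edge_sq_axpy (-1) (L2_edge e (lu n)) (fP e).1.
  by under eq_fun do rewrite mulN1r.
have main eps : 0 < eps -> exists N, forall n, (N <= n)%N ->
    L2 (fun e x => u n e x - f e x) /\ nrm2 (fun e x => u n e x - f e x) <= eps.
  move=> eps0; have e4 : 0 < eps / 4 by rewrite divr_gt0.
  have [N NP] := cu _ e4; exists N => n Nn; apply: nrm2_le => // F.
  pose k : R := (size F).+1%:R.
  have k0 : 0 < k by rewrite ltr0n.
  have ek : 0 < eps / 4 / k by rewrite divr_gt0.
  have [T TP] : exists T, forall m, (T <= m)%N -> forall e, e \in (F : seq E) ->
      edge_norm (len e) (fun x => u m e x - f e x) <= eps / 4 / k.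
    elim: (F : seq E) => [|e s [T TP]]; first by exists 0%N.
    have [T1 T1P] := (fP e).2 _ ek.
    exists (maxn T1 T) => m; rewrite geq_max => /andP[n1 n2] e'.
    by rewrite inE => /predU1P[->|es]; [exact: T1P|exact: TP].
  (* The comparison index [m] depends on [F] through [T], but the final bound does not: [u n - u m]
     is controlled on all edges at once, and [u m - f] is made small on [F] by the choice of [T]. *)
  pose m := maxn N T.
  have Nm : (N <= m)%N by exact: leq_maxl.
  have Tm : (T <= m)%N by exact: leq_maxr.
  apply: (@le_trans _ _ (\sum_(e <- F) (2 * edge_norm (len e) (fun x => u n e x - u m e x) +
      2 * edge_norm (len e) (fun x => u m e x - f e x)))).
    apply: ler_sum => e _.
    have := edge_norm_axpy_le 1 (L2_edge e (L2_sub (lu n) (lu m))) (sub_sq m e).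
    rewrite /= expr1n expr0n/= addr0 mulr1.
    rewrite (_ : (fun x => _ + 1 * _) = (fun x => u n e x - f e x))//.
    by apply/funext => x; rewrite mul1r addrA subrK.
  rewrite big_split/= -!mulr_sumr.
  have h1 := sum_edge_norm_le F (L2_sub (lu n) (lu m)).
  have h2 := NP n m Nn Nm.
  have h3 : \sum_(e <- F) edge_norm (len e) (fun x => u m e x - f e x) <= eps / 4.
    apply: (@le_trans _ _ (\sum_(e <- F) (eps / 4 / k))).
      by rewrite big_seq [leRHS]big_seq; apply: ler_sum => e eF; exact: TP.
    rewrite big_const_seq count_predT iter_addr_0 -[leLHS]mulr_natr.
    by rewrite mulrAC ler_pdivrMr// ler_wpM2l ?divr_ge0 ?(ltW eps0)// ler_nat.
  have alg (p q r : R) : p <= r -> r < eps / 4 -> q <= eps / 4 -> 2 * p + 2 * q <= eps.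
    by lra.
  exact: alg h1 h2 h3.
have lf : L2 f.
  have [N NP] := main 1 ltr01; have [lN _] := NP N (leqnn _).
  apply: L2_ext (L2_sub (lu N) lN) => e; apply/funext => x.
  by rewrite opprB addrC subrK.
exists f => //; apply/(form_approxP _ _ _ lf); split=> //.
apply/(cvg0_ge0P (fun n => nrm2_ge0 _)) => eps /main[N NP].
by exists N => n /NP[].
Qed.

Definition form_bound D (C : R) :=
  forall f f', dom_H0 D f f' -> nrm2 f <= C * nrm2 f'.

Lemma resolvent_form_bound D : resolvent_set (kirchhoff D) 0 ->
  exists2 C : R, 0 < C & form_bound D C.
Proof.
move=> [sur [C0 bd]]; pose C := `|C0|.
(* With [N] the squared norm of [p] and [P] that of [p'], the estimates are [N ^+ 2 <= ip p f * P]
   and [ip p f <= Num.sqrt C * N]. They give the constant [Num.sqrt C]; the 1 makes it positive. *)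
exists (Num.sqrt C + 1); first by rewrite ltr_wpDl// sqrtr_ge0.
move=> p p' dp; have [lp lp'] := dom_H0_L2 dp.
have [f [h [K hp]]] := sur p lp.
have [[lf [u [u' fu]]] lh _] := K.
have z0 : (fun e x => h e x - 0 * f e x) = h.
  by apply/funext => e; apply/funext => x; rewrite mul0r subr0.
have {}hp : nrm2 (fun e x => h e x - p e x) = 0.
  apply/eqP; rewrite -eqe -L2_sqnorm; last exact: L2_sub.
  by apply/eqP; apply: etrans hp; congr sqnorm; apply/funext => e; apply/funext => x;
    rewrite mul0r subr0.
have {}bd : nrm2 f <= C * nrm2 p.
  have := bd f h K; rewrite z0 !L2_sqnorm// -EFinM lee_fin => fh.
  have hpE : nrm2 h = nrm2 p.
    have e1 : ip h h = ip p h by exact: ip_null.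
    have e2 : ip h p = ip p p by exact: ip_null.
    by rewrite [nrm2 h]e1 ipC e2.
  apply: le_trans fh _; rewrite hpE; apply: ler_wpM2r; first exact: nrm2_ge0.
  exact: ler_norm.
have ch := form_approx_cst dp.
have c1 := kirchhoff_weak K fu lp ch.
have c2 := kirchhoff_weak K fu lf fu.
rewrite (ip_null lh lp lp hp) in c1; rewrite (ip_null lh lp lf hp) in c2.
have [_ lu'] := form_approx_L2 fu.
have P0 := nrm2_ge0 p'; have N0 := nrm2_ge0 p.
have s0 : 0 <= Num.sqrt C by exact: sqrtr_ge0.
have ss : Num.sqrt C ^+ 2 = C by rewrite sqr_sqrtr /C ?normr_ge0.
rewrite -nrm2E in c1.
(* Cauchy-Schwarz for the closed form: it is applied to [u' n] and [p'], then both sides are passed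
   to the limit with the weak equation. *)
have q1 : nrm2 p * nrm2 p <= ip p f * nrm2 p'.
  apply: (ler_cvg_to (cvgM c1 c1) (cvgM c2 (cvg_cst (nrm2 p')))); apply: nearW => n.
  by rewrite /= -(nrm2E (u' n)) -expr2; exact: (ip_cauchy_schwarz (lu' n) lp').
have q2 := ip_cauchy_schwarz lp lf.
have alg (N F P x s : R) : 0 <= N -> 0 <= P -> 0 <= s -> N * N <= x * P ->
    x ^+ 2 <= N * F -> F <= s ^+ 2 * N -> N <= (s + 1) * P.
  move=> n0 pp s1 h1 h2 h3.
  have [->|nz] := eqVneq N 0; first by rewrite mulr_ge0// addr_ge0.
  have np : 0 < N by rewrite lt_def nz.
  have h4 : x ^+ 2 <= (s * N) ^+ 2.
    apply: le_trans h2 _; rewrite exprMn [leRHS]mulrC -mulrA mulrC -mulrA.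
    by rewrite ler_wpM2l// mulrC.
  have h5 : x <= s * N.
    apply: le_trans (ler_norm _) _; rewrite -(@ler_pXn2r _ 2)// ?nnegrE ?mulr_ge0//.
    by rewrite real_normK ?num_real.
  have h6 : N * N <= N * (s * P).
    by apply: le_trans h1 _; rewrite mulrA (mulrC N); apply: ler_wpM2r.
  rewrite ler_pM2l// in h6; apply: le_trans h6 _; apply: ler_wpM2r => //; by rewrite lerDl.
rewrite -ss in bd; exact: (alg _ _ _ _ _ N0 P0 s0 q1 q2 bd).
Qed.

End Spectral.

(** * Solving the shifted equation by minimisation *)

Section Resolvent.
Import Order.TTheory GRing.Theory Num.Theory.
Import numFieldNormedType.Exports.
Local Open Scope classical_set_scope.
Local Open Scope ring_scope.
Local Open Scope complex_scope.
Context {R : realType} {G : metricGraph R}.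
Local Notation V := (vertex G).
Local Notation E := (edge G).
Local Notation efun := (E -> R -> R[i]).
Variables (D : set V) (C x : R).
Hypotheses (C0 : 0 < C) (bound : form_bound D C) (xC : x < (2 * C)^-1).
Implicit Types (e : E) (f g h : efun).

Let energy f f' := nrm2 f' - x * nrm2 f.

Let xC1 : x * (2 * C) < 1.
Proof. by move: xC; rewrite -[X in _ < X]div1r ltr_pdivlMr// mulr_gt0. Qed.

(** For positive [x] the form bound gives [x * nrm2 f <= x * C * nrm2 f'], at most half of
    [nrm2 f']; a negative shift only increases the energy. This is where the threshold [(2 * C)^-1]
    comes from. *)
Lemma energy_ge f f' : dom_H0 D f f' -> nrm2 f' <= 2 * energy f f'.
Proof.
move=> df; have := bound df; have := nrm2_ge0 f; have := nrm2_ge0 f'.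
rewrite /energy; move: (nrm2 f) (nrm2 f') xC1 C0 => p q h1 h2 q0 p0 pq.
have [x0|/ltW x0] := leP x 0.
  have : x * p <= 0 by exact: mulr_le0_ge0.
  lra.
have h3 : x * p <= x * (C * q) by exact: ler_wpM2l.
have h4 : x * (2 * C) * q <= q by rewrite ler_piMl// ltW.
lra.
Qed.

(** In the limit the form bound reads [nrm2 f <= C * ip h f]. The smallness of [x] absorbs the
    shift, so [nrm2 f] is at most [2 * C] times the product of [h - x f] with [f], and
    Cauchy-Schwarz finishes. *)
Lemma form_bound_kirchhoff f h : kirchhoff D f h ->
  nrm2 f <= 4 * C ^+ 2 * nrm2 (axpy (- x)%:C h f).
Proof.
move=> K; have [[lf [u [u' fu]]] lh _] := K.
have [lu lu'] := form_approx_L2 fu.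
have [du uf _] := (form_approxP _ _ _ lf).1 fu.
have c1 := kirchhoff_weak K fu lf fu.
have c2 := ip_cvg lu lu lf lf uf uf.
have c3 : ip f f <= C * ip h f.
  by apply: (ler_cvg_to c2 (cvgM (cvg_cst C) c1)); apply: nearW => n; exact: bound.
have lk : L2 (axpy (- x)%:C h f) by exact: L2_axpy.
have e1 : ip (axpy (- x)%:C h f) f = ip h f - x * nrm2 f.
  by rewrite ip_axpyl// mulNr.
have := ip_cauchy_schwarz lk lf; rewrite e1.
have := nrm2_ge0 f; have := nrm2_ge0 (axpy (- x)%:C h f).
have c4 : nrm2 f <= C * ip h f by [].
move: c4; move: (nrm2 (axpy _ _ _)) (nrm2 f) (ip h f) => p n q nq p0 n0 cs.
have h1 : n <= 2 * C * (q - x * n).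
  have : x * (2 * C) * n <= n by rewrite ler_piMl// ltW.
  by move: nq; lra.
have [->|nz] := eqVneq n 0; first by apply: mulr_ge0 => //; apply: mulr_ge0 => //; exact: sqr_ge0.
have np : 0 < n by rewrite lt_def nz.
rewrite -(ler_pM2r np); apply: (@le_trans _ _ ((2 * C * (q - x * n)) ^+ 2)).
  rewrite -expr2 ler_pXn2r// nnegrE//; exact: le_trans h1.
have -> : (2 * C * (q - x * n)) ^+ 2 = 4 * C ^+ 2 * (q - x * n) ^+ 2 by ring.
by rewrite -[leRHS]mulrA; apply: ler_wpM2l => //; apply: mulr_ge0 => //; exact: sqr_ge0.
Qed.

Section Minimisation.
Variables (g : efun) (lg : L2 g).

(** The functional whose Euler-Lagrange equation is [(H - x) f = g]. The [residual] below is half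
    its derivative at [f] in direction [h], that is, the defect in the weak equation. *)
Let J f f' := energy f f' - 2 * ip g f.

Let residual f f' h h' := ip f' h' - x * ip f h - ip g h.

(** Since [ip g f ^+ 2 <= nrm2 g * (C * nrm2 f')], the arithmetic-geometric mean inequality bounds
    [2 * ip g f] by [2 * C * nrm2 g + nrm2 f' / 2], and the energy dominates the last summand. *)
Let J_ge f f' : dom_H0 D f f' -> - (2 * C * nrm2 g) <= J f f'.
Proof.
move=> df; have [lf lf'] := dom_H0_L2 df.
have := energy_ge df; have := ip_cauchy_schwarz lg lf; have := bound df.
rewrite /J; have := nrm2_ge0 g; have := nrm2_ge0 f'; have := nrm2_ge0 f.
move: (energy f f') (nrm2 f) (nrm2 f') (nrm2 g) (ip g f) => a p q G0 b p0 q0 g0 pq bg aq.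
have h1 : b ^+ 2 <= G0 * (C * q) by apply: le_trans bg _; exact: ler_wpM2l.
have cg : 0 <= C * G0 by rewrite mulr_ge0// ltW.
have k1 : 0 <= 2 * C * G0 + q / 2 by lra.
have k2 : 2 * C * G0 + q / 2 <= 2 * C * G0 + a by lra.
have k3 : 0 <= 2 * C * G0 + a by lra.
have h2 : `|2 * b| <= 2 * C * G0 + a.
  rewrite -(@ler_pXn2r _ 2)// ?nnegrE// ?real_normK ?num_real//.
  have h3 : (2 * C * G0 + q / 2) ^+ 2 <= (2 * C * G0 + a) ^+ 2.
    by rewrite ler_pXn2r.
  apply: le_trans h3; have := sqr_ge0 (2 * C * G0 - q / 2); lra.
have := ler_norm (2 * b); lra.
Qed.

Let J_axpy (t : R) f f' h h' : dom_H0 D f f' -> dom_H0 D h h' ->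
  J (axpy t%:C f h) (axpy t%:C f' h') =
  J f f' + 2 * t * residual f f' h h' + t ^+ 2 * energy h h'.
Proof.
move=> df dh; have [lf lf'] := dom_H0_L2 df; have [lh lh'] := dom_H0_L2 dh.
rewrite /J /energy /residual (nrm2_axpy _ lf lh) (nrm2_axpy _ lf' lh').
rewrite (ip_axpyr _ lf lh lg).
move: (nrm2 f) (nrm2 f') (nrm2 h) (nrm2 h') (ip f h) (ip f' h') (ip g f) (ip g h).
by move=> *; ring.
Qed.

(* [J (v n + t h)] stays above the infimum for all real [t]; the inequality is
   the discriminant of the resulting quadratic polynomial in [t]. *)
Lemma minimizing_sequence : exists v v' : nat -> efun,
  (forall n, dom_H0 D (v n) (v' n)) /\
  forall n h h', dom_H0 D h h' ->
    residual (v n) (v' n) h h' ^+ 2 <= n.+1%:R^-1 * energy h h'.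
Proof.
pose S := [set y : R | exists f f', dom_H0 D f f' /\ y = J f f'].
have lbS : has_lbound S.
  by exists (- (2 * C * nrm2 g)) => _ [f [f' [df ->]]]; exact: J_ge.
have infS : has_inf S.
  split=> //; exists (J (fun _ _ => 0) (fun _ _ => 0)), (fun _ _ => 0), (fun _ _ => 0).
  by split; first exact: (dom_H0_0 D).
have seq n : exists vv : efun * efun, dom_H0 D vv.1 vv.2 /\
    J vv.1 vv.2 < inf S + n.+1%:R^-1.
  have n0 : 0 < n.+1%:R^-1 :> R by rewrite invr_gt0 ltr0n.
  by have [_ [f [f' [df ->]]] lt] := inf_adherent n0 infS; exists (f, f').
have [vv vvP] := choice seq.
exists (fun n => (vv n).1), (fun n => (vv n).2); split; first by move=> n; have [] := vvP n.
move=> n h h' dh; have [dv Jv] := vvP n.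
apply: quadratic_ge0.
  move=> t; have : inf S <= J (axpy t%:C (vv n).1 h) (axpy t%:C (vv n).2 h').
    apply: (ge_inf lbS); exists (axpy t%:C (vv n).1 h), (axpy t%:C (vv n).2 h').
    by split; first exact: (dom_H0_axpy t%:C dv dh).
  rewrite J_axpy// => le1.
  have alg (a b c d k : R) : a < b + c -> b <= a + d + k -> 0 <= c + d + k by lra.
  exact: alg Jv le1.
have := energy_ge dh; have := nrm2_ge0 h'; move: (energy _ _) (nrm2 _) => p q; lra.
Qed.

(** Almost-minimisers nearly satisfy the weak equation. Testing it with their differences shows that
    they are Cauchy, and testing it with approximations of [h] gives the equation for the limit. *)
Lemma form_bound_solve : exists f, kirchhoff D f (axpy x%:C g f).
Proof.
have [v [v' [dv vP]]] := minimizing_sequence.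
have lv n : L2 (v n) by have [] := dom_H0_L2 (dv n).
have lv' n : L2 (v' n) by have [] := dom_H0_L2 (dv n).
have close N m n : (N <= m)%N -> (N <= n)%N ->
    nrm2 (fun e y => v' m e y - v' n e y) <= 8 * N.+1%:R^-1.
  move=> Nm Nn; have dd := dom_H0_sub (dv m) (dv n).
  have := vP m _ _ dd; have := vP n _ _ dd; have := energy_ge dd.
  have := nrm2_ge0 (fun e y => v' m e y - v' n e y).
  set w := fun e y => v m e y - v n e y; set w' := fun e y => v' m e y - v' n e y.
  have lw : L2 w by exact: L2_sub. have lw' : L2 w' by exact: L2_sub.
  (* The energy [a] of the difference is a difference of two residuals, each with square at most
     [a / N.+1]. Hence [a ^+ 2 <= 4 * a / N.+1], and [energy_ge] turns the 4 into the 8 above. *)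
  have eE : energy w w' = residual (v m) (v' m) w w' - residual (v n) (v' n) w w'.
    rewrite /energy /residual.
    have -> : nrm2 w' = ip (v' m) w' - ip (v' n) w' by rewrite -(ip_subl (lv' m) (lv' n) lw').
    have -> : nrm2 w = ip (v m) w - ip (v n) w by rewrite -(ip_subl (lv m) (lv n) lw).
    have alg (p q r s t k : R) : p - q - k * (r - s) = p - k * r - t - (q - k * s - t) by ring.
    exact: alg.
  have inv_le k : (N <= k)%N -> k.+1%:R^-1 <= N.+1%:R^-1 :> R.
    by move=> Nk; rewrite lef_pV2 ?posrE ?ltr0n// ler_nat ltnS.
  move: eE (inv_le m Nm) (inv_le n Nn); have i0 : 0 < N.+1%:R^-1 :> R by rewrite invr_gt0 ltr0n.
  move: i0; move: (m.+1%:R^-1) (n.+1%:R^-1) (N.+1%:R^-1) => im inn iN.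
  move: (energy w w') (residual _ _ _ _) (residual _ _ _ _) (nrm2 w') => a r s q.
  move=> iN0 aE imN inN q0 qa ra sa.
  have a0 : 0 <= a by lra.
  have h1 : r ^+ 2 <= iN * a by apply: le_trans ra _; exact: ler_wpM2r.
  have h2 : s ^+ 2 <= iN * a by apply: le_trans sa _; exact: ler_wpM2r.
  have h3 : a * a <= (4 * iN) * a.
    by rewrite {1 2}aE; have := sqr_ge0 (r + s); lra.
  have [az|nz] := eqVneq a 0; first by move: qa; rewrite az; lra.
  have ap : 0 < a by rewrite lt_def nz.
  by rewrite ler_pM2r// in h3; lra.
have arch (k eps : R) : 0 < eps -> exists N, k * N.+1%:R^-1 < eps.
  move=> eps0; exists (Num.truncn (k / eps)).
  by rewrite ltr_pdivrMr ?ltr0n// mulrC -ltr_pdivrMr// truncnS_gt.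
have cv' : cauchy_nrm2 v'.
  move=> eps /(arch 8)[N NP]; exists N => m n Nm Nn.
  exact: le_lt_trans (close N m n Nm Nn) NP.
have cv : cauchy_nrm2 v.
  move=> eps /(arch (C * 8))[N NP]; exists N => m n Nm Nn.
  apply: le_lt_trans (bound (dom_H0_sub (dv m) (dv n))) _; apply: le_lt_trans NP.
  by rewrite -mulrA ler_pM2l//; exact: close.
have [f lf fv] := dom_H0_limit dv cv cv'; exists f.
have lgf : L2 (axpy x%:C g f) by exact: L2_axpy.
apply: (kirchhoff_intro lf lgf fv) => h w w' lh fw.
have [lw lw'] := form_approx_L2 fw.
have [dw wh cw] := (form_approxP _ _ _ lh).1 fw.
have [_ vf _] := (form_approxP _ _ _ lf).1 fv.
have [M M0 MP] := cauchy_nrm2_bound_all lw' cw.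
(* The test function moves with [n], but its energy stays bounded while the residual bound carries
   the factor [n.+1%:R^-1]. *)
have res0 : (fun n => residual (v n) (v' n) (w n) (w' n)) @ \oo --> (0 : R).
  have eM n : energy (w n) (w' n) <= (1 + `|x| * C) * M.
    rewrite /energy; apply: (@le_trans _ _ (M + `|x| * (C * M))); last first.
      by rewrite mulrDl mul1r mulrA.
    apply: lerD; first exact: MP.
    apply: le_trans (ler_norm _) _; rewrite normrN normrM.
    apply: ler_wpM2l => //; rewrite ger0_norm ?nrm2_ge0//.
    apply: le_trans (bound (dw n)) _; rewrite ler_pM2l//; exact: MP.
  apply: (@cvg0_squeeze _ _ (fun n => Num.sqrt (n.+1%:R^-1 * ((1 + `|x| * C) * M)))).
    move=> n; rewrite -sqrtr_sqr ler_sqrt; last first.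
      rewrite !mulr_ge0// addr_ge0// mulr_ge0// ltW//.
    apply: le_trans (vP n _ _ (dw n)) _; by apply: ler_wpM2l (eM n).
  apply: cvg0_sqrt; rewrite -[X in _ --> X](mul0r ((1 + `|x| * C) * M)).
  by apply: cvgM; [exact: cvg_harmonic|exact: cvg_cst].
(* Solving the definition of the residual for the form value leaves only L^2 products, which
   converge. *)
have -> : (fun n => ip (v' n) (w' n)) = (fun n => residual (v n) (v' n) (w n) (w' n) +
    (x * ip (v n) (w n) + ip g (w n))).
  apply/funext => n; rewrite /residual.
  have alg (p q r s : R) : p = p - q * r - s + (q * r + s) by ring.
  exact: alg.
have -> : ip (axpy x%:C g f) h = 0 + (x * ip f h + ip g h).
  by rewrite (ip_axpyl _ lg lf lh) add0r addrC.
have gg : (fun n => nrm2 (fun e y => g e y - g e y)) @ \oo --> (0 : R).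
  rewrite (_ : nrm2 _ = 0); first exact: cvg_cst.
  rewrite (nrm2_sub lg lg).
  have alg (p : R) : p - 2 * p + p = 0 by ring.
  exact: alg.
have l1 := ip_cvg lv lw lf lh vf wh.
have l2 := ip_cvg (fun=> lg) lw lg lh gg wh.
exact: (cvgD res0 (cvgD (cvgM (cvg_cst x) l1) l2)).
Qed.

End Minimisation.

Lemma form_bound_resolvent : resolvent_set (kirchhoff D) x%:C.
Proof.
split=> [g lg|].
  have [f K] := form_bound_solve lg; exists f, (axpy x%:C g f); split=> //.
  rewrite (_ : (fun e y => _) = (fun _ _ => 0)); last first.
    by apply/funext => e; apply/funext => y; rewrite /axpy addrK subrr.
  rewrite (L2_sqnorm L2_cst0); congr EFin.
  have z0 : (fun (_ : E) (_ : R) => 0 : R[i]) = axpy (-1)%:C (fun _ _ => 0) (fun _ _ => 0).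
    by apply/funext => e; apply/funext => y; rewrite /axpy mulr0 addr0.
  have l0 := @L2_cst0 R G; have := nrm2_sub l0 l0.
  rewrite (_ : (fun _ _ => 0 - 0) = (fun _ _ => 0)); last first.
    by apply/funext => e; apply/funext => y; rewrite subr0.
  have alg (p : R) : p = p - 2 * p + p -> p = 0 by lra.
  exact: alg.
exists (4 * C ^+ 2) => f h K; have [[lf _] lh _] := K.
rewrite (_ : (fun e y => _) = axpy (- x)%:C h f); last first.
  apply/funext => e; apply/funext => y; rewrite /axpy.
  by rewrite (rmorphN (real_complex R)) mulNr.
rewrite !L2_sqnorm//; last exact: L2_axpy.
by rewrite -EFinM lee_fin; exact: form_bound_kirchhoff.
Qed.

End Resolvent.

(** * Isoperimetric constants *)

Section Isoperimetry.
Import Order.TTheory GRing.Theory Num.Theory.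
Local Open Scope classical_set_scope.
Local Open Scope ring_scope.
Context {R : realType} {G : metricGraph R}.
Local Notation V := (vertex G).
Local Notation E := (edge G).
Implicit Types (v w : V) (e : E) (X Y : {fset V}).

Lemma exists_notin_vertex X : exists v : V, v \notin X.
Proof.
apply: contrapT => H; apply: (@vertex_infinite R G).
apply: (@sub_finite_set _ _ [set` X]); last exact: finite_fset.
by move=> v _ /=; apply/negPn/negP => vX; apply: H; exists v.
Qed.

(* A path leaving [X] crosses its boundary. *)
Lemma edge_boundary_neq0 X : X != fset0 -> exists e, edge_boundary X e.
Proof.
case/fset0Pn => v vX; have [w wX] := exists_notin_vertex X.
have [p [+ lastp]] := connected_graph v w.
elim: p v vX lastp => [|y p ih] v vX /= lastp; first by rewrite -lastp vX in wX.
move=> /andP[/asboolP[e He] yp].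
have [yX|yX] := boolP (y \in X); first exact: (ih y).
by exists e; rewrite /edge_boundary/=; case: He => -[-> ->]; rewrite vX (negbTE yX).
Qed.

(** A singleton has a boundary edge, and that edge is incident to its only vertex. *)
Lemma star_nonempty v : exists e, star v e.
Proof.
have [e] := @edge_boundary_neq0 [fset v]%fset (introT (fset0Pn _) (ex_intro _ v (fset11 v))).
rewrite /edge_boundary/= !inE => H; exists e; rewrite /star/=.
by case: (init e == v) H => //=; case: (term e == v).
Qed.

Lemma edge_boundary_sub X : edge_boundary X `<=` \bigcup_(v in [set` X]) star v.
Proof.
move=> e; rewrite /edge_boundary/=.
have [iX _|_] := boolP (init e \in X); first by exists (init e) => //; rewrite /star/= eqxx.
by rewrite addFb => tX; exists (term e) => //; rewrite /star/= eqxx orbT.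
Qed.

Definition incident X : {fset E} := fset_set (\bigcup_(v in [set` X]) star v).

Lemma incidentP X e : (e \in incident X) = (init e \in X) || (term e \in X).
Proof.
rewrite /incident in_fset_set; last first.
  by apply: bigcup_finite; [exact: finite_fset|move=> v _; exact: locally_finite].
apply/idP/orP => [|[iX|tX]]; rewrite ?inE.
- by move=> -[v /= vX]; rewrite /star/= => /orP[/eqP vE|/eqP vE]; [left|right]; rewrite vE.
- by exists (init e) => //; rewrite /star/= eqxx.
- by exists (term e) => //; rewrite /star/= eqxx orbT.
Qed.

Lemma finite_edge_boundary X : finite_set (edge_boundary X).
Proof.
apply: sub_finite_set (@edge_boundary_sub X) _.
by apply: bigcup_finite; [exact: finite_fset|move=> v _; exact: locally_finite].
Qed.

(** Boundary sizes and degrees become sums of indicators over one common edge set, so that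
    inequalities between them can be checked edge by edge. *)
Lemma card_fset_sum (F F' : {fset E}) : (F' `<=` F)%fset ->
  (#|` F'|%:R : R) = \sum_(e <- F) (e \in F')%:R.
Proof.
move=> F'F; rewrite -(big_fset_incl _ F'F (F := fun e => (e \in F')%:R)).
  by rewrite card_fset_sum1 natr_sum big_seq [RHS]big_seq; apply: eq_bigr => e ->.
by move=> e _ /negbTE ->.
Qed.

Lemma deg_sum (F : {fset E}) v : (fset_set (star v) `<=` F)%fset ->
  (deg v)%:R = \sum_(e <- F) ((init e == v)%:R + (term e == v)%:R) :> R.
Proof.
move=> vF; rewrite /deg (card_fset_sum vF); apply: eq_bigr => e _.
have -> : (e \in fset_set (star v)) = (init e == v) || (term e == v).
  by rewrite in_fset_set; [apply/idP/idP; rewrite inE|exact: locally_finite].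
have := loopless e.
have [<-|_] := eqVneq (init e) v; last by rewrite add0r.
by rewrite eq_sym => /negbTE ->; rewrite addr0.
Qed.

Lemma star_incident X v : v \in X -> (fset_set (star v) `<=` incident X)%fset.
Proof.
move=> vX; apply/fsubsetP => e; rewrite in_fset_set; last exact: locally_finite.
by rewrite incidentP inE /star/= => /orP[/eqP->|/eqP->]; rewrite vX ?orbT.
Qed.

Lemma sum_delta (p : V -> R) X v : (forall w, w \notin X -> p w = 0) ->
  \sum_(w <- X) ((v == w)%:R * p w) = p v.
Proof.
move=> pX; have [vX|vX] := boolP (v \in X).
  rewrite (big_fsetD1 v vX)/= eqxx mul1r big_seq big1 ?addr0// => w.
  by rewrite !inE => /andP[wv _]; rewrite eq_sym (negbTE wv) mul0r.
rewrite pX// big_seq big1// => w wX; case: eqP => [vw|_]; last by rewrite mul0r.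
by rewrite vw wX in vX.
Qed.

(** Double counting of incident pairs. [F] may be larger than the set of edges meeting [X], because
    [p] vanishes at both ends of every other edge. *)
Lemma handshake (p : V -> R) X (F : {fset E}) : (incident X `<=` F)%fset ->
  (forall w, w \notin X -> p w = 0) ->
  \sum_(v <- X) ((deg v)%:R * p v) = \sum_(e <- F) (p (init e) + p (term e)).
Proof.
move=> XF pX.
transitivity (\sum_(v <- X) \sum_(e <- F) ((init e == v)%:R * p v + (term e == v)%:R * p v)).
  rewrite big_seq [RHS]big_seq; apply: eq_bigr => v vX.
  rewrite (deg_sum (fsubset_trans (star_incident vX) XF)) mulr_suml.
  by apply: eq_bigr => e _; rewrite mulrDl.
rewrite exchange_big/=; apply: eq_bigr => e _.
by rewrite big_split/= !sum_delta.
Qed.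

Lemma deg_gt0 v : (0 < deg v)%N.
Proof.
rewrite /deg cardfs_gt0; apply/fset0Pn; have [e ve] := star_nonempty v.
by exists e; rewrite in_fset_set ?inE//; exact: locally_finite.
Qed.

Lemma deg_fset_gt0 X : X != fset0 -> (0 < deg_fset X)%N.
Proof.
case/fset0Pn => v vX; rewrite /deg_fset (big_fsetD1 v vX)/=.
by rewrite ltn_addr// deg_gt0.
Qed.

Definition isoperimetric (c : R) (Y : set V) := forall X : {fset V}, [set` X] `<=` Y ->
  c * (deg_fset X)%:R <= #|` fset_set (edge_boundary X)|%:R.

Lemma alpha_comb_gt0P (Y : set V) : (0 < alpha_comb Y)%E <->
  exists2 c : R, 0 < c & isoperimetric c Y.
Proof.
split=> [a0|[c c0 cY]].
  have [c c0 ca] : exists2 c : R, 0 < c & (c%:E <= alpha_comb Y)%E.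
    (* If [Y] is empty the infimum is [+oo], and any positive constant serves. *)
    move: a0; case: (alpha_comb Y) => [r|_|//]; last by exists 1 => //; rewrite leey.
    by rewrite lte_fin => r0; exists r.
  exists c => // X XY; have [->|X0] := eqVneq X fset0.
    by rewrite /deg_fset big_seq_fset0 mulr0.
  rewrite -ler_pdivlMr ?ltr0n ?deg_fset_gt0// -lee_fin.
  by apply: le_trans ca _; apply: ereal_inf_lbound; exists X.
apply: (@lt_le_trans _ _ c%:E); first by rewrite lte_fin.
apply: le_ereal_inf_tmp => _ [X [X0 XY] <-].
by rewrite lee_fin ler_pdivlMr ?ltr0n ?deg_fset_gt0//; exact: cY.
Qed.

Lemma alpha_comb_ess_gt0P : (0 < alpha_comb_ess G)%E <->
  exists K : {fset V}, (0 < alpha_comb (~` [set` K]))%E.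
Proof.
split=> [/ereal_sup_gt[_ [K _ <-] a0]|[K a0]]; first by exists K.
by apply: (lt_le_trans a0); apply: ereal_sup_ubound; exists K.
Qed.

Lemma in_fset_boundary X e :
  (e \in fset_set (edge_boundary X)) = (init e \in X) (+) (term e \in X).
Proof.
rewrite in_fset_set; last exact: finite_edge_boundary.
by apply/idP/idP; rewrite inE.
Qed.

Lemma boundary_incident X : (fset_set (edge_boundary X) `<=` incident X)%fset.
Proof.
by apply/fsubsetP => e; rewrite in_fset_boundary incidentP; case: (init e \in X).
Qed.

Lemma card_boundary_sum X (F : {fset E}) : (incident X `<=` F)%fset ->
  #|` fset_set (edge_boundary X)|%:R =
  \sum_(e <- F) ((init e \in X) (+) (term e \in X))%:R :> R.
Proof.
move=> XF; rewrite (card_fset_sum (fsubset_trans (boundary_incident X) XF)).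
by apply: eq_bigr => e _; rewrite in_fset_boundary.
Qed.

Lemma deg_fset_sum X (F : {fset E}) : (incident X `<=` F)%fset ->
  (deg_fset X)%:R = \sum_(e <- F) ((init e \in X)%:R + (term e \in X)%:R) :> R.
Proof.
move=> XF; rewrite -(@handshake (fun v => (v \in X)%:R) X F)//; last first.
  by move=> w /negbTE ->.
rewrite /deg_fset natr_sum big_seq [RHS]big_seq.
by apply: eq_bigr => v ->; rewrite mulr1.
Qed.

(* Subtracting from [p] its minimum [m] on the support [X] lowers the left-hand
   side by [c * m * deg X] and the right-hand side by [m * #|dX|]. *)
Lemma layer_cake (c : R) X (p : V -> R) (F : {fset E}) :
  isoperimetric c [set: V] -> (incident X `<=` F)%fset ->
  (forall v, 0 <= p v) -> (forall v, v \notin X -> p v = 0) ->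
  c * \sum_(e <- F) (p (init e) + p (term e)) <=
  \sum_(e <- F) `|p (init e) - p (term e)|.
Proof.
move=> iso; move: {2}(#|` X|) (erefl #|` X|) => n.
elim: n X p => [|n ih] X p Xn XF p0 pX.
  move/cardfs0_eq : Xn => X0.
  have pz v : p v = 0 by rewrite pX// X0 inE.
  rewrite big1 ?mulr0 ?sumr_ge0// => e _; by rewrite !pz addr0.
have [v0 v0X vmin] : exists2 v0, v0 \in X & forall v, v \in X -> p v0 <= p v.
  have Xne : X != fset0 by rewrite -cardfs_gt0 Xn.
  have [v vX] := fset0Pn _ Xne.
  have [/= i _ iP] := @arg_minP _ _ _ [` vX]%fset xpredT (fun i => p (val i)) isT.
  by exists (val i); [exact: valP|move=> w wX; have := iP [` wX]%fset isT].
pose m := p v0; pose q v := p v - m * (v \in X)%:R.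
have q0 v : 0 <= q v.
  rewrite /q; have [vX|vX] := boolP (v \in X); rewrite ?mulr1 ?mulr0 ?subr0//.
  by rewrite subr_ge0 vmin.
(* Subtracting the layer of height [m] kills the value at [v0], so the support loses a vertex and
   the induction on its cardinality proceeds. *)
have qX v : v \notin (X `\ v0)%fset -> q v = 0.
  rewrite !inE negb_and negbK => /orP[/eqP ->|vX].
    by rewrite /q v0X mulr1 subrr.
  by rewrite /q pX// (negbTE vX) mulr0 subr0.
have XF' : (incident (X `\ v0) `<=` F)%fset.
  apply: fsubset_trans XF; apply/fsubsetP => e; rewrite !incidentP !inE.
  by move=> /orP[/andP[_ ->]|/andP[_ ->]]; rewrite ?orbT.
have Xn' : #|` (X `\ v0)%fset| = n.
  by have := cardfsD1 v0 X; rewrite v0X Xn add1n => -[].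
have := ih _ q Xn' XF' q0 qX.
have -> : \sum_(e <- F) (p (init e) + p (term e)) =
    \sum_(e <- F) (q (init e) + q (term e)) + m * (deg_fset X)%:R.
  rewrite (deg_fset_sum XF) mulr_sumr -big_split; apply: eq_bigr => e _ /=.
  by rewrite /q; ring.
(* Inside [X] the subtraction cancels in the difference. On a boundary edge the outer value is 0 and
   the inner one is at least [m], so the absolute value drops by exactly [m]. *)
have -> : \sum_(e <- F) `|p (init e) - p (term e)| =
    \sum_(e <- F) `|q (init e) - q (term e)| +
    m * #|` fset_set (edge_boundary X)|%:R.
  rewrite (card_boundary_sum XF) mulr_sumr -big_split; apply: eq_bigr => e _ /=.
  have := q0 (init e); have := q0 (term e); rewrite /q.
  have := pX (init e); have := pX (term e).
  case: (init e \in X); case: (term e \in X) => /= h1 h2; rewrite ?mulr1 ?mulr0 ?subr0.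
  - by move=> _ _; rewrite addr0; congr (`|_|); ring.
  - by rewrite h1// !subr0 => _ h; rewrite !ger0_norm// subrK.
  - by rewrite h2// !sub0r !normrN => h _; rewrite !ger0_norm// subrK.
  - by rewrite addr0.
have := iso X (fun _ _ => I); have := p0 v0; rewrite -/m.
move=> m0 isoX qF; rewrite mulrDr; apply: lerD qF _.
by rewrite mulrCA; exact: ler_wpM2l.
Qed.

Lemma alpha_comb_of_ess : (0 < alpha_comb_ess G)%E -> (0 < alpha_comb [set: V])%E.
Proof.
move=> /alpha_comb_ess_gt0P[K /alpha_comb_gt0P[c c0 iso]]; apply/alpha_comb_gt0P.
pose d : R := (deg_fset K)%:R; have d0 : 0 <= d by exact: ler0n.
have S0 : 0 < 1 + d + c * d by rewrite -addrA ltr_wpDr// addr_ge0// mulr_ge0// ltW.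
(* With [b], [q] the degree sum and boundary size of [X], passing to [Y] costs at most [d] in each,
   so [c * b <= q + d + c * d]; since [q >= 1], this is at most [(1 + d + c * d) * q]. *)
exists (c / (1 + d + c * d)); first exact: divr_gt0.
move=> X _; have [->|X0] := eqVneq X fset0.
  by rewrite /deg_fset big_seq_fset0 mulr0.
pose Y := (X `\` K)%fset; pose F := (incident X `|` incident K)%fset.
have XF : (incident X `<=` F)%fset by exact: fsubsetUl.
have KF : (incident K `<=` F)%fset by exact: fsubsetUr.
have YF : (incident Y `<=` F)%fset.
  apply: fsubset_trans XF; apply/fsubsetP => e; rewrite !incidentP !inE.
  by move=> /orP[/andP[_ ->]|/andP[_ ->]]; rewrite ?orbT.
have isoY : c * (deg_fset Y)%:R <= #|` fset_set (edge_boundary Y)|%:R.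
  by apply: iso => v /=; rewrite !inE => /andP[/negP].
have degX : (deg_fset X)%:R <= (deg_fset Y)%:R + d.
  rewrite /d (deg_fset_sum XF) (deg_fset_sum YF) (deg_fset_sum KF) -big_split.
  apply: ler_sum => e _ /=; rewrite !inE.
  by do 4 case: (_ \in _) => /=; lra.
(* A boundary edge of [Y] that is not one of [X] has an endpoint in [K], hence is counted by the
   degree sum of [K]. *)
have bdY : #|` fset_set (edge_boundary Y)|%:R <=
    #|` fset_set (edge_boundary X)|%:R + d.
  rewrite /d (card_boundary_sum XF) (card_boundary_sum YF) (deg_fset_sum KF) -big_split.
  apply: ler_sum => e _ /=; rewrite !inE.
  by do 4 case: (_ \in _) => /=; lra.
have bX : 1 <= #|` fset_set (edge_boundary X)|%:R :> R.
  rewrite ler1n cardfs_gt0; apply/fset0Pn; have [e eX] := edge_boundary_neq0 X0.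
  by exists e; rewrite in_fset_boundary.
move: isoY degX bdY bX; clearbody d.
move: (deg_fset Y)%:R (deg_fset X)%:R #|` fset_set (edge_boundary Y)|%:R
  #|` fset_set (edge_boundary X)|%:R => a b p q h1 h2 h3 h4.
rewrite mulrAC ler_pdivrMr//.
have h5 : 0 <= (d + c * d) * (q - 1) by rewrite mulr_ge0 ?subr_ge0// addr_ge0// mulr_ge0// ltW.
have h6 : c * b <= c * (a + d) by rewrite ler_pM2l.
lra.
Qed.

End Isoperimetry.

(** * From isoperimetry to the form bound through vertex values *)

Section VertexValues.
Import Order.TTheory GRing.Theory Num.Theory.
Import numFieldNormedType.Exports.
Local Open Scope classical_set_scope.
Local Open Scope ring_scope.
Local Open Scope complex_scope.
Context {R : realType}.
Local Notation Re := (@complex.Re R).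
Local Notation Im := (@complex.Im R).
Local Notation mu := (@lebesgue_measure R).
Implicit Types (z : R[i]).

Definition nsq z : R := Re z ^+ 2 + Im z ^+ 2.

Lemma nsq_ge0 z : 0 <= nsq z.
Proof. by rewrite addr_ge0 ?sqr_ge0. Qed.

Lemma nsq0 : nsq 0 = 0.
Proof. by rewrite /nsq /= expr0n addr0. Qed.

Lemma nsqN z : nsq (- z) = nsq z.
Proof. by rewrite /nsq !ReImE !sqrrN. Qed.

Lemma nsq_le2 z z' : nsq z <= 2 * nsq (z - z') + 2 * nsq z'.
Proof.
rewrite /nsq !ReImE; move: (Re z) (Im z) (Re z') (Im z') => a b c d.
have := sqr_ge0 (a - 2 * c); have := sqr_ge0 (b - 2 * d); lra.
Qed.

Lemma nsq_sub_le z z' z'' : nsq (z - z'') <= 2 * nsq (z - z') + 2 * nsq (z' - z'').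
Proof. by have := nsq_le2 (z - z'') (z' - z''); rewrite opprB addrA subrK. Qed.

(* [|x|^2 - |y|^2 <= |x - y| * (|x| + |y|)] and Young's inequality *)
Lemma nsq_dist (t : R) z z' : 0 < t ->
  `|nsq z - nsq z'| <= t * (nsq z + nsq z') + (2 * t)^-1 * nsq (z - z').
Proof.
move=> t0; rewrite /nsq !ReImE; move: (Re z) (Im z) (Re z') (Im z') => a b c d.
have t2 : 0 < 2 * t by rewrite mulr_gt0.
have young (p q : R) : `|p ^+ 2 - q ^+ 2| <= t * (p ^+ 2 + q ^+ 2) + (2 * t)^-1 * (p - q) ^+ 2.
  rewrite -(ler_pM2l t2) mulrDr [_ * (_^-1 * _)]mulrA divff ?gt_eqF// mul1r.
  have -> : 2 * t * `|p ^+ 2 - q ^+ 2| = `|2 * t * (p ^+ 2 - q ^+ 2)|.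
    by rewrite [RHS]normrM (gtr0_norm t2).
  (* Added to the square of [t * (p + q) - (p - q)] or of [t * (p + q) + (p - q)], this square
     leaves [2 * t ^+ 2 * (p ^+ 2 + q ^+ 2) + (p - q) ^+ 2] and a cross term of either sign. *)
  have h0 := sqr_ge0 (t * (p - q)).
  rewrite ler_norml; apply/andP; split.
    by have := sqr_ge0 (t * (p + q) + (p - q)); lra.
  by have := sqr_ge0 (t * (p + q) - (p - q)); lra.
have -> : a ^+ 2 + b ^+ 2 - (c ^+ 2 + d ^+ 2) = (a ^+ 2 - c ^+ 2) + (b ^+ 2 - d ^+ 2) by ring.
apply: le_trans (ler_normD _ _) (le_trans (lerD (young a c) (young b d)) _).
by rewrite le_eqVlt; apply/orP; left; apply/eqP; ring.
Qed.

Lemma CH1_osc l u u' x y : CH1 l u u' -> 0 <= x <= l -> 0 <= y <= l ->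
  nsq (u y - u x) <= l * edge_norm l u'.
Proof.
move=> cu xl yl; have [_ su] := CH1_edge_sq cu; have [cr ci] := cu.
by rewrite edge_normE// mulrDr /nsq !ReImE lerD// ?(H1_osc cr)// (H1_osc ci).
Qed.

Lemma CH1_poincare l u u' x : CH1 l u u' -> 0 <= x <= l ->
  edge_norm l u <= 2 * l * nsq (u x) + 2 * l ^+ 2 * edge_norm l u'.
Proof.
move=> cu xl; have [su su'] := CH1_edge_sq cu; have [cr ci] := cu.
rewrite !edge_normE// /nsq !mulrDr addrACA lerD//.
  exact: (H1_poincare cr).
exact: (H1_poincare ci).
Qed.

Lemma CH1_sobolev l u u' h x : CH1 l u u' -> 0 <= x <= l -> 0 <= h <= l ->
  h * nsq (u x) <= 2 * edge_norm l u + 2 * h ^+ 2 * edge_norm l u'.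
Proof.
move=> cu xl hl; have [su su'] := CH1_edge_sq cu; have [cr ci] := cu.
rewrite !edge_normE// /nsq !mulrDr addrACA lerD//.
  exact: (H1_sobolev cr).
exact: (H1_sobolev ci).
Qed.

Context {G : metricGraph R}.
Local Notation V := (vertex G).
Local Notation E := (edge G).
Local Notation efun := (E -> R -> R[i]).
Implicit Types (e : E) (D : set V) (v w : V).

(** The value is read off an arbitrary incident edge. For [f] in [dom_H0] the choice is immaterial:
    by continuity off [D], and because every incident edge has value 0 on [D]. *)
Definition vval (f : efun) v : R[i] := vertex_value f (projT1 (cid (star_nonempty v))) v.

Lemma vertex_value_vval D f f' e v : dom_H0 D f f' -> star v e ->
  vertex_value f e v = vval f v.
Proof.
move=> [_ _ cont _ dir] ve; rewrite /vval; case: cid => e' ve' /=.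
have [Dv|Dv] := pselect (D v); first by rewrite !(dir v Dv).
exact: cont.
Qed.

Lemma star_init e : star (init e) e. Proof. by rewrite /star/= eqxx. Qed.
Lemma star_term e : star (term e) e. Proof. by rewrite /star/= eqxx orbT. Qed.

Lemma vval_init D f f' e : dom_H0 D f f' -> f e 0 = vval f (init e).
Proof.
move=> df; rewrite -(vertex_value_vval df (star_init e)).
by rewrite /vertex_value eqxx.
Qed.

Lemma vval_term D f f' e : dom_H0 D f f' -> f e (len e) = vval f (term e).
Proof.
move=> df; rewrite -(vertex_value_vval df (star_term e)).
by rewrite /vertex_value (negbTE (loopless e)).
Qed.

Lemma in0l e : 0 <= (0 : R) <= len e. Proof. by rewrite lexx ltW// len_gt0. Qed.
Lemma inll e : 0 <= len e <= len e. Proof. by rewrite lexx ltW// len_gt0. Qed.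

Lemma vval_osc D f f' e : dom_H0 D f f' ->
  nsq (vval f (init e) - vval f (term e)) <= len e * edge_norm (len e) (f' e).
Proof.
move=> df; rewrite -(vval_init e df) -(vval_term e df).
exact: (CH1_osc (dom_H0_CH1 e df) (inll e) (in0l e)).
Qed.

Lemma vval_support D f f' : dom_H0 D f f' ->
  exists X : {fset V}, forall v, v \notin X -> nsq (vval f v) = 0.
Proof.
move=> df; have [_ fs _ _ _] := df.
set S := [set e | exists2 x, x \in `[0, len e] & f e x != 0] in fs.
exists ((@init R G) @` fset_set S `|` (@term R G) @` fset_set S)%fset => v.
rewrite !inE negb_or => /andP[vi vt].
suff -> : vval f v = 0 by exact: nsq0.
have [e ve] := star_nonempty v.
rewrite -(vertex_value_vval df ve); apply/eqP/negPn/negP => nz.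
have eS : e \in fset_set S.
  rewrite in_fset_set// inE /S/=; move: nz; rewrite /vertex_value.
  by case: ifP => _ nz; [exists 0|exists (len e)] => //; rewrite in_itv/=; [exact: in0l|exact: inll].
move: ve; rewrite /star/= => /orP[/eqP vE|/eqP vE].
- by move: vi; rewrite -vE; rewrite in_imfset.
- by move: vt; rewrite -vE; rewrite in_imfset.
Qed.

Lemma isoperimetric_form_bound D (c L : R) : 0 < c -> isoperimetric c [set: V] ->
  (forall e, len e <= L) -> exists2 C : R, 0 < C & form_bound D C.
Proof.
move=> c0 iso lenL.
have [e0 _] : exists e : E, True.
  apply: contrapT => nE; apply: (@edge_infinite R G).
  by rewrite (_ : [set: E] = set0)//; apply/seteqP; split=> // e _; apply: nE; exists e.
have L0 : 0 < L by apply: lt_le_trans (lenL e0); exact: len_gt0.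
exists (4 * L ^+ 2 / c ^+ 2 + 2 * L ^+ 2).
  have LL : 0 < L ^+ 2 by exact: exprn_gt0.
  apply: addr_gt0; last exact: mulr_gt0.
  by apply: divr_gt0; [exact: mulr_gt0|exact: exprn_gt0].
move=> f f' df; have [lf lf'] := dom_H0_L2 df.
have [X XP] := vval_support df; have [F0 F0P] := dom_H0_support df.
pose p v := nsq (vval f v).
pose F := (incident X `|` F0)%fset.
have XF : (incident X `<=` F)%fset by exact: fsubsetUl.
pose N' := \sum_(e <- F) edge_norm (len e) (f' e).
have N'le : N' <= nrm2 f' by exact: sum_edge_norm_le.
have N'0 : 0 <= N' by apply: sumr_ge0 => e _; exact: edge_norm_ge0.
pose S := \sum_(e <- F) (p (init e) + p (term e)).
have layers := layer_cake iso XF (fun v => nsq_ge0 (vval f v)) XP.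
have c2 : 0 < c / 2 by rewrite divr_gt0.
(* Young's inequality with parameter [c / 2]: half of [c * S] can be absorbed on the left, and the
   rest is the oscillation along edges, controlled by the energy. *)
have up : \sum_(e <- F) `|p (init e) - p (term e)| <= c / 2 * S + c^-1 * (L * N').
  rewrite /S /N' !mulr_sumr -big_split; apply: ler_sum => e _ /=.
  apply: le_trans (nsq_dist _ _ c2) _; rewrite lerD2l.
  have -> : 2 * (c / 2) = c by rewrite mulrCA divff ?mulr1.
  apply: ler_wpM2l; first by rewrite invr_ge0 ltW.
  apply: le_trans (vval_osc e df) _; apply: ler_wpM2r => //; exact: edge_norm_ge0.
have Sle : S <= 2 * L / c ^+ 2 * N'.
  have := le_trans layers up; rewrite -/S => h.
  have h1 : c / 2 * S <= c^-1 * (L * N') by lra.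
  rewrite -(ler_pM2l c2); apply: le_trans h1 _.
  rewrite le_eqVlt; apply/orP; left; apply/eqP; field; by rewrite gt_eqF.
have [_ fle] : L2 f /\ nrm2 f <= \sum_(e <- F) edge_norm (len e) (f e).
  apply: nrm2_fsupport => [e|e]; first exact: L2_edge.
  by rewrite inE negb_or => /andP[_ /F0P[]].
(* Poincare's inequality from the endpoint [init e] passes from vertex values to the norm on the
   whole edge. *)
have edges : \sum_(e <- F) edge_norm (len e) (f e) <= 2 * L * S + 2 * L ^+ 2 * N'.
  rewrite /S /N' !mulr_sumr -big_split; apply: ler_sum => e _ /=.
  apply: le_trans (CH1_poincare (dom_H0_CH1 e df) (in0l e)) _.
  have el := len_gt0 e; rewrite (vval_init e df) -/(p _); apply: lerD.
    apply: (@le_trans _ _ (2 * L * p (init e))).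
      by apply: ler_wpM2r; [exact: nsq_ge0|rewrite ler_pM2l].
    by apply: ler_wpM2l; [rewrite mulr_ge0// ltW|rewrite lerDl nsq_ge0].
  apply: ler_wpM2r; first exact: edge_norm_ge0.
  by rewrite ler_pM2l// ler_pXn2r// nnegrE ltW.
apply: le_trans fle (le_trans edges _).
have h2 : 2 * L * S <= 2 * L * (2 * L / c ^+ 2 * N').
  by apply: ler_wpM2l Sle; rewrite mulr_ge0// ltW.
apply: (@le_trans _ _ ((4 * L ^+ 2 / c ^+ 2 + 2 * L ^+ 2) * N')).
  have -> : (4 * L ^+ 2 / c ^+ 2 + 2 * L ^+ 2) * N' =
    2 * L * (2 * L / c ^+ 2 * N') + 2 * L ^+ 2 * N' by ring.
  by rewrite lerD2r.
have q0 (k : R) : 0 <= k ^+ 2 by exact: sqr_ge0.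
apply: ler_wpM2l N'le; apply: addr_ge0; last exact: mulr_ge0.
by apply: divr_ge0 => //; exact: mulr_ge0.
Qed.

End VertexValues.

(** * Triviality of the kernel *)

Section Kernel.
Import Order.TTheory GRing.Theory Num.Theory.
Import numFieldNormedType.Exports.
Local Open Scope classical_set_scope.
Local Open Scope ring_scope.
Local Open Scope complex_scope.
Context {R : realType} {G : metricGraph R}.
Local Notation V := (vertex G).
Local Notation E := (edge G).
Local Notation efun := (E -> R -> R[i]).
Implicit Types (e : E) (D : set V) (v w : V) (f h : efun).

Lemma cvg0_sum (F : {fset E}) (a : E -> nat -> R) :
  (forall e, a e @ \oo --> (0 : R)) ->
  (fun n => \sum_(e <- F) a e n) @ \oo --> (0 : R).
Proof.
move=> a0; elim: (F : seq E) => [|e s ih].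
  by under eq_fun do rewrite big_nil; exact: cvg_cst.
under eq_fun do rewrite big_cons; have := cvg0_lin 1 1 (a0 e) ih.
by under eq_fun do rewrite !mul1r.
Qed.

(* If the form of [f] vanishes, an approximating sequence becomes constant on
   the whole connected graph; as the total length is infinite, this constant
   tends to 0. *)
Lemma kirchhoff_injective D f h (l0 : R) : 0 < l0 -> (forall e, l0 <= len e) ->
  kirchhoff D f h -> nrm2 h = 0 -> sqnorm f = 0%E.
Proof.
move=> l00 lenl0 K h0; have [[lf [u [u' fu]]] lh _] := K.
have [lu lu'] := form_approx_L2 fu.
have [du uf _] := (form_approxP _ _ _ lf).1 fu.
(* Testing the equation with [f] itself, the energies of [u n] converge to [ip h f], which is 0
   because [h] is null. *)
have q0 : (fun n => nrm2 (u' n)) @ \oo --> (0 : R).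
  have -> : (0 : R) = ip h f; last exact: (kirchhoff_weak K fu lf fu).
  apply/esym/eqP; rewrite -sqrf_eq0 eq_le sqr_ge0 andbT.
  by apply: le_trans (ip_cauchy_schwarz lh lf) _; rewrite h0 mul0r.
have en e n : edge_norm (len e) (u' n e) <= nrm2 (u' n) by exact: edge_norm_le_nrm2.
have adj e : (fun n => nsq (vval (u n) (init e) - vval (u n) (term e))) @ \oo --> (0 : R).
  apply: cvg0_squeeze (cvg0_lin (len e) 0 q0 q0) => n; rewrite ger0_norm ?nsq_ge0//.
  apply: le_trans (vval_osc e (du n)) _; rewrite mul0r addr0.
  by rewrite ler_pM2l ?len_gt0.
have conn v w : (fun n => nsq (vval (u n) v - vval (u n) w)) @ \oo --> (0 : R).
  have [p [+ <-]] := connected_graph v w.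
  elim: p v => [|y p ih] v /=.
    by move=> _; under eq_fun do rewrite subrr nsq0; exact: cvg_cst.
  move=> /andP[/asboolP[e He] yp].
  have vy : (fun n => nsq (vval (u n) v - vval (u n) y)) @ \oo --> (0 : R).
    case: He => -[<- <-]; first exact: adj.
    by under eq_fun do rewrite -nsqN opprB; exact: adj.
  apply: cvg0_squeeze (cvg0_lin 2 2 vy (ih y yp)) => n.
  by rewrite ger0_norm ?nsq_ge0//; exact: nsq_sub_le.
pose M := 2 * 1 + 2 * nrm2 f.
have M0 : 0 <= M by rewrite addr_ge0// mulr_ge0// nrm2_ge0.
have [N1 MP] : exists N, forall n, (N <= n)%N -> nrm2 (u n) <= M.
  have [N NP] := (cvg0_ge0P (fun n => nrm2_ge0 _)).1 uf 1 ltr01.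
  exists N => n Nn; apply: le_trans (nrm2_le2 (lu n) lf) _.
  by rewrite lerD2r ler_pM2l//; exact: NP.
have van v : (fun n => nsq (vval (u n) v)) @ \oo --> (0 : R).
  apply/(cvg0_ge0P (fun n => nsq_ge0 _)) => eps eps0.
  (* If [u n] is nearly constant, [k] edges of length at least [l0] carry mass of order [k * l0]
     times its square at [v]. The total mass stays below [M], so more than [8 * M / (l0 * eps)]
     edges force the value below [eps]. *)
  have [F _ FK] := infinite_set_fset (Num.truncn (8 * M / (l0 * eps))).+1 (@edge_infinite R G).
  pose k : R := #|` F|%:R.
  have le0 : 0 < l0 * eps by rewrite mulr_gt0.
  have kM : 8 * M <= k * (l0 * eps).
    rewrite -ler_pdivrMr//; apply: le_trans (ltW (truncnS_gt _)) _.
    by rewrite ler_nat.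
  have k0 : 0 < k by rewrite ltr0n; exact: leq_ltn_trans FK.
  have sum0 := cvg0_sum F (fun e => conn v (init e)).
  have rest := cvg0_lin (2 * l0) (4 * k * l0 ^+ 2) sum0 q0.
  have rest0 n : 0 <= 2 * l0 * (\sum_(e <- F) nsq (vval (u n) v - vval (u n) (init e))) +
      4 * k * l0 ^+ 2 * nrm2 (u' n).
    rewrite addr_ge0// ?mulr_ge0 ?nrm2_ge0 ?sqr_ge0// ?(ltW l00) ?(ltW k0)//.
    by apply: sumr_ge0 => e _; exact: nsq_ge0.
  have e0 : 0 < l0 * k * eps / 2 by rewrite divr_gt0// !mulr_gt0.
  have [N2 N2P] := (cvg0_ge0P rest0).1 rest _ e0.
  exists (maxn N1 N2) => n; rewrite geq_max => /andP[n1 n2].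
  (* Sobolev's inequality with window [l0] at [init e], after comparing the values at [v] and
     [init e], summed over the edges of [F]. *)
  have le1 : k * (l0 * nsq (vval (u n) v)) <=
      2 * l0 * (\sum_(e <- F) nsq (vval (u n) v - vval (u n) (init e))) +
      4 * k * l0 ^+ 2 * nrm2 (u' n) + 4 * nrm2 (u n).
    have cst_sum (c : R) : k * c = \sum_(e <- F) c.
      by rewrite big_const_seq count_predT iter_addr_0 -[RHS]mulr_natl.
    apply: (@le_trans _ _ (\sum_(e <- F) (2 * l0 * nsq (vval (u n) v - vval (u n) (init e)) +
        4 * l0 ^+ 2 * nrm2 (u' n) + 4 * edge_norm (len e) (u n e)))).
      rewrite cst_sum; apply: ler_sum => e _.
      have := CH1_sobolev (dom_H0_CH1 e (du n)) (in0l e) (introT andP (conj (ltW l00) (lenl0 e))).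
      rewrite (vval_init e (du n)) => h1.
      have h2 : l0 * nsq (vval (u n) v) <=
          l0 * (2 * nsq (vval (u n) v - vval (u n) (init e)) + 2 * nsq (vval (u n) (init e))).
        by rewrite ler_pM2l//; exact: nsq_le2.
      have h3 : l0 ^+ 2 * edge_norm (len e) (u' n e) <= l0 ^+ 2 * nrm2 (u' n).
        by rewrite ler_pM2l ?exprn_gt0.
      move: h1 h2 h3; move: (nsq _) (nsq _) (nsq _) => a b c.
      move: (edge_norm _ _) (edge_norm _ _) (nrm2 _) => p q r; lra.
    rewrite [leLHS]big_split [X in X + _ <= _]big_split/=.
    rewrite -(cst_sum (4 * l0 ^+ 2 * _)) -!mulr_sumr.
    have -> : 4 * k * l0 ^+ 2 * nrm2 (u' n) = k * (4 * l0 ^+ 2 * nrm2 (u' n)) by ring.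
    by rewrite lerD2l ler_pM2l//; exact: sum_edge_norm_le.
  rewrite -(ler_pM2l (mulr_gt0 l00 k0)).
  have := MP n n1; have := N2P n n2; move: le1.
  have alg (a b t j : R) : j * a <= t + 4 * b -> t <= j * eps / 2 -> b <= M ->
      8 * M <= j * eps -> j * a <= j * eps by clear; lra.
  rewrite mulrA [k * l0]mulrC => h1 h2 h3; apply: alg h1 h2 h3 _.
  by rewrite [l0 * k]mulrC -mulrA.
have ef0 e : edge_norm (len e) (f e) = 0.
  have lim0 : (fun n => 2 * nrm2 (fun e x => u n e x - f e x) + 2 *
      (2 * len e * nsq (vval (u n) (init e)) + 2 * len e ^+ 2 * nrm2 (u' n))) @ \oo --> (0 : R).
    exact: cvg0_lin uf (cvg0_lin _ _ (van (init e)) q0).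
  have cst0 : (fun _ : nat => edge_norm (len e) (f e)) @ \oo --> (0 : R).
    apply: cvg0_squeeze lim0 => n; rewrite ger0_norm ?edge_norm_ge0//.
    have lun := L2_sub (lu n) lf.
    have := edge_norm_axpy_le (-1) (L2_edge e (lu n)) (L2_edge e lun).
    rewrite (_ : (fun x => _ + _) = f e); last first.
      by apply/funext => x; rewrite mulN1r opprB addrC subrK.
    rewrite /= oppr0 expr0n/= sqrrN expr1n addr0 mulr1 => h1; apply: le_trans h1 _.
    rewrite addrC; apply: lerD; rewrite ler_pM2l//.
      exact: (edge_norm_le_nrm2 e lun).
    apply: le_trans (CH1_poincare (dom_H0_CH1 e (du n)) (in0l e)) _.
    by rewrite (vval_init e (du n)) lerD2l ler_pM2l// mulr_gt0// exprn_gt0// len_gt0.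
  exact: (cvg_unique _ (cvg_cst _) cst0).
rewrite sqnormE; last by move=> e; exact: L2_edge.
by apply: esum1 => e _; rewrite ef0.
Qed.

End Kernel.

(** * Cutoff functions, and from the form bound to isoperimetry *)

Section TestFunctions.
Import Order.TTheory GRing.Theory Num.Theory.
Import numFieldNormedType.Exports.
Local Open Scope classical_set_scope.
Local Open Scope ring_scope.
Local Open Scope complex_scope.
Context {R : realType}.
Local Notation mu := (@lebesgue_measure R).

Lemma H1_is_derive (l : R) (F F' : R -> R) :
  (forall x : R, is_derive x (1 : R) F (F' x)) -> continuous F' -> H1 l F F'.
Proof.
move=> dF cF'; split; first exact/continuous_sq_integrable/continuous_subspaceT.
move=> x /andP[x0 xl].
have cF : continuous F.
  by move=> y; apply: differentiable_continuous; apply/derivable1_diffP; have [] := dF y.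
move: x0; rewrite le_eqVlt => /predU1P[<-|x0].
  by rewrite set_itv1 Rintegral_set1 addr0.
rewrite /Rintegral (@continuous_FTC2 _ F' F 0 x x0)//=.
- by rewrite addrCA subrr addr0.
- exact: continuous_subspaceT.
- split; first by move=> y _; have [] := dF y.
  + exact/cvg_at_right_filter/cF.
  + exact/cvg_at_left_filter/cF.
- by move=> y _; rewrite derive1E; have [] := dF y.
Qed.

(* The cubic with values 0, 1 and vanishing derivative at 0 and [l]. *)
Definition smoothstep (l x : R) : R := 3 * (x / l) ^+ 2 - 2 * (x / l) ^+ 3.
Definition smoothstep' (l x : R) : R := 6 * l^-1 * ((x / l) - (x / l) ^+ 2).
Definition smoothstep'' (l x : R) : R := 6 * l^-1 * (l^-1 - 2 * l^-1 * (x / l)).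

Lemma smoothstep_H1 l : H1 l (smoothstep l) (smoothstep' l).
Proof.
apply: H1_is_derive => x; last first.
  rewrite /smoothstep'; apply: cvgM; first exact: cvg_cst.
  by apply: cvgB; [|apply: cvgM]; apply: cvgM => //; exact: cvg_cst.
rewrite /smoothstep; apply: is_derive_eq.
rewrite /smoothstep' /GRing.scale/=; ring.
Qed.

Lemma smoothstep'_H1 l : H1 l (smoothstep' l) (smoothstep'' l).
Proof.
apply: H1_is_derive => x; last first.
  rewrite /smoothstep''; apply: cvgM; first exact: cvg_cst.
  apply: cvgB; first exact: cvg_cst.
  by apply: cvgM; [exact: cvg_cst|apply: cvgM => //; exact: cvg_cst].
rewrite /smoothstep'; apply: is_derive_eq.
rewrite /smoothstep'' /GRing.scale/=; ring.
Qed.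

Context {G : metricGraph R}.
Local Notation V := (vertex G).
Local Notation E := (edge G).
Local Notation efun := (E -> R -> R[i]).
Implicit Types (e : E) (D : set V) (X : {fset V}).

Definition ind X v : R := (v \in X)%:R.

(** Linear interpolation of the indicator would in general violate the Kirchhoff condition. With
    [smoothstep] every inward derivative vanishes at the vertices, so the condition holds term by
    term and the function lies in [dom_H0]. *)
Definition cutoff X : efun := fun e x =>
  (ind X (init e) + (ind X (term e) - ind X (init e)) * smoothstep (len e) x)%:C.

Definition cutoff' X : efun := fun e x =>
  ((ind X (term e) - ind X (init e)) * smoothstep' (len e) x)%:C.

Lemma cutoff_init X e : cutoff X e 0 = (ind X (init e))%:C.
Proof. by rewrite /cutoff /smoothstep mul0r !expr0n/= !mulr0 subrr mulr0 addr0. Qed.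

Lemma cutoff_term X e : cutoff X e (len e) = (ind X (term e))%:C.
Proof.
rewrite /cutoff /smoothstep divff ?gt_eqF ?len_gt0// !expr1n !mulr1.
by congr (_%:C); ring.
Qed.

Lemma cutoff_CH1 X e : CH1 (len e) (cutoff X e) (cutoff' X e).
Proof.
have c0 c : H1 (len e) (cst c) (cst 0).
  split; first exact: sq_integrable_cst.
  by move=> x _; rewrite Rintegral_cst// mul0r addr0.
split; last exact: c0.
have := H1_add (c0 (ind X (init e)))
  (H1_scale (ind X (term e) - ind X (init e)) (smoothstep_H1 (len e))).
rewrite (_ : (fun x => cst 0 x + _) = (fun x => complex.Re (cutoff' X e x)))//.
by apply/funext => x; rewrite /= add0r.
Qed.

Lemma dom_H0_cutoff D X : (forall v, D v -> v \notin X) ->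
  dom_H0 D (cutoff X) (cutoff' X).
Proof.
move=> DX.
have vv e v : star v e -> vertex_value (cutoff X) e v = (ind X v)%:C.
  rewrite /star/= /vertex_value; case: eqP => [<- _|_ /= /eqP <-].
    exact: cutoff_init.
  exact: cutoff_term.
have c0 c : H1 c (cst 0 : R -> R) (cst 0).
  split; first exact: sq_integrable_cst.
  by move=> x _; rewrite Rintegral_cst// mul0r addr0.
split.
- move=> e; apply/H2P.
  exists (fun x => ((ind X (term e) - ind X (init e)) * smoothstep'' (len e) x)%:C).
  split; last exact: cutoff_CH1.
  by split; [exact: H1_scale (smoothstep'_H1 _)|exact: c0].
- apply: (@sub_finite_set _ _ [set` incident X]); last exact: finite_fset.
  move=> e /= [x _]; rewrite incidentP; apply: contraNT.
  rewrite negb_or => /andP[/negbTE iX /negbTE tX].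
  by rewrite /cutoff /ind iX tX subrr mul0r addr0.
- by move=> v _ e e' ve ve'; rewrite !vv.
- move=> v _; apply: fsbig1 => e _; rewrite /inward_deriv /cutoff' /smoothstep'.
  case: ifP => _; first by rewrite mul0r expr0n/= subrr !mulr0.
  by rewrite divff ?gt_eqF ?len_gt0// expr1n subrr !mulr0 oppr0.
- by move=> v Dv e ve; rewrite vv// /ind (negbTE (DX v Dv)).
Qed.

(** For [t = x / l] the factor [t - t ^+ 2] is at most 1/4, so the square is at most
    [9 / (4 * l ^+ 2)]; 4 is a rounder constant. *)
Lemma smoothstep'_sq_le l (x : R) : 0 < l -> 0 <= x <= l ->
  smoothstep' l x ^+ 2 <= 4 / l ^+ 2.
Proof.
move=> l0 /andP[x0 xl]; rewrite /smoothstep'.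
have : 0 <= x / l <= 1 by rewrite divr_ge0 ?(ltW l0)//= ler_pdivrMr// mul1r.
move: (x / l) => t /andP[t0 t1].
have -> : (6 * l^-1 * (t - t ^+ 2)) ^+ 2 = (36 * (t - t ^+ 2) ^+ 2) / l ^+ 2.
  by rewrite !exprMn exprVn; ring.
apply: ler_wpM2r; first by rewrite invr_ge0 sqr_ge0.
have h0 : 0 <= t - t ^+ 2 by rewrite expr2; nra.
have h1 : t - t ^+ 2 <= 1 / 4 by have := sqr_ge0 (t - 1 / 2); lra.
have : (t - t ^+ 2) ^+ 2 <= (1 / 4) ^+ 2 by rewrite ler_pXn2r// nnegrE//; lra.
lra.
Qed.

Lemma edge_norm_cutoff' X e : edge_norm (len e) (cutoff' X e) <=
  4 / len e * ((init e \in X) (+) (term e \in X))%:R.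
Proof.
have l0 := len_gt0 e; have [_ sc'] := CH1_edge_sq (cutoff_CH1 X e).
rewrite edge_normE//.
set b : R := ((_ (+) _)%:R).
have -> : \int[mu]_(x in `[0, len e]) complex.Im (cutoff' X e x) ^+ 2 = 0.
  transitivity (\int[mu]_(x in `[0, len e]) (0 : R)); last by rewrite Rintegral_cst// mul0r.
  by apply: eq_Rintegral => x _; rewrite /= expr0n.
rewrite addr0.
have -> : 4 / len e * b = (4 / len e ^+ 2 * b) * (len e - 0).
  by rewrite subr0; field; rewrite gt_eqF.
rewrite -Rintegral_cst_itv ?(ltW l0)//; apply: le_Rintegral => //.
- by have [[_ h] _] := sc'.
- exact: itv_integrable_cst.
- move=> x /=; rewrite in_itv/= => xl; rewrite exprMn mulrC.
  have -> : (ind X (term e) - ind X (init e)) ^+ 2 = b.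
    rewrite /b /ind; case: (init e \in X); case: (term e \in X) => /=;
      by rewrite ?subrr ?subr0 ?sub0r ?sqrrN ?expr1n ?expr0n.
  by apply: ler_wpM2r; [exact: ler0n|exact: smoothstep'_sq_le].
Qed.

(* Sobolev's inequality on a piece of length [len e / 16] at an end of [e] where
   the cutoff is 1 *)
Lemma edge_norm_cutoff X e :
  len e / 128 * ((init e \in X)%:R + (term e \in X)%:R) <=
  edge_norm (len e) (cutoff X e).
Proof.
have l0 := len_gt0 e; have cc := cutoff_CH1 X e.
have [/orP touch|] := boolP ((init e \in X) || (term e \in X)); last first.
  rewrite negb_or => /andP[/negbTE -> /negbTE ->].
  by rewrite addr0 mulr0; exact: edge_norm_ge0.
have [x xl ux] : exists2 x, 0 <= x <= len e & nsq (cutoff X e x) = 1.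
  have nsqR (c : R) : nsq c%:C = c ^+ 2 by rewrite /nsq /= expr0n/= addr0.
  case: touch => hX; [exists 0|exists (len e)]; rewrite ?in0l ?inll//.
    by rewrite cutoff_init /ind hX nsqR expr1n.
  by rewrite cutoff_term /ind hX nsqR expr1n.
have hl : 0 <= len e / 16 <= len e by lra.
have := CH1_sobolev cc xl hl; rewrite ux mulr1.
have up : edge_norm (len e) (cutoff' X e) <= 4 / len e.
  apply: le_trans (edge_norm_cutoff' X e) _.
  by rewrite ler_piMr ?divr_ge0 ?(ltW l0)//; case: (_ (+) _).
(* Of the [len e / 16] on the left of Sobolev's inequality the energy consumes at most half. The
   norm is thus at least [len e / 64], and 128 accounts for the two endpoints that may lie in
   [X]. *)
have h2 : 2 * (len e / 16) ^+ 2 * edge_norm (len e) (cutoff' X e) <= len e / 32.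
  apply: (@le_trans _ _ (2 * (len e / 16) ^+ 2 * (4 / len e))).
    by apply: ler_wpM2l up; rewrite mulr_ge0// sqr_ge0.
  by rewrite le_eqVlt; apply/orP; left; apply/eqP; field; rewrite gt_eqF.
have h3 : len e / 128 * ((init e \in X)%:R + (term e \in X)%:R) <= len e / 64.
  by case: (_ \in _); case: (_ \in _) => /=; lra.
move: h2 h3; move: (edge_norm _ (cutoff X e)) (edge_norm _ _) => p q; lra.
Qed.

Lemma form_bound_isoperimetric D (C l0 : R) : 0 < C -> form_bound D C ->
  0 < l0 -> (forall e, l0 <= len e) ->
  exists2 c : R, 0 < c & isoperimetric c (~` D).
Proof.
move=> C0 bound l00 lenl0; have c512 : 0 < 512 :> R by rewrite ltr0n.
have c0 : 0 < l0 ^+ 2 / (512 * C).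
  by apply: divr_gt0; [exact: exprn_gt0|exact: (mulr_gt0 c512 C0)].
(* The constant comes from [l0 / 128 * deg_fset X <= C * (4 / l0)] times the boundary size, with
   [512 = 128 * 4]. *)
exists (l0 ^+ 2 / (512 * C)) => // X XD.
have DX v : D v -> v \notin X by move=> Dv; apply/negP => /XD.
have dc := dom_H0_cutoff DX; have [lc lc'] := dom_H0_L2 dc.
have XX : (incident X `<=` incident X)%fset by exact: fsubset_refl.
have lower : l0 / 128 * (deg_fset X)%:R <= nrm2 (cutoff X).
  apply: le_trans (sum_edge_norm_le (incident X) lc).
  rewrite (deg_fset_sum XX) mulr_sumr; apply: ler_sum => e _.
  apply: le_trans (edge_norm_cutoff X e).
  by apply: ler_wpM2r; [rewrite addr_ge0|rewrite ler_pM2r].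
have upper : nrm2 (cutoff' X) <= 4 / l0 * #|` fset_set (edge_boundary X)|%:R.
  have le4 e : 4 / len e * ((init e \in X) (+) (term e \in X))%:R <=
      4 / l0 * ((init e \in X) (+) (term e \in X))%:R.
    apply: ler_wpM2r => //; rewrite ler_pM2l// lef_pV2// posrE//; exact: len_gt0.
  have [_ h] : L2 (cutoff' X) /\
      nrm2 (cutoff' X) <= \sum_(e <- incident X) edge_norm (len e) (cutoff' X e).
    apply: nrm2_fsupport => [e|e]; first exact: L2_edge.
    rewrite incidentP negb_or => /andP[/negbTE iX /negbTE tX].
    apply/eqP; rewrite eq_le edge_norm_ge0 andbT.
    by apply: le_trans (edge_norm_cutoff' X e) _; rewrite iX tX mulr0.
  apply: le_trans h _; rewrite (card_boundary_sum XX) mulr_sumr.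
  by apply: ler_sum => e _; apply: le_trans (edge_norm_cutoff' X e) (le4 e).
have := le_trans lower (le_trans (bound _ _ dc) (ler_wpM2l (ltW C0) upper)).
move: (deg_fset X)%:R #|` fset_set (edge_boundary X)|%:R => d b h.
have k0 : 0 < 128 / l0 * (l0 ^+ 2 / (512 * C)).
  by apply: mulr_gt0 c0; exact: divr_gt0.
have := h; rewrite -(ler_pM2l k0).
have -> : 128 / l0 * (l0 ^+ 2 / (512 * C)) * (l0 / 128 * d) = l0 ^+ 2 / (512 * C) * d.
  by field; rewrite !gt_eqF.
have -> // : 128 / l0 * (l0 ^+ 2 / (512 * C)) * (C * (4 / l0 * b)) = b.
by field; rewrite !gt_eqF.
Qed.

End TestFunctions.

(** * The bottom of the spectrum and the equivalences *)

Section SpectralGap.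
Import Order.TTheory GRing.Theory Num.Theory.
Import numFieldNormedType.Exports.
Local Open Scope classical_set_scope.
Local Open Scope ring_scope.
Local Open Scope complex_scope.
Context {R : realType} {G : metricGraph R}.
Local Notation V := (vertex G).
Local Notation E := (edge G).
Implicit Types (D : set V) (e : E).

Lemma len_inf_gt0 : (0 < len_inf G)%E -> exists2 l0 : R, 0 < l0 & forall e, l0 <= len e.
Proof.
move=> h; have [l0 l00 le0] : exists2 l0 : R, 0 < l0 & (l0%:E <= len_inf G)%E.
  move: h; case: (len_inf G) => [r|_|//]; last by exists 1 => //; rewrite leey.
  by rewrite lte_fin => r0; exists r.
exists l0 => // e; rewrite -lee_fin; apply: le_trans le0 _.
by apply: ereal_inf_lbound; exists e.
Qed.

Lemma len_sup_lty : (len_sup G < +oo)%E -> exists L : R, forall e, len e <= L.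
Proof.
move=> h; have [L Lle] : exists L : R, (len_sup G <= L%:E)%E.
  move: h; case: (len_sup G) => [r _|//|_]; first by exists r.
  by exists 0; rewrite leNye.
exists L => e; rewrite -lee_fin; apply: le_trans _ Lle.
by apply: ereal_sup_ubound; exists e.
Qed.

Lemma inf_real_gt0 (S : set R[i]) : (0 < inf_real S)%E -> ~ S 0.
Proof.
move=> h S0; have : (inf_real S <= 0)%E by apply: ereal_inf_lbound; exists 0.
by rewrite leNgt h.
Qed.

Lemma form_bound_lambda0 D (C : R) : 0 < C -> form_bound D C -> (0 < lambda0 D)%E.
Proof.
move=> C0 bound; have c0 : 0 < (2 * C)^-1 by rewrite invr_gt0 mulr_gt0.
apply: (@lt_le_trans _ _ ((2 * C)^-1)%:E); first by rewrite lte_fin.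
apply: le_ereal_inf_tmp => _ [x Sx <-]; rewrite lee_fin leNgt; apply/negP => xC.
exact: Sx (form_bound_resolvent C0 bound xC).
Qed.

Lemma lambda0_form_bound D : (0 < lambda0 D)%E -> exists2 C : R, 0 < C & form_bound D C.
Proof.
by move=> /inf_real_gt0/contrapT; exact: resolvent_form_bound.
Qed.

Lemma lambda0_le_ess D : (lambda0 D <= lambda0_ess D)%E.
Proof. by apply: ereal_inf_le_tmp => _ [x [Sx _] <-]; exists x. Qed.

Lemma lambda0_ess_gt0 D : (0 < len_inf G)%E -> (0 < lambda0_ess D)%E -> (0 < lambda0 D)%E.
Proof.
move=> /len_inf_gt0[l0 l00 lenl0] /inf_real_gt0 ess0.
suff : resolvent_set (kirchhoff D) 0.
  by move=> /resolvent_form_bound[C C0 bound]; exact: form_bound_lambda0 bound.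
apply: contrapT => S0; apply: ess0; split=> // -[_ _ [f [h K hf] f0] _].
have [[lf _] lh _] := K; move/eqP: f0; apply.
apply: (kirchhoff_injective l00 lenl0 K).
apply/eqP; rewrite -eqe -L2_sqnorm//; apply/eqP; apply: etrans hf; congr sqnorm.
by apply/funext => e; apply/funext => x; rewrite mul0r subr0.
Qed.

End SpectralGap.

Local Open Scope classical_set_scope.
Local Open Scope ereal_scope.

Theorem corollary5p2 (R : realType) (G : metricGraph R)
    (hdeg : forall v : vertex G, deg v <> 2%N)
    (hinf : 0 < len_inf G) (hsup : len_sup G < +oo)
    (D : set (vertex G)) (hD : forall v, D v -> deg v = 1%N) :
  (finite_set D ->
     [<-> 0 < lambda0 D;
          0 < lambda0_ess D;
          0 < alpha_comb [set: vertex G];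
          0 < alpha_comb_ess G]) /\
  [/\ 0 < lambda0 D <-> 0 < lambda0_ess D,
      0 < alpha_comb [set: vertex G] <-> 0 < alpha_comb_ess G &
      0 < alpha_comb [set: vertex G] -> 0 < lambda0 D].
Proof.
have gap_ess : 0 < lambda0 D <-> 0 < lambda0_ess D.
  split; last exact: lambda0_ess_gt0.
  by move=> h; exact: Order.POrderTheory.lt_le_trans h (lambda0_le_ess D).
have comb_ess : 0 < alpha_comb [set: vertex G] <-> 0 < alpha_comb_ess G.
  split; last exact: alpha_comb_of_ess.
  move=> h; apply/alpha_comb_ess_gt0P; exists fset0.
  by rewrite (_ : ~` _ = setT)//; apply/seteqP; split=> v //= _; rewrite in_fset0.
have comb_gap : 0 < alpha_comb [set: vertex G] -> 0 < lambda0 D.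
  move=> /alpha_comb_gt0P[c c0 iso]; have [L lenL] := len_sup_lty hsup.
  by have [C C0 bound] := isoperimetric_form_bound D c0 iso lenL; exact: form_bound_lambda0 bound.
split; last by split.
move=> fD; tfae.
- exact: gap_ess.1.
- move=> /gap_ess.2/lambda0_form_bound[C C0 bound].
  have [l0 l00 lenl0] := len_inf_gt0 hinf.
  (* The finiteness of [D] is used here: it makes [D] an admissible set to discard in
     [alpha_comb_ess]. *)
  apply/comb_ess/alpha_comb_ess_gt0P; exists (fset_set D); rewrite fset_setK//.
  exact/alpha_comb_gt0P/(form_bound_isoperimetric C0 bound l00 lenl0).
- exact: comb_ess.1.
- by move=> /comb_ess.2.
Qed.
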